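(* Let $X$ be a Banach space with a conditional spreading basis $(e_i)_i$, let $(z_i)_i$ be its convex block homogeneous part, and set $Z=[(z_i)_i]$, the closed linear span of $(z_i)_i$. The following hold. (i) If $(e_i)_i$ is strongly summing, then $Z\oplus Z$ does not embed isomorphically into $X$. In particular, $X\oplus X$ does not embed into $X$. (ii) The basis $(e_i)_i$ is not strongly summing if and only if $X$ is isomorphic to $X\oplus X$.
   Context: Banach spaces are real. Two sequences are equivalent if the norms of their finite linear combinations with the same coefficients are comparable up to uniform positive constants. A sequence is spreading (resp. 1-spreading) if it is equivalent (resp. isometrically equivalent) to all of its subsequences. A conditional spreading basis is a Schauder basis that is spreading and not unconditional. A Schauder basic sequence $(e_i)_i$ is strongly summing if for every sequence of real numbers $(a_i)_i$ such that $(\|\sum_{i=1}^na_ie_i\|)_n$ is bounded, the real series $\sum_ia_i$ converges. A convex block sequence of $(x_i)_i$ is a sequence $(w_k)_k$ with $w_k=\sum_{i\in F_k}c_ix_i$, where $F_1<F_2<\cdots$ are successive finite subsets of $\mathbb{N}$, $c_i\geqslant0$ and $\sum_{i\in F_k}c_i=1$. Convex block homogeneous part: let $(e_i)_i$ be a conditional spreading basis of $X$. After passing to an equivalent norm on $X$ with respect to which $(e_i)_i$ is 1-spreading (such a norm exists), let $Z$ be the completion of $c_{00}(\mathbb{N})$, with unit vector basis denoted $(z_i)_i$, under the norm $$\Big\|\sum_{i=1}^na_iz_i\Big\|=\lim_{N\to\infty}\Big\|\sum_{i=1}^na_i\Big(\frac1N\sum_{j=(i-1)N+1}^{iN}e_j\Big)\Big\|=\inf\Big\{\Big\|\sum_{i=1}^na_iw_i\Big\|:(w_i)_{i=1}^n\text{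 is a convex block sequence of }(e_i)_i\Big\}.$$ The sequence $(z_i)_i$, which is well defined up to equivalence, is the convex block homogeneous part of $(e_i)_i$. *)

(* Defs.v *)
From HB Require Import structures.
From mathcomp Require Import all_boot all_order all_algebra.
From mathcomp Require Import all_classical all_reals all_analysis.

Set Implicit Arguments.
Unset Strict Implicit.
Unset Printing Implicit Defensive.

Import Order.TTheory GRing.Theory Num.Theory.
Import numFieldNormedType.Exports.

Local Open Scope classical_set_scope.
Local Open Scope ring_scope.

(* Sequences are indexed from 0. *)

Definition lincomb (R : realType) (X : normedModType R) (n : nat)
    (a : nat -> R) (x : nat -> X) : X :=
  \sum_(i < n) a i *: x i.

Definition equivalent_sequences (R : realType) (X Y : normedModType R)
    (x : nat -> X) (y : nat -> Y) : Prop :=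
  exists c C : R, [/\ 0 < c, 0 < C &
    forall (n : nat) (a : nat -> R),
      c * `|lincomb n a x| <= `|lincomb n a y| <= C * `|lincomb n a x|].

Definition spreading (R : realType) (X : normedModType R) (x : nat -> X) : Prop :=
  forall f : nat -> nat, {homo f : i j / (i < j)%N} ->
    equivalent_sequences x (x \o f).

Definition schauder_basis (R : realType) (X : normedModType R) (e : nat -> X) :
    Prop :=
  forall x : X, exists! a : nat -> R,
    series (fun i => a i *: e i) @ \oo --> x.

(* Every basis expansion converges under every rearrangement of its terms. *)
Definition unconditional_basis (R : realType) (X : normedModType R)
    (e : nat -> X) : Prop :=
  schauder_basis e /\
  forall (a : nat -> R), cvgn (series (fun i => a i *: e i)) ->
    forall s : nat -> nat, bijective s ->
      cvgn (series (fun i => a (s i) *: e (s i))).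

Definition conditional_spreading_basis (R : realType) (X : normedModType R)
    (e : nat -> X) : Prop :=
  [/\ schauder_basis e, spreading e & ~ unconditional_basis e].

(* Meaningful for Schauder basic sequences only, a property which is not part
   of the predicate. *)
Definition strongly_summing (R : realType) (X : normedModType R)
    (e : nat -> X) : Prop :=
  forall a : nat -> R,
    (exists M : R, forall n, `|lincomb n a e| <= M) -> cvgn (series a).

(* [nu] is definite because it dominates a multiple of the given norm. *)
Definition equivalent_norm (R : realType) (X : normedModType R) (nu : X -> R) :
    Prop :=
  [/\ forall x y : X, nu (x + y) <= nu x + nu y,
      forall (a : R) (x : X), nu (a *: x) = `|a| * nu x &
      exists c C : R, [/\ 0 < c, 0 < C &
        forall x : X, c * `|x| <= nu x <= C * `|x|]].

Definition one_spreading_wrt (R : realType) (X : normedModType R) (nu : X -> R)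
    (x : nat -> X) : Prop :=
  forall f : nat -> nat, {homo f : i j / (i < j)%N} ->
    forall (n : nat) (a : nat -> R),
      nu (lincomb n a (x \o f)) = nu (lincomb n a x).

Definition block_average (R : realType) (X : normedModType R) (e : nat -> X)
    (N i : nat) : X :=
  N%:R^-1 *: \sum_(i * N <= j < i.+1 * N) e j.

Definition convex_block_homogeneous_part (R : realType) (X Z : normedModType R)
    (e : nat -> X) (z : nat -> Z) : Prop :=
  exists nu : X -> R, [/\ equivalent_norm nu, one_spreading_wrt nu e &
    forall (n : nat) (a : nat -> R),
      (fun N : nat => nu (lincomb n a (block_average e N))) @ \oo
        --> `|lincomb n a z|].

Definition closed_span (R : realType) (X : normedModType R) (x : nat -> X) :
    set X :=
  closure [set v | exists n a, v = lincomb n a x].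

Definition isomorphic_embedding (R : realType) (X Y : normedModType R)
    (T : {linear X -> Y}) : Prop :=
  exists c C : R, [/\ 0 < c, 0 < C &
    forall x : X, c * `|x| <= `|T x| <= C * `|x|].

Definition embeds (R : realType) (X Y : normedModType R) : Prop :=
  exists T : {linear X -> Y}, isomorphic_embedding T.

Definition isomorphic (R : realType) (X Y : normedModType R) : Prop :=
  exists T : {linear X -> Y}, isomorphic_embedding T /\ bijective T.

(* The library's product of normed spaces carries the max norm, which is
   equivalent to every usual norm on the direct sum. *)
Definition direct_sum (R : realType) (X Y : normedModType R) : normedModType R :=
  (X * Y)%type.

(* Main.v *)
(** The subsequences of a spreading basis [e] are uniformly equivalent, by a
    gliding hump argument. Hence averaging long translates of some of
    the blocks of a finite linear combination does not increase its norm by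
    more than a constant, and replaces these blocks by their sums of
    coefficients times long averages of [e]. It follows that blocks with small
    sums can be suppressed, and that [e] is controlled by its averages together
    with its differences [e (2 i) - e (2 i + 1)], which have arbitrarily small
    convex combinations, as [e] does not dominate the basis of l1.

    If Z + Z embeds in X, some combination [v] of the two copies of [z] loses
    no mass at infinity: the sum of the coordinatewise limits [a] is the limit
    of the sums of the coefficients, the former existing because [e] is
    strongly summing. Then [v n] is asymptotically an initial segment of [a]
    plus a hump with almost vanishing sum. Convex combinations make the humps
    small, while signed combinations of the initial segments stay bounded, so
    that an alternating series of convex blocks of [e] is bounded, against
    strong summability.

    If [e] is not strongly summing, averaging an oscillating bounded series
    shows that the norm is equivalent to the maximum of the supremum of the
    partial sums and of the norm on the differences. The partial sums of two
    sequences can then be recorded by a single one, obtained by interleaving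
    longer and longer blocks of both, up to corrections by convex combinations
    whose differences are small; this gives a basis of X + X equivalent to
    [e]. *)

Require Import Defs.
From HB Require Import structures.
From mathcomp Require Import all_boot all_order all_algebra.
From mathcomp Require Import all_classical all_reals all_analysis.
From mathcomp Require Import ring lra zify.

Set Implicit Arguments.
Unset Strict Implicit.
Unset Printing Implicit Defensive.

Import Order.TTheory GRing.Theory Num.Theory.
Import numFieldNormedType.Exports.

Local Open Scope classical_set_scope.
Local Open Scope ring_scope.

(** * Sequences, linear combinations and averages *)

(** The norm of [X] is never changed. Every estimate holds for the given norm up to a constant, and
    the renorming behind the homogeneous part costs only its two equivalence constants.
    Conditionality is used in one form: averages over two disjoint windows stay uniformly apart.
    This turns prefix sums of coefficients into bounded functionals, so that suppressing a block can
    be paid for by its sum. In the other direction, masked combinations of the differences are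
    always dominated by [e]. The homogeneous part enters only through two estimates: [z] is
    dominated by [e], and [e] is dominated by [z] together with the differences. Both are trivial
    for [z = e], so that one argument excludes Z + Z and X + X at once, and the latter is also what
    is needed for the converse in (ii). Two copies are needed because the mass lost at infinity is
    one scalar per copy. A single scalar may be nonzero, but two scalars always satisfy a nontrivial
    linear relation, and this relation selects the combination to study. *)

Lemma cvg_natP (R : realType) (V : normedModType R) (u : nat -> V) (l : V) :
  u @ \oo --> l <->
  forall eps : R, 0 < eps -> exists N, forall n, (N <= n)%N -> `|l - u n| <= eps.
Proof.
split=> [/cvgrPdist_le H eps e0|H].
  by have [N _ HN] := H _ e0; exists N => n Nn; exact: HN.
apply/cvgrPdist_le => eps e0; have [N HN] := H _ e0.
by exists N => // n /=; exact: HN.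
Qed.

Lemma cvg_nat_cauchyP (R : realType) (V : completeNormedModType R)
    (u : nat -> V) :
  cvgn u <->
  forall eps : R, 0 < eps -> exists N, forall m n, (N <= m)%N -> (N <= n)%N ->
    `|u m - u n| <= eps.
Proof.
split=> [/cvg_ex[l /cvg_natP H] eps e0|H].
  have e20 : 0 < eps / 2 by rewrite divr_gt0.
  have [N HN] := H _ e20; exists N => m n Nm Nn.
  rewrite -(subrKA l) (le_trans (ler_normD _ _))// (splitr eps) lerD ?HN//.
  by rewrite distrC HN.
apply/cauchy_cvgP/cauchyP => eps e0.
have e20 : 0 < eps / 2 by rewrite divr_gt0.
have [N HN] := H _ e20; exists (u N).
exists N => // n /= Nn; rewrite -ball_normE /=.
by rewrite (le_lt_trans (HN _ _ (leqnn N) Nn))// ltr_pdivrMr// ltr_pMr// ltr1n.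
Qed.

Lemma cvg_comb (R : realType) (V : normedModType R) (u v : nat -> V) (l m : V) (al be : R) :
  u @ \oo --> l -> v @ \oo --> m ->
  (fun i => al *: u i + be *: v i) @ \oo --> al *: l + be *: m.
Proof. by move=> ul vm; apply: cvgD; apply: cvgZl_tmp. Qed.

Lemma dependent_choice_nat (T : Type) (r : nat -> T -> T -> Prop) (s0 : T) :
  (forall i s, exists s', r i s s') ->
  exists f : nat -> T, f 0 = s0 /\ forall i, r i (f i) (f i.+1).
Proof.
move=> H.
have H' (p : nat * T) : exists s', r p.1 p.2 s' by exact: H.
have [F HF] := choice H'.
exists (fun n => nat_rect (fun=> T) s0 (fun i s => F (i, s)) n); split=> // i.
exact: (HF (i, _)).
Qed.

(** Takes the place of the limits over window lengths [N]: averaging costs an error [c / N] whose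
    [c] may depend on the coefficients but not on [N]. *)
Lemma le_add_divn (R : realType) (x y c : R) :
  (forall N : nat, (0 < N)%N -> x <= y + c / N%:R) -> x <= y.
Proof.
move=> H; rewrite leNgt; apply/negP => xy.
have d0 : 0 < x - y by rewrite subr_gt0.
pose N := (Num.bound `|c / (x - y)|).+1.
have Nc : c / (x - y) < N%:R.
  apply: (le_lt_trans (ler_norm _)).
  by rewrite (lt_trans (archi_boundP (normr_ge0 _)))// ltr_nat.
have := H N isT; rewrite leNgt => /negP; apply.
rewrite -ltrBrDl ltr_pdivrMr ?ltr0n// mulrC.
by move: Nc; rewrite ltr_pdivrMr.
Qed.

Lemma le_addM_gt0 (R : realType) (x y c : R) :
  (forall eps, 0 < eps -> x <= y + c * eps) -> x <= y.
Proof.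
by move=> H; apply: (@le_add_divn _ _ _ c) => N N0; apply: H; rewrite invr_gt0 ltr0n.
Qed.

Lemma sum_half_le (R : realType) n : \sum_(i < n) (2^-1 : R) ^+ i <= 2.
Proof.
suff -> : \sum_(i < n) (2^-1 : R) ^+ i = 2 - 2 * 2^-1 ^+ n.
  by rewrite gerBl mulr_ge0// exprn_ge0// invr_ge0.
elim: n => [|n IH]; first by rewrite big_ord0 expr0; lra.
by rewrite big_ord_recr /= IH exprS; lra.
Qed.

Lemma half_exp_le (R : realType) i j : (i <= j)%N -> (2^-1 : R) ^+ j <= 2^-1 ^+ i.
Proof.
by move=> ij; apply: ler_wiXn2l; rewrite // ?invr_ge0 ?invf_le1 ?ler1n.
Qed.

Lemma half_exp_gt0 (R : realType) i : 0 < (2^-1 : R) ^+ i.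
Proof. by rewrite exprn_gt0// invr_gt0. Qed.

Lemma homo_ltnS (f : nat -> nat) :
  (forall i, (f i < f i.+1)%N) -> {homo f : i j / (i < j)%N}.
Proof. by move=> H; apply: homo_ltn => // y x z; exact: ltn_trans. Qed.

Lemma homo_leq_ltn (f : nat -> nat) :
  {homo f : i j / (i < j)%N} -> {homo f : i j / (i <= j)%N}.
Proof.
by move=> H i j; rewrite leq_eqVlt => /orP[/eqP->//|/H /ltnW].
Qed.

Lemma homo_ltn_geq (f : nat -> nat) :
  {homo f : i j / (i < j)%N} -> forall n, (n <= f n)%N.
Proof.
by move=> H; elim=> // n IH; rewrite (leq_ltn_trans IH)// H.
Qed.

Lemma homo_ltn_inj (f : nat -> nat) :
  {homo f : i j / (i < j)%N} -> injective f.
Proof.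
move=> H i j fij; case: (ltngtP i j) => // /H; rewrite fij ltnn//.
Qed.

Lemma big_ord_double (U : nmodType) (F : nat -> U) n :
  \sum_(k < n.*2) F k = \sum_(i < n) (F i.*2 + F i.*2.+1).
Proof.
elim: n => [|n IH]; first by rewrite !big_ord0.
by rewrite doubleS !big_ord_recr /= IH addrA.
Qed.

Lemma big_ord_mul (V : nmodType) (F : nat -> V) n N :
  \sum_(t < n * N) F t = \sum_(i < n) \sum_(j < N) F (i * N + j)%N.
Proof.
elim: n => [|n IH]; first by rewrite mul0n !big_ord0.
rewrite big_ord_recr /= -IH mulSnr -!(big_mkord xpredT F).
rewrite (@big_cat_nat _ _ _ (n * N) 0 (n * N + N)) ?leq_addr//=; congr (_ + _).
rewrite -{1}[(n * N)%N]add0n big_addn addKn big_mkord.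
by apply: eq_bigr => j _; rewrite addnC.
Qed.

(** * Partitions of the natural numbers into successive intervals *)

Section partition_of_nat.
Variable M : nat -> nat.
Hypotheses (M0 : M 0 = 0%N) (Mlt : {homo M : i j / (i < j)%N}).

(** The search may stop at [n], since an increasing [M] satisfies [n < M n.+1]. *)
Definition block_of (n : nat) : nat := find (fun k => (n < M k.+1)%N) (iota 0 n.+1).

Lemma block_ofP n : (M (block_of n) <= n < M (block_of n).+1)%N.
Proof.
have Hh : has (fun k => (n < M k.+1)%N) (iota 0 n.+1).
  apply/hasP; exists n; first by rewrite mem_iota add0n ltnS leqnn.
  by rewrite (leq_trans _ (homo_ltn_geq Mlt n.+1)).
have := nth_find 0 Hh; rewrite -/(block_of n).
have lt : (block_of n < n.+1)%N by rewrite -[X in (_ < X)%N](size_iota 0) -has_find.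
rewrite nth_iota// add0n => -> /=; rewrite andbT.
case E : (block_of n) => [|k]; first by rewrite M0.
rewrite leqNgt; apply/negP => H.
have := @before_find _ 0 (fun k => (n < M k.+1)%N) (iota 0 n.+1) k.
rewrite -/(block_of n) E ltnSn => /(_ isT).
by rewrite nth_iota ?add0n ?H// (leq_trans _ lt)// E.
Qed.

Lemma block_of_uniq n k : (M k <= n < M k.+1)%N -> block_of n = k.
Proof.
have /andP[h1 h2] := block_ofP n => /andP[h3 h4].
apply/eqP; rewrite eqn_leq; apply/andP; split; rewrite leqNgt; apply/negP => H.
  have := homo_leq_ltn Mlt H; lia.
have := homo_leq_ltn Mlt H; lia.
Qed.

Lemma block_of_eq n k : (block_of n == k) = (M k <= n < M k.+1)%N.
Proof.
by apply/eqP/idP => [<-|/block_of_uniq//]; exact: block_ofP.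
Qed.

Lemma block_of_homo : {homo block_of : m n / (m <= n)%N}.
Proof.
move=> m n mn; rewrite leqNgt; apply/negP => /(homo_leq_ltn Mlt) H.
have := block_ofP m; have := block_ofP n; lia.
Qed.

Lemma block_of_lt n k : (block_of n < k)%N = (n < M k)%N.
Proof.
have /andP[h1 h2] := block_ofP n.
apply/idP/idP => [/(homo_leq_ltn Mlt)|h]; first lia.
rewrite ltnNge; apply/negP => /(homo_leq_ltn Mlt); lia.
Qed.

Lemma big_partition_nat (V : nmodType) (F : nat -> V) I :
  \sum_(i < M I) F i = \sum_(i < I) \sum_(M i <= n < M i.+1) F n.
Proof.
elim: I => [|I IH]; first by rewrite M0 !big_ord0.
rewrite big_ord_recr /= -IH -!(big_mkord xpredT F).
rewrite (@big_cat_nat _ _ _ (M I) 0 (M I.+1)) //=.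
exact/ltnW/Mlt.
Qed.

Lemma big_block (V : nmodType) (F : nat -> V) I k : (k < I)%N ->
  \sum_(i < M I | block_of i == k) F i = \sum_(M k <= i < M k.+1) F i.
Proof.
move=> kI; have Mk := homo_leq_ltn Mlt kI.
rewrite -(big_mkord (fun i => block_of i == k) F).
rewrite (@big_cat_nat _ _ _ (M k.+1)) //= [X in _ + X]big1_seq ?addr0; last first.
  move=> i; rewrite mem_index_iota block_of_eq; lia.
rewrite (@big_cat_nat _ _ _ (M k)) //=; last exact/ltnW/Mlt.
rewrite [X in X + _]big1_seq ?add0r; last first.
  move=> i; rewrite mem_index_iota block_of_eq; lia.
rewrite big_seq_cond [RHS]big_seq; apply: eq_bigl => i.
by rewrite mem_index_iota block_of_eq andbb.
Qed.

End partition_of_nat.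

Section lincomb_theory.
Variables (R : realType) (X : normedModType R).
Implicit Types (x y : nat -> X) (a b : nat -> R) (n : nat).

Lemma lincombDl n a b x :
  lincomb n (fun i => a i + b i) x = lincomb n a x + lincomb n b x.
Proof. by rewrite /lincomb -big_split; apply: eq_bigr => i _; rewrite scalerDl. Qed.

Lemma lincombDr n a x y :
  lincomb n a (fun i => x i + y i) = lincomb n a x + lincomb n a y.
Proof. by rewrite /lincomb -big_split; apply: eq_bigr => i _; rewrite scalerDr. Qed.

Lemma lincombBr n a x y :
  lincomb n a (fun i => x i - y i) = lincomb n a x - lincomb n a y.
Proof. by rewrite /lincomb -sumrB; apply: eq_bigr => i _; rewrite scalerBr. Qed.

Lemma lincombBl n a b x :
  lincomb n (fun i => a i - b i) x = lincomb n a x - lincomb n b x.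
Proof. by rewrite /lincomb -sumrB; apply: eq_bigr => i _; rewrite scalerBl. Qed.

Lemma lincombZl n (k : R) a x :
  lincomb n (fun i => k * a i) x = k *: lincomb n a x.
Proof. by rewrite /lincomb scaler_sumr; apply: eq_bigr => i _; rewrite scalerA. Qed.

Lemma lincombNl n a x : lincomb n (fun i => - a i) x = - lincomb n a x.
Proof. by rewrite /lincomb -sumrN; apply: eq_bigr => i _; rewrite scaleNr. Qed.

Lemma eq_lincomb n a b x y : (forall i, (i < n)%N -> a i *: x i = b i *: y i) ->
  lincomb n a x = lincomb n b y.
Proof. by move=> H; apply: eq_bigr => i _; rewrite H. Qed.

Lemma lincomb_widen m n a x : (m <= n)%N ->
  lincomb m a x = lincomb n (fun i => if (i < m)%N then a i else 0) x.
Proof.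
move=> mn; rewrite /lincomb (big_ord_widen _ (fun i => a i *: x i) mn) big_mkcond.
by apply: eq_bigr => i _; case: ifP => //; rewrite scale0r.
Qed.

Lemma norm_lincomb_le n a x (B : R) : (forall i, (i < n)%N -> `|x i| <= B) ->
  `|lincomb n a x| <= B * \sum_(i < n) `|a i|.
Proof.
move=> HB; rewrite (le_trans (ler_norm_sum _ _ _))// mulr_sumr ler_sum// => i _.
by rewrite normrZ mulrC ler_wpM2r// HB.
Qed.

End lincomb_theory.

Lemma seriesE (R : realType) (X : normedModType R) (a : nat -> R) (e : nat -> X) n :
  series (fun i => a i *: e i) n = lincomb n a e.
Proof. by rewrite /series /= big_mkord. Qed.

(* The coefficients that place [a] at the positions [f]. *)
Definition scatter (R : realType) (f : nat -> nat) (n : nat) (a : nat -> R) (m : nat) : R :=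
  \sum_(i < n | f i == m) a i.

(** Carries a domination between two sequences over to their subsequences along the same [f]. *)
Lemma lincomb_scatter (R : realType) (X : normedModType R) (x : nat -> X) f n
    (a : nat -> R) N : (forall i, (i < n)%N -> (f i < N)%N) ->
  lincomb N (scatter f n a) x = lincomb n a (x \o f).
Proof.
move=> fN; rewrite /lincomb /scatter.
under eq_bigr do rewrite scaler_suml big_mkcond.
rewrite exchange_big /=; apply: eq_bigr => i _.
rewrite -big_mkcond (big_pred1 (Ordinal (fN i (ltn_ord i)))) //=.
Qed.

(** * Averages *)

Definition average (R : realType) (X : normedModType R) (N : nat) (f : nat -> X) : X :=
  N%:R^-1 *: \sum_(j < N) f j.

Section average_theory.
Variables (R : realType) (X : normedModType R).
Implicit Types (f g : nat -> X).

Lemma average_const N (x : X) : (0 < N)%N -> average N (fun=> x) = x.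
Proof.
move=> N0; rewrite /average sumr_const card_ord -[x *+ N]scaler_nat scalerA mulVf ?scale1r//.
by rewrite pnatr_eq0 -lt0n.
Qed.

Lemma averageB N f g : average N (fun j => f j - g j) = average N f - average N g.
Proof. by rewrite /average sumrB scalerBr. Qed.

Lemma average_lincomb N n (a : nat -> R) (F : nat -> nat -> X) :
  average N (fun j => lincomb n a (F j)) =
  lincomb n a (fun i => average N (fun j => F j i)).
Proof.
rewrite /average /lincomb exchange_big scaler_sumr; apply: eq_bigr => i _.
by rewrite -scaler_sumr !scalerA mulrC.
Qed.

Lemma norm_average_le N f (M : R) : (0 < N)%N ->
  (forall j, (j < N)%N -> `|f j| <= M) -> `|average N f| <= M.
Proof.
move=> N0 HM; rewrite normrZ ger0_norm ?invr_ge0 ?ler0n//.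
rewrite mulrC ler_pdivrMr ?ltr0n// (le_trans (ler_norm_sum _ _ _))//.
rewrite (@le_trans _ _ (\sum_(j < N) M))//; first by apply: ler_sum => j _; exact: HM.
by rewrite sumr_const card_ord mulr_natr.
Qed.

Lemma block_averageE (e : nat -> X) N k :
  block_average e N k = average N (fun j => e (k * N + j)%N).
Proof.
rewrite /block_average /average -{1}[(k * N)%N]add0n big_addn mulSn addnK.
rewrite big_mkord; congr (_ *: _); apply: eq_bigr => j _.
by rewrite addnC.
Qed.

(* Shifting the window changes at most [2 i] of its terms. *)
Lemma average_shift (e : nat -> X) (B : R) N k i : (0 < N)%N ->
  (forall j, `|e j| <= B) ->
  `|average N (fun j => e (k + i + j)%N) - average N (fun j => e (k + j)%N)|
    <= 2 * i%:R * B / N%:R.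
Proof.
move=> N0 eB; rewrite /average -scalerBr normrZ ger0_norm ?invr_ge0 ?ler0n//.
rewrite mulrC ler_wpM2r ?invr_ge0 ?ler0n//.
elim: i => [|i IH].
  rewrite addn0 subrr normr0 mulr0 mul0r//.
have -> : \sum_(j < N) e (k + i.+1 + j)%N - \sum_(j < N) e (k + j)%N =
    (\sum_(j < N) e (k + i + j)%N - \sum_(j < N) e (k + j)%N) +
    (e (k + i + N)%N - e (k + i)%N).
  have H : \sum_(j < N) e (k + i.+1 + j)%N + e (k + i)%N =
           \sum_(j < N) e (k + i + j)%N + e (k + i + N)%N.
    rewrite -(big_ord_recr N (fun j => e (k + i + j)%N)) big_ord_recl /= addn0.
    by rewrite addrC; congr (_ + _); apply: eq_bigr => j _; rewrite /bump /=; congr e; lia.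
  move/(canRL (addrK _)): H => ->.
  by rewrite -addrA [- _ - _]addrC addrACA.
rewrite (le_trans (ler_normD _ _))//.
have -> : 2 * i.+1%:R * B = 2 * i%:R * B + 2 * B by rewrite -natr1; ring.
rewrite lerD// (le_trans (ler_normB _ _))//.
by have := eB (k + i)%N; have := eB (k + i + N)%N; lra.
Qed.

End average_theory.

(** * Spreading sequences *)

Definition uniformly_spreading (R : realType) (X : normedModType R)
    (K : R) (e : nat -> X) : Prop :=
  forall f g : nat -> nat, {homo f : i j / (i < j)%N} ->
    {homo g : i j / (i < j)%N} ->
  forall n a, `|lincomb n a (e \o f)| <= K * `|lincomb n a (e \o g)|.

(* Otherwise there are pairs of tuples of positions, beyond any prescribed
   position, whose linear combinations are less and less comparable; glued
   together, they give two inequivalent subsequences. *)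
Lemma spreading_uniform (R : realType) (X : normedModType R) (e : nat -> X) :
  spreading e -> exists2 K : R, 0 < K & uniformly_spreading K e.
Proof.
move=> esp; apply: contrapT => nK.
pose T := (nat * (nat -> R) * (nat -> nat) * (nat -> nat))%type.
pose bad (k : nat) (s s' : T) :=
  let: (n, a, f, g) := s in let: (n', a', f', g') := s' in
  [/\ {homo f' : i j / (i < j)%N} /\ {homo g' : i j / (i < j)%N},
      (f n < f' 0)%N, (g n < g' 0)%N &
      k%:R * `|lincomb n' a' (e \o g')| < `|lincomb n' a' (e \o f')| ].
have next k s : exists s', bad k s s'.
  case: s => [[[n a] f] g].
  (* The shift [tau] moves a bad pair beyond all earlier positions. As [e] is equivalent to its
     shift, this costs a factor [C / c], which is put into the constant refuted beforehand; [k.+1]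
     keeps that constant positive. *)
  pose m := (f n + g n).+1; pose tau i := (i + m)%N.
  have tau_lt : {homo tau : i j / (i < j)%N} by move=> i j; rewrite ltn_add2r.
  have [c [C [c0 C0 H]]] := esp _ tau_lt.
  have : ~ uniformly_spreading (k.+1%:R * C / c) e.
    by move=> h; apply: nK; exists (k.+1%:R * C / c) => //; rewrite divr_gt0// mulr_gt0.
  move=> /existsNP[f' /existsNP[g' /not_implyP[f'lt /not_implyP[g'lt]]]].
  move=> /existsNP[n' /existsNP[a' /negP]]; rewrite -ltNge => hlt.
  exists (n', a', tau \o f', tau \o g'); split.
  - by split=> i j ij /=; apply: tau_lt; [apply: f'lt|apply: g'lt].
  - rewrite /= /tau /m; lia.
  - rewrite /= /tau /m; lia.
  have Hf N : (forall i, (i < n')%N -> (f' i < N)%N) ->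
      c * `|lincomb n' a' (e \o f')| <= `|lincomb n' a' (e \o (tau \o f'))|.
    move=> fN; rewrite -(lincomb_scatter e a' fN).
    by rewrite (_ : e \o (tau \o f') = (e \o tau) \o f')// -(lincomb_scatter _ a' fN);
       have /andP[] := H N (scatter f' n' a').
  have Hg N : (forall i, (i < n')%N -> (g' i < N)%N) ->
      `|lincomb n' a' (e \o (tau \o g'))| <= C * `|lincomb n' a' (e \o g')|.
    move=> gN; rewrite -(lincomb_scatter e a' gN).
    by rewrite (_ : e \o (tau \o g') = (e \o tau) \o g')// -(lincomb_scatter _ a' gN);
       have /andP[] := H N (scatter g' n' a').
  apply: lt_le_trans (Hf (f' n') _); last by move=> i; exact: f'lt.
  apply: le_lt_trans (_ : k%:R * (C * `|lincomb n' a' (e \o g')|) < _).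
    by rewrite ler_wpM2l// (Hg (g' n'))// => i; exact: g'lt.
  move: hlt; rewrite -(ltr_pM2l c0); apply: le_lt_trans.
  set y := `|_|; have y0 : 0 <= y by exact: normr_ge0.
  have -> : c * (k.+1%:R * C / c * y) = k.+1%:R * (C * y) by field; lra.
  by rewrite ler_wpM2r ?ler_nat// mulr_ge0// ltW.
have [s [s0 sbad]] := dependent_choice_nat (0%N, (fun=> 0), id, id) next.
pose n i := (s i.+1).1.1.1; pose a i := (s i.+1).1.1.2.
pose f i := (s i.+1).1.2; pose g i := (s i.+1).2.
have flt i : {homo f i : i j / (i < j)%N}.
  by have := sbad i; rewrite /f /bad; case: (s i) => [[[? ?] ?] ?];
    case: (s i.+1) => [[[? ?] ?] ?] [[]].
have glt i : {homo g i : i j / (i < j)%N}.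
  by have := sbad i; rewrite /g /bad; case: (s i) => [[[? ?] ?] ?];
    case: (s i.+1) => [[[? ?] ?] ?] [[]].
have fS i : (f i (n i) < f i.+1 0)%N.
  by have := sbad i.+1; rewrite /f /n /bad; case: (s i.+1) => [[[? ?] ?] ?];
    case: (s i.+2) => [[[? ?] ?] ?] [].
have gS i : (g i (n i) < g i.+1 0)%N.
  by have := sbad i.+1; rewrite /g /n /bad; case: (s i.+1) => [[[? ?] ?] ?];
    case: (s i.+2) => [[[? ?] ?] ?] [].
have hbad i : i%:R * `|lincomb (n i) (a i) (e \o g i)| < `|lincomb (n i) (a i) (e \o f i)|.
  by have := sbad i; rewrite /f /g /n /a /bad; case: (s i) => [[[? ?] ?] ?];
    case: (s i.+1) => [[[? ?] ?] ?] [].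
have n0 i : (0 < n i)%N.
  rewrite lt0n; apply/eqP => ni0; have := hbad i.
  by rewrite ni0 /lincomb !big_ord0 normr0 mulr0 ltxx.
pose M k := (\sum_(i < k) n i)%N.
have M0 : M 0 = 0%N by rewrite /M big_ord0.
have MS k : M k.+1 = (M k + n k)%N by rewrite /M big_ord_recr.
have Mlt : {homo M : i j / (i < j)%N}.
  by apply: homo_ltnS => i; rewrite MS -[X in (X < _)%N]addn0 ltn_add2l.
pose glue (h : nat -> nat -> nat) m := h (block_of M m) (m - M (block_of M m))%N.
have glueE h k i : (i < n k)%N -> glue h (M k + i)%N = h k i.
  move=> ik; have -> : glue h (M k + i)%N = h k (M k + i - M k)%N.
    by rewrite /glue (@block_of_uniq M M0 Mlt _ k)// MS; lia.
  by rewrite addKn.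
have glue_lt h : (forall i, {homo h i : i j / (i < j)%N}) ->
    (forall i, (h i (n i) < h i.+1 0)%N) -> {homo glue h : i j / (i < j)%N}.
  move=> hlt hS; apply: homo_ltnS => i.
  have := block_ofP M0 Mlt i; set k := block_of M i; rewrite MS => Hk.
  have -> : i = (M k + (i - M k))%N by lia.
  rewrite glueE; last lia.
  have [lt|ge] := ltnP (i - M k).+1 (n k).
    by rewrite -addnS glueE//; exact: hlt.
  have -> : (M k + (i - M k)).+1 = (M k.+1 + 0)%N by rewrite MS; lia.
  rewrite glueE ?n0//; apply: leq_trans (hS k); rewrite ltnS.
  by apply: (homo_leq_ltn (hlt k)); lia.
have [c [C [c0 C0 HF]]] := esp _ (glue_lt f flt fS).
have [c' [C' [c'0 C'0 HG]]] := esp _ (glue_lt g glt gS).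
(* Both glued subsequences are equivalent to [e], hence comparable with constant [C / c']. The
   tuples of any block [k] beyond this constant contradict it. *)
pose k := Num.bound (C / c').
have kC : C / c' < k%:R by apply: archi_boundP; rewrite divr_ge0// ltW.
have := hbad k; apply/negP; rewrite -leNgt.
have pN i : (i < n k)%N -> (M k + i < M k.+1)%N by rewrite MS ltn_add2l.
have E h : lincomb (n k) (a k) (e \o h k) =
    lincomb (M k.+1) (scatter (fun i => M k + i)%N (n k) (a k)) (e \o glue h).
  rewrite lincomb_scatter//; apply: eq_lincomb => i ik /=.
  by rewrite glueE.
rewrite !E; set b := scatter _ _ _.
have /andP[_ h1] := HF (M k.+1) b.
have /andP[h2 _] := HG (M k.+1) b.
rewrite (le_trans h1)//; move: h2; rewrite -ler_pdivlMl// => h2.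
apply: (@le_trans _ _ (C * (c'^-1 * `|lincomb (M k.+1) b (e \o glue g)|))).
  by rewrite ler_wpM2l// ltW.
by rewrite mulrA ler_wpM2r// ltW.
Qed.

(** The pairs are disjoint, so that spreading allows them to be moved to any interlaced pairs of
    positions. *)
Definition differences (R : realType) (X : normedModType R) (e : nat -> X) (i : nat) : X :=
  e i.*2 - e i.*2.+1.

Section uniformly_spreading_theory.
Variables (R : realType) (X : normedModType R) (e : nat -> X) (K : R).
Hypotheses (K0 : 0 < K) (eK : uniformly_spreading K e).

Let idlt : {homo id : i j / (i < j)%N}. Proof. by []. Qed.

Lemma spread_le f n a : {homo f : i j / (i < j)%N} ->
  `|lincomb n a (e \o f)| <= K * `|lincomb n a e|.
Proof. by move=> f_lt; exact: (eK f_lt idlt). Qed.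

Lemma le_spread f n a : {homo f : i j / (i < j)%N} ->
  `|lincomb n a e| <= K * `|lincomb n a (e \o f)|.
Proof. by move=> f_lt; exact: (eK idlt f_lt). Qed.

Lemma spreading_bounded : exists2 B : R, 0 < B & forall i, `|e i| <= B.
Proof.
exists (K * `|e 0| + 1) => [|i]; first by rewrite ltr_wpDl// mulr_ge0// ltW.
have f_lt : {homo addn i : m n / (m < n)%N} by move=> m n; rewrite ltn_add2l.
have := spread_le 1 (fun=> 1) f_lt.
by rewrite /lincomb !big_ord1 /= !scale1r addn0 => /le_trans; apply; rewrite lerDl.
Qed.

(** Interlaced [f] and [g] merge into one increasing sequence of positions, along which every
    coefficient occurs twice, with opposite signs. Uniform spreading then compares any two such
    families of pairs. *)
Lemma lincomb_differences f g n a : (forall i, (f i < g i < f i.+1)%N) ->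
  exists h, {homo h : i j / (i < j)%N} /\
  lincomb n a (fun i => e (f i) - e (g i)) =
  lincomb n.*2 (fun t => (-1) ^+ odd t * a t./2) (e \o h).
Proof.
move=> fg; exists (fun t => if odd t then g t./2 else f t./2); split.
  apply: homo_ltnS => t; rewrite /= uphalf_half.
  by case: (odd t) => /=; have := fg t./2; rewrite ?add1n ?add0n => /andP[].
elim: n => [|n IH]; first by rewrite /lincomb !big_ord0.
rewrite doubleS /lincomb !big_ord_recr /= -/(lincomb _ _ _) in IH *.
rewrite -!/(lincomb _ _ _) in IH *.
rewrite /lincomb in IH *; rewrite IH !odd_double /= uphalf_double doubleK.
by rewrite expr0 mul1r expr1 mulN1r scaleNr scalerBr addrA.
Qed.

Lemma differences_spread f g n a : (forall i, (f i < g i < f i.+1)%N) ->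
  `|lincomb n a (fun i => e (f i) - e (g i))| <= K * `|lincomb n a (differences e)|.
Proof.
move=> fg; have [h [h_lt ->]] := lincomb_differences n a fg.
have [|h' [h'_lt E]] := @lincomb_differences double (fun i => i.*2.+1) n a.
  by move=> i; rewrite ltnS leqnn doubleS ltnS ltnSn.
by rewrite [X in _ <= K * `|X|]E; exact: eK.
Qed.

Lemma le_differences_spread f g n a : (forall i, (f i < g i < f i.+1)%N) ->
  `|lincomb n a (differences e)| <= K * `|lincomb n a (fun i => e (f i) - e (g i))|.
Proof.
move=> fg; have [h [h_lt ->]] := lincomb_differences n a fg.
have [|h' [h'_lt E]] := @lincomb_differences double (fun i => i.*2.+1) n a.
  by move=> i; rewrite ltnS leqnn doubleS ltnS ltnSn.
by rewrite [X in `|X| <= _]E; exact: eK.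
Qed.

(* Moving only the coefficients in [P] from even to odd positions. *)
Lemma differences_mask (P : pred nat) n a :
  `|lincomb n (fun i => if P i then a i else 0) (differences e)|
    <= 2 * K * `|lincomb n a e|.
Proof.
have -> : lincomb n (fun i => if P i then a i else 0) (differences e) =
    lincomb n a (e \o double) - lincomb n a (e \o (fun i => i.*2 + P i)%N).
  rewrite -lincombBr; apply: eq_lincomb => i _ /=; rewrite /differences.
  by case: (P i); rewrite ?addn1// addn0 subrr scaler0 scale0r.
rewrite (le_trans (ler_normB _ _))// -mulrA mulr_natl mulr2n lerD// spread_le//.
  by move=> i j; rewrite ltn_double.
apply: homo_ltnS => i; rewrite doubleS.
by case: (P i); case: (P i.+1); lia.
Qed.

(** Masking all coordinates but one leaves [a i] times a single difference, whose norm is bounded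
    below by spreading, as that of [e 0 - e 1] is positive. *)
Lemma le_coef : e 0 != e 1 ->
  exists2 C : R, 0 < C & forall n a i, (i < n)%N -> `|a i| <= C * `|lincomb n a e|.
Proof.
rewrite -subr_eq0 -normr_gt0 => e01.
exists (2 * K * K / `|e 0 - e 1|) => [|n a i i_n]; first by rewrite divr_gt0// !mulr_gt0.
rewrite mulrAC ler_pdivlMr//.
have H1 : `|e 0 - e 1| <= K * `|differences e i|.
  have f_lt : {homo addn i.*2 : m n / (m < n)%N} by move=> u v; rewrite ltn_add2l.
  have := le_spread 2 (fun k => (-1) ^+ k) f_lt.
  rewrite /lincomb !big_ord_recr !big_ord0 /= !add0r.
  by rewrite expr0 expr1 !scale1r !scaleN1r addn0 addn1.
have := differences_mask (pred1 i) n a.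
rewrite {1}/lincomb (bigD1 (Ordinal i_n))//= eqxx big1 => [|j ji]; last first.
  by rewrite ifN ?scale0r// -val_eqE.
rewrite addr0 normrZ => H2.
apply: (@le_trans _ _ (`|a i| * (K * `|differences e i|))); first by rewrite ler_wpM2l.
by rewrite mulrCA; have := ler_wpM2l (ltW K0) H2; lra.
Qed.

Lemma norm_block_average_le (B : R) N k : (0 < N)%N -> (forall i, `|e i| <= B) ->
  `|block_average e N k| <= B.
Proof. by move=> N0 eB; rewrite block_averageE norm_average_le. Qed.

(** Each translate of the averaged blocks still sits at increasing positions, so it costs at most
    [K], and so does the mean over [N] translates. The windows obtained start [i] places late, which
    is an error of order [i / N]. The constant [c] is chosen before [blk], [P] and [N], so that
    several placements can be compared and [N] can tend to infinity. *)
Lemma averaging n a : exists c : R, forall (blk : nat -> nat) (P : pred nat),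
  {homo blk : i j / (i <= j)%N} -> forall N, (0 < N)%N ->
  `|lincomb n a (fun i => if P (blk i) then block_average e N (blk i)
                          else e (blk i * N + i)%N)|
    <= K * `|lincomb n a e| + c / N%:R.
Proof.
have [B B0 eB] := spreading_bounded.
exists (2 * n%:R * B * \sum_(i < n) `|a i|) => blk P blk_le N N0.
(* The summand [i] keeps positions distinct inside a block. A translate by [j < N] does not reach
   the next block, which starts at least [N] places later. *)
pose pos j i := (blk i * N + i + (if P (blk i) then j else 0))%N.
set T := lincomb _ _ _.
pose A := average N (fun j => lincomb n a (e \o pos j)).
have pos_lt j : (j < N)%N -> {homo pos j : i i' / (i < i')%N}.
  move=> jN; apply: homo_ltnS => i; rewrite /pos.
  have := blk_le i i.+1 (leqnSn i); rewrite leq_eqVlt => /orP[/eqP<-|lt].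
    by rewrite addnS addSn.
  have : (blk i * N + N <= blk i.+1 * N)%N by rewrite -mulSnr leq_mul2r lt orbT.
  by case: ifP => _; case: ifP => _; lia.
have HA : `|A| <= K * `|lincomb n a e|.
  by apply: norm_average_le => // j jN; exact/spread_le/pos_lt.
rewrite -(subrK A T) addrC (le_trans (ler_normD _ _))// lerD//.
rewrite /A average_lincomb -lincombBr mulrAC; apply: norm_lincomb_le => i i_n.
rewrite /pos /=; case: ifP => _; last first.
  by rewrite addn0 average_const// subrr normr0 !mulr_ge0 ?invr_ge0// ltW.
rewrite block_averageE distrC.
rewrite (le_trans (average_shift _ _ N0 eB))// ler_wpM2r ?invr_ge0//.
by rewrite ler_wpM2r ?(ltW B0)// ler_wpM2l// ler_nat ltnW.
Qed.

(* The suppressed blocks are smeared out over long intervals, where only the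
   sums of their coefficients survive. *)
Lemma suppression (blk : nat -> nat) (P : pred nat) n a (B : R) m :
  {homo blk : i j / (i <= j)%N} -> (forall i, `|e i| <= B) ->
  (forall i, (i < n)%N -> (blk i < m)%N) ->
  `|lincomb n (fun i => if P (blk i) then 0 else a i) e| <=
  K * (K * `|lincomb n a e| + B * \sum_(k < m | P k) `|\sum_(i < n | blk i == k) a i|).
Proof.
move=> blk_le eB blk_m; have [c Hc] := averaging n a.
apply: (@le_add_divn _ _ _ (K * c)) => N N0.
pose g i := (blk i * N + i)%N.
have g_lt : {homo g : i j / (i < j)%N}.
  apply: homo_ltnS => i; rewrite /g -addnS leq_add// leq_mul2r.
  by rewrite blk_le ?orbT// leqnSn.
rewrite (le_trans (le_spread _ _ g_lt))//.
rewrite -mulrA -mulrDr ler_pM2l// addrAC.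
have -> : lincomb n (fun i => if P (blk i) then 0 else a i) (e \o g) =
    lincomb n a (fun i => if P (blk i) then block_average e N (blk i)
                          else e (blk i * N + i)%N) -
    \sum_(k < m | P k) (\sum_(i < n | blk i == k) a i) *: block_average e N k.
  have -> : \sum_(k < m | P k) (\sum_(i < n | blk i == k) a i) *: block_average e N k =
      lincomb n a (fun i => if P (blk i) then block_average e N (blk i) else 0).
    under eq_bigr do rewrite scaler_suml big_mkcond.
    rewrite exchange_big /=; apply: eq_bigr => i _.
    have im := blk_m _ (ltn_ord i).
    case: ifP => Pi.
      rewrite (bigD1 (Ordinal im))//= eqxx big1 ?addr0// => k /andP[_ ki].
      by rewrite ifN// eq_sym; move: ki; rewrite -val_eqE.
    rewrite scaler0 big1// => k Pk; case: ifP => // /eqP E.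
    by move: Pi; rewrite E Pk.
  rewrite -lincombBr; apply: eq_lincomb => i _ /=.
  by case: ifP; rewrite ?subrr ?scaler0 ?scale0r ?subr0.
rewrite (le_trans (ler_normB _ _))// lerD ?(Hc _ P)//.
rewrite (le_trans (ler_norm_sum _ _ _))// mulr_sumr ler_sum// => k _.
by rewrite normrZ mulrC ler_wpM2r// norm_block_average_le.
Qed.

(* [e (i * N)] is compared with the average over the window that it starts. *)
Lemma le_average_differences n a N : (0 < N)%N ->
  `|lincomb n a e| <= K * (`|lincomb n a (block_average e N)| +
    K * `|lincomb n a (differences e)|).
Proof.
move=> N0; pose g i := (i * N)%N.
have g_lt : {homo g : i j / (i < j)%N} by move=> i j; rewrite ltn_mul2r N0.
rewrite (le_trans (le_spread n a g_lt))// ler_pM2l//.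
rewrite -(subrK (lincomb n a (block_average e N)) (lincomb n a (e \o g))).
rewrite addrC (le_trans (ler_normD _ _))// lerD//.
have -> : lincomb n a (e \o g) - lincomb n a (block_average e N) =
    average N (fun j => lincomb n a (fun i => e (g i) - e (g i + j)%N)).
  rewrite average_lincomb -lincombBr; apply: eq_lincomb => i _.
  by rewrite averageB average_const// block_averageE.
apply: norm_average_le => // -[|j] jN.
  rewrite /lincomb big1 ?normr0 ?mulr_ge0// => [|i _]; first exact: ltW.
  by rewrite addn0 subrr scaler0.
apply: differences_spread => i; rewrite /g mulSn; lia.
Qed.

End uniformly_spreading_theory.

(** Once a rearranged series has used all the indices below [N], any further stretch of it is a
    subset of a tail of the original series. Suppression bounds it by that tail, and completeness
    concludes. *)
Lemma suppression_unconditional (R : realType) (X : completeNormedModType R)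
    (e : nat -> X) (C : R) : schauder_basis e ->
  (forall (P : pred nat) n a,
    `|lincomb n (fun i => if P i then a i else 0) e| <= C * `|lincomb n a e|) ->
  unconditional_basis e.
Proof.
move=> eS HC; split=> // a acv s sbij.
have {}HC : forall (P : pred nat) n a,
    `|lincomb n (fun i => if P i then a i else 0) e| <= (`|C| + 1) * `|lincomb n a e|.
  move=> P n b; rewrite (le_trans (HC _ _ _))// ler_wpM2r//.
  by rewrite (le_trans (ler_norm _))// lerDl.
have C0 : 0 < `|C| + 1 by rewrite ltr_wpDl.
move: (`|C| + 1) => D in HC C0; clear C.
apply/cvg_nat_cauchyP => eps eps0.
move/cvg_nat_cauchyP : acv => /(_ (eps / D)) []; first by rewrite divr_gt0.
move=> N HN.
(* The sum [N'] stands for a maximum: it exceeds [t i] for all [i < N], so that the indices [s k]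
   with [N' <= k] are at least [N]. The sum in [L] below plays the same part for [s]. *)
have [t st ts] := sbij.
pose N' := (\sum_(i < N) (t i).+1)%N.
have tN' i : (i < N)%N -> (t i < N')%N.
  by move=> iN; rewrite /N' (bigD1 (Ordinal iN))//= addSn ltnS leq_addr.
have main m n : (N' <= m)%N -> (m <= n)%N ->
   `|series (fun i => a (s i) *: e (s i)) n - series (fun i => a (s i) *: e (s i)) m| <= eps.
  move=> N'm mn; rewrite sub_series_geq//.
  pose L := (N + \sum_(i < n) (s i).+1)%N.
  have sL i : (i < n)%N -> (s i < L)%N.
    move=> i_n; rewrite /L (bigD1 (Ordinal i_n))//=; lia.
  pose P i := (m <= t i < n)%N.
  have -> : \sum_(m <= k < n) a (s k) *: e (s k) =
      lincomb L (fun i => if P i then (if (N <= i)%N then a i else 0) else 0) e.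
    pose F i := (if P i then (if (N <= i)%N then a i else 0) else 0) *: e i.
    rewrite /lincomb -/(F _) -(big_mkord xpredT F).
    rewrite -(@big_map _ _ _ _ _ s (index_iota m n) xpredT (fun i => a i *: e i)).
    rewrite [RHS](bigID P) /= [X in _ = _ + X]big1 ?addr0; last first.
      by move=> i nP; rewrite /F (negbTE nP) scale0r.
    rewrite -[RHS]big_filter.
    have -> : \sum_(i <- [seq i <- index_iota 0 L | P i]) F i =
              \sum_(i <- [seq i <- index_iota 0 L | P i]) a i *: e i.
      rewrite !big_filter; apply: eq_bigr => i Pi; rewrite /F Pi ifT//.
      rewrite leqNgt; apply/negP => iN; have := tN' _ iN; move: Pi; rewrite /P; lia.
    apply: perm_big; apply: uniq_perm.
    - by rewrite map_inj_uniq ?iota_uniq//; exact: bij_inj.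
    - by rewrite filter_uniq// iota_uniq.
    move=> i; rewrite mem_filter mem_index_iota /=.
    apply/mapP/idP => [[k]|/andP[Pi _]].
      rewrite mem_index_iota => Hk ->; rewrite /P st Hk /=; apply: sL; lia.
    by exists (t i); rewrite ?ts// mem_index_iota.
  rewrite (le_trans (HC _ _ _))// -ler_pdivlMl// mulrC.
  have NL : (N <= L)%N by rewrite leq_addr.
  apply: le_trans (HN L N NL (leqnn N)).
  rewrite sub_series_geq// le_eqVlt; apply/orP; left; apply/eqP; congr (`| _ |).
  rewrite /lincomb -(big_mkord xpredT (fun i => (if (N <= i)%N then a i else 0) *: e i)).
  rewrite (@big_cat_nat _ _ _ N)//= [X in X + _]big1_seq ?add0r => [|i]; last first.
    by rewrite mem_index_iota => /= iN; rewrite ifF ?scale0r//; lia.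
  by apply: eq_big_nat => i iN; rewrite ifT//; lia.
exists N' => m n N'm N'n.
by have [mn|/ltnW nm] := leqP m n; [rewrite distrC|]; exact: main.
Qed.

(** * Conditional spreading bases *)

Section conditional_spreading.
Variables (R : realType) (X : completeNormedModType R) (e : nat -> X).
Hypothesis (ecs : conditional_spreading_basis e).

Let eS : schauder_basis e. Proof. by case: ecs. Qed.

Lemma no_suppression (C : R) : ~ (forall (P : pred nat) n a,
  `|lincomb n (fun i => if P i then a i else 0) e| <= C * `|lincomb n a e|).
Proof. by case: ecs => _ _ + /(suppression_unconditional eS); exact. Qed.

Lemma schauder_basis_neq01 : e 0 != e 1.
Proof.
apply/eqP => e01; have [a [_ a_uniq]] := eS (e 0).
have E k : e k = e 0 -> a = (fun i => (i == k)%:R).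
  move=> ek; apply: a_uniq; apply/cvg_natP => eps eps0; exists k.+1 => n kn.
  rewrite seriesE /lincomb (bigD1 (Ordinal kn))//= eqxx scale1r ek big1 ?addr0.
    by rewrite subrr normr0 ltW.
  by move=> i; rewrite -val_eqE /= => /negbTE ->; rewrite scale0r.
have := congr1 (fun f : nat -> R => f 0%N) (E 0%N erefl).
by rewrite (E 1%N (esym e01)) /= => /eqP; rewrite eq_sym oner_eq0.
Qed.

Variable K : R.
Hypotheses (K0 : 0 < K) (eK : uniformly_spreading K e).

Lemma block_averageBE N i j (f : nat -> nat) :
  (forall t, (t < N)%N -> f t = (i * N + t)%N) ->
  (forall t, (t < N)%N -> f (N + t)%N = (j * N + t)%N) ->
  block_average e N i - block_average e N j =
  lincomb (N + N) (fun t => if (t < N)%N then N%:R^-1 else - N%:R^-1) (e \o f).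
Proof.
move=> f1 f2; rewrite !block_averageE /average /lincomb big_split_ord /=.
congr (_ + _); rewrite -?scaleNr scaler_sumr; apply: eq_bigr => t _ /=.
  by rewrite ltn_ord f1.
by rewrite ltnNge leq_addr /= f2.
Qed.

Lemma norm_block_averageB_le N i j : (i < j)%N ->
  `|block_average e N i - block_average e N j|
    <= K * `|block_average e N 0 - block_average e N 1|.
Proof.
move=> ij.
(* The windows 0 and 1 are adjacent and give the identity. For the windows [i] and [j], the index
   [t] of the second half is the place [t - N] of window [j], that is [j.-1 * N + t]. *)
rewrite (@block_averageBE N i j (fun t => if (t < N)%N then i * N + t else j.-1 * N + t)%N).
- rewrite (@block_averageBE N 0 1 id)//; last by move=> t _; rewrite mul1n.
  apply: eK => //; apply: homo_ltnS => t; have : (i * N <= j.-1 * N)%N.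
    by rewrite leq_mul2r; apply/orP; right; lia.
  case: (ltnP t.+1 N); case: (ltnP t N); lia.
- by move=> t ->.
- move=> t _; rewrite ltnNge leq_addr /= addnA; congr addn.
  by case: j ij => // j _; rewrite mulSnr.
Qed.

Lemma norm_block_average0_le N i : `|block_average e N i| <= K * `|block_average e N 0|.
Proof.
have E k : block_average e N k =
    lincomb N (fun=> N%:R^-1) (e \o (fun t => k * N + t)%N).
  by rewrite block_averageE /average /lincomb scaler_sumr.
by rewrite !E; apply: eK; apply: homo_ltnS => t; rewrite ltn_add2l.
Qed.

Lemma block_average_mul N M : (0 < M)%N ->
  block_average e (M * N) 0 = average M (fun i => block_average e N i).
Proof.
move=> M0; rewrite /block_average mul0n mul1n big_mkord /average.
case: N => [|N].
  rewrite muln0 big_ord0 scaler0 big1 ?scaler0// => i _.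
  by rewrite !muln0 big_geq// scaler0.
rewrite (@big_partition_nat (fun i => i * N.+1)%N _ _ X e M)//; last first.
  by move=> i j ij; rewrite ltn_mul2r ij.
by rewrite natrM invfM -scalerA scaler_sumr.
Qed.

(* Otherwise the averages form a Cauchy sequence whose limit has zero
   coordinates, so that the averages tend to zero; averaging then suppresses
   arbitrary coordinates, and the basis is unconditional. *)
Lemma block_averageB_gt0 : exists2 d : R, 0 < d &
  forall N, (0 < N)%N -> d <= `|block_average e N 0 - block_average e N 1|.
Proof.
apply: contrapT => nd.
have [C C0 eC] := le_coef K0 eK schauder_basis_neq01.
have H1 k : exists N, [/\ (0 < N)%N, N%:R^-1 <= C * k.+1%:R^-1 &
    forall i j, `|block_average e N i - block_average e N j| <= k.+1%:R^-1].
  pose d : R := k.+1%:R^-1 / (K + 1).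
  have k0 : 0 < k.+1%:R^-1 :> R by rewrite invr_gt0.
  have d0 : 0 < d by rewrite divr_gt0// addr_gt0.
  have [N N0 Nd] : exists2 N, (0 < N)%N & `|block_average e N 0 - block_average e N 1| < d.
    apply: contrapT => nN; apply: nd; exists d => // N N0.
    by rewrite leNgt; apply/negP => h; apply: nN; exists N.
  have dk : K * d <= k.+1%:R^-1.
    by rewrite /d mulrA ler_pdivrMr ?addr_gt0// mulrC ler_pM2l// lerDl ler01.
  have d1 : d <= k.+1%:R^-1.
    by rewrite /d ler_pdivrMr ?addr_gt0// ler_peMr ?(ltW k0)// lerDr ltW.
  have lt i j : (i < j)%N -> `|block_average e N i - block_average e N j| <= k.+1%:R^-1.
    move=> ij; rewrite (le_trans (norm_block_averageB_le _ ij))// (le_trans _ dk)//.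
    by rewrite ler_pM2l// ltW.
  exists N; split=> // [|i j].
    (* The difference of two averages has coefficients [N%:R^-1] up to sign, and [C] times its norm
       bounds them: small differences force long windows. *)
    have := eC (N + N)%N (fun t => if (t < N)%N then N%:R^-1 else - N%:R^-1) 0%N.
    rewrite N0 addn_gt0 N0 => /(_ isT); rewrite ger0_norm ?invr_ge0//.
    rewrite -(@block_averageBE N 0 1 id)//; last by move=> t _; rewrite mul1n.
    by move=> /le_trans; apply; rewrite ler_pM2l// (le_trans (ltW Nd)).
  case: (ltngtP i j) => [/lt//|/lt|->]; first by rewrite distrC.
  by rewrite subrr normr0 ltW.
have {H1}[N HN] := choice H1.
have N0 k : (0 < N k)%N by case: (HN k).
pose x k := block_average e (N k) 0.
(* Averages of lengths [N k] and [N l] are compared through the one of length [N k * N l], which is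
   a mean of averages of either length. *)
have xM k m : (0 < m)%N -> `|x k - block_average e (m * N k) 0| <= k.+1%:R^-1.
  move=> m0; rewrite block_average_mul// -(average_const (x k) m0) -averageB.
  by apply: norm_average_le => // j _; case: (HN k) => _ _; apply.
have xx k l : `|x k - x l| <= k.+1%:R^-1 + l.+1%:R^-1.
  rewrite -(subrKA (block_average e (N l * N k) 0)) (le_trans (ler_normD _ _))//.
  by rewrite lerD ?xM// distrC mulnC xM.
have small (eps : R) : 0 < eps -> exists k, forall l, (k <= l)%N -> l.+1%:R^-1 <= eps.
  move=> eps0; exists (Num.bound eps^-1) => l kl.
  rewrite -[leRHS]invrK lef_pV2 ?posrE ?invr_gt0// ltW// (lt_le_trans (archi_boundP _))//.
    by rewrite invr_ge0 ltW.
  by rewrite ler_nat ltnW.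
have /cvg_ex[l xl] : cvgn x.
  apply/cvg_nat_cauchyP => eps eps0; have [|k Hk] := small (eps / 2).
    by rewrite divr_gt0.
  by exists k => m n km kn; rewrite (le_trans (xx _ _))// (splitr eps) lerD ?Hk.
have [a [/cvg_natP al _]] := eS l.
(* The coordinates of [x k] are at most [1 / N k], which tends to zero, and coordinates are
   continuous by [eC]. *)
have a0 i : a i = 0.
  apply/eqP; rewrite -normr_eq0 eq_le normr_ge0 andbT.
  apply: (@le_addM_gt0 _ _ _ (C + C + C)) => eps eps0; rewrite add0r.
  move/cvg_natP: xl => /(_ _ eps0)[k1 Hk1]; have [k2 Hk2] := small _ eps0.
  pose k := maxn k1 k2.
  have [n1 Hn1] := al _ eps0; pose n := maxn n1 (maxn i.+1 (N k)).
  have := eC n (fun t => a t - (if (t < N k)%N then (N k)%:R^-1 else 0)) i.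
  rewrite lincombBl -lincomb_widen; last by rewrite /n !leq_max leqnn !orbT.
  have -> : lincomb (N k) (fun=> (N k)%:R^-1) e = x k.
    by rewrite /x block_averageE /average /lincomb scaler_sumr.
  have -> : (i < n)%N by rewrite /n !leq_max leqnn !orbT.
  move=> /(_ isT) Hi.
  have hx : `|l - x k| <= eps by rewrite Hk1// leq_maxl.
  have hl : `|l - lincomb n a e| <= eps by rewrite -seriesE Hn1// leq_maxl.
  have hb : `|lincomb n a e - x k| <= eps + eps.
    rewrite -(subrKA l) (le_trans (ler_normD _ _))// lerD//.
    by rewrite distrC.
  have hN : (N k)%:R^-1 <= C * eps.
    have [_ h _] := HN k; rewrite (le_trans h)// ler_pM2l// Hk2// leq_maxr//.
  have {hb}hb : C * `|lincomb n a e - x k| <= C * (eps + eps) by rewrite ler_pM2l.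
  have : `|if (i < N k)%N then (N k)%:R^-1 else 0| <= (N k)%:R^-1 :> R.
    by case: ifP => _; rewrite ?normr0 ?ger0_norm ?invr_ge0.
  move: hN Hi hb; set u : R := `|_ - if _ then _ else _|; set v : R := `|if _ then _ else _|.
  have := ler_normD (a i - (if (i < N k)%N then (N k)%:R^-1 else 0))
    (if (i < N k)%N then (N k)%:R^-1 else 0).
  rewrite subrK -/u -/v; lra.
have l0 : l = 0.
  apply/eqP; rewrite -normr_eq0 eq_le normr_ge0 andbT.
  apply: (@le_addM_gt0 _ _ _ 1) => eps eps0; rewrite add0r mul1r.
  have [n Hn] := al _ eps0; have := Hn n (leqnn n).
  rewrite seriesE /lincomb big1 ?subr0// => i _; rewrite a0 scale0r//.
apply: (@no_suppression (K * K)) => P n b.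
have [c Hc] := averaging K0 eK n b.
apply: (@le_addM_gt0 _ _ _ (K * (`|c| * C + K * \sum_(i < n) `|b i|))) => eps eps0.
move/cvg_natP: xl => /(_ _ eps0)[k1 Hk1]; have [k2 Hk2] := small _ eps0.
pose k := maxn k1 k2.
have hx : `|x k| <= eps by have := Hk1 k (leq_maxl _ _); rewrite l0 sub0r normrN.
have hN : (N k)%:R^-1 <= C * eps.
  have [_ h _] := HN k; rewrite (le_trans h)// ler_pM2l// Hk2// leq_maxr//.
have {Hc}Hc := Hc id (predC P) (fun i j ij => ij) _ (N0 k).
pose g i := (i * N k + i)%N.
have g_lt : {homo g : i j / (i < j)%N}.
  by apply: homo_ltnS => i; rewrite /g mulSn; lia.
rewrite (le_trans (le_spread eK _ _ g_lt))//.
rewrite -!mulrA -mulrDr ler_pM2l//.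
have -> : lincomb n (fun i => if P i then b i else 0) (e \o g) =
    lincomb n b (fun i => if predC P i then block_average e (N k) i
                          else e (i * N k + i)%N) -
    lincomb n b (fun i => if predC P i then block_average e (N k) i else 0).
  rewrite -lincombBr; apply: eq_lincomb => i _ /=.
  by case: (P i); rewrite ?subr0 ?subrr ?scaler0 ?scale0r.
rewrite (le_trans (ler_normB _ _))//.
have h2 : `|lincomb n b (fun i => if predC P i then block_average e (N k) i else 0)|
    <= K * eps * \sum_(i < n) `|b i|.
  apply: norm_lincomb_le => i _; case: ifP => _; last by rewrite normr0 mulr_ge0// ltW.
  by rewrite (le_trans (norm_block_average0_le _ _))// ler_pM2l.
have h3 : c / (N k)%:R <= `|c| * (C * eps).
  rewrite (le_trans (ler_norm _))// normrM ler_wpM2l// ger0_norm// invr_ge0//.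
have := lerD Hc h2; rewrite -/(_ \o _); lra.
Qed.

(** Average the first [m] terms once over the window 0 and once over the window 1, with the
    remaining terms kept at the same positions beyond both. The two results differ by the prefix sum
    times a difference of averages, which is bounded away from zero. *)
Lemma prefix_sum_le : exists2 C : R, 0 < C &
  forall m n (a : nat -> R), (m <= n)%N -> `|\sum_(i < m) a i| <= C * `|lincomb n a e|.
Proof.
have [d d0 Hd] := block_averageB_gt0.
exists (2 * K / d) => [|m n a mn]; first by rewrite divr_gt0// mulr_gt0.
pose blk (k i : nat) : nat := if (i < m)%N then k else 2%N.
have blk_le k : (k <= 2)%N -> {homo blk k : i j / (i <= j)%N}.
  by move=> k2 i j; rewrite /blk; case: ifP; case: ifP => //; lia.
have [c Hc] := averaging K0 eK n a.
have H1 := Hc _ (fun k => (k < 2)%N) (blk_le 0%N isT).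
have H2 := Hc _ (fun k => (k < 2)%N) (blk_le 1%N isT).
rewrite mulrAC ler_pdivlMr//.
apply: (@le_add_divn _ _ _ (c + c)) => N N0.
have := lerD (H1 N N0) (H2 N N0).
have -> : forall u v : R, K * u + v + (K * u + v) = 2 * K * u + (v + v).
  by move=> *; ring.
rewrite -mulrDl; apply: le_trans; apply: le_trans (ler_normB _ _).
rewrite -lincombBr.
have -> : lincomb n a (fun i =>
     (if (blk 0%N i < 2)%N then block_average e N (blk 0%N i) else e (blk 0%N i * N + i)%N) -
     (if (blk 1%N i < 2)%N then block_average e N (blk 1%N i) else e (blk 1%N i * N + i)%N))
  = (\sum_(i < m) a i) *: (block_average e N 0 - block_average e N 1).
  rewrite (big_ord_widen _ (fun i => a i) mn) scaler_suml [RHS]big_mkcond.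
  apply: eq_bigr => i _; rewrite /blk; case: (ltnP i m) => //= _.
  by rewrite subrr scaler0.
by rewrite normrZ ler_wpM2l// Hd.
Qed.

(** The tail is suppressed as one block. Its sum is a difference of two prefix sums, hence already
    controlled. *)
Lemma projection_le : exists2 C : R, 0 < C &
  forall m n (a : nat -> R), (m <= n)%N -> `|lincomb m a e| <= C * `|lincomb n a e|.
Proof.
have [C C0 HC] := prefix_sum_le; have [B B0 eB] := spreading_bounded K0 eK.
exists (K * (K + B * (C + C))) => [|m n a mn].
  by rewrite mulr_gt0// addr_gt0// mulr_gt0// addr_gt0.
have blk_le : {homo (fun i => (m <= i)%N : nat) : i j / (i <= j)%N}.
  by move=> i j; case: (leqP m i); case: (leqP m j); lia.
have lt2 i : (i < n)%N -> ((m <= i)%N < 2)%N by case: (m <= i)%N.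
have := @suppression _ _ _ _ K0 eK _ (pred1 1%N) n a B 2 blk_le eB lt2.
have -> : lincomb n (fun i => if pred1 1%N (m <= i : nat)%N then 0 else a i) e =
    lincomb m a e.
  rewrite (lincomb_widen _ _ mn); apply: eq_lincomb => i _ /=.
  by rewrite ltnNge; case: (m <= i)%N.
move=> /le_trans; apply.
rewrite -[leRHS]mulrA ler_wpM2l ?(ltW K0)// mulrDl lerD2l -mulrA ler_wpM2l ?(ltW B0)//.
rewrite big_mkcond !big_ord_recr big_ord0 /= !add0r.
have -> : \sum_(i < n | (m <= i)%N == 1%N :> nat) a i = \sum_(i < n) a i - \sum_(i < m) a i.
  rewrite [X in X - _](bigID (fun i : 'I_n => (i < m)%N)) /=.
  rewrite -(big_ord_widen _ (fun i => a i) mn) [RHS]addrC addKr.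
  by apply: eq_bigl => i; rewrite ltnNge; case: (m <= i)%N.
by rewrite (le_trans (ler_normB _ _))// mulrDl lerD// HC.
Qed.

Lemma not_l1 (C : R) : ~ (forall n (a : nat -> R), \sum_(i < n) `|a i| <= C * `|lincomb n a e|).
Proof.
have [B B0 eB] := spreading_bounded K0 eK.
move=> HC; apply: (@no_suppression (B * C)) => P n a.
rewrite (le_trans (norm_lincomb_le _ (fun i _ => eB i)))// -mulrA ler_wpM2l ?(ltW B0)//.
rewrite (le_trans _ (HC _ _))// ler_sum// => i _.
by case: ifP => _; rewrite ?normr0.
Qed.

End conditional_spreading.

Definition bounds (R : realType) (X : normedModType R) (e : nat -> X) (C : R) : Prop :=
  [/\ 0 < C, uniformly_spreading C e, forall i, `|e i| <= C,
      forall n (a : nat -> R) i, (i < n)%N -> `|a i| <= C * `|lincomb n a e| &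
      (forall m n (a : nat -> R), (m <= n)%N -> `|\sum_(i < m) a i| <= C * `|lincomb n a e|) /\
      (forall m n (a : nat -> R), (m <= n)%N -> `|lincomb m a e| <= C * `|lincomb n a e|)].

Lemma conditional_spreading_bounds (R : realType) (X : completeNormedModType R)
    (e : nat -> X) : conditional_spreading_basis e -> exists C, bounds e C.
Proof.
move=> ecs; have [K K0 eK] : exists2 K : R, 0 < K & uniformly_spreading K e.
  by case: ecs => _ /spreading_uniform.
have [B B0 eB] := spreading_bounded K0 eK.
have [C1 C10 H1] := le_coef K0 eK (schauder_basis_neq01 ecs).
have [C2 C20 H2] := prefix_sum_le ecs K0 eK.
have [C3 C30 H3] := projection_le ecs K0 eK.
have le (x y z : R) : 0 <= z -> x <= y * z -> forall y', y <= y' -> x <= y' * z.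
  by move=> z0 h y' yy; rewrite (le_trans h)// ler_wpM2r.
exists (K + B + C1 + C2 + C3); split; [lra| |move=> i; have := eB i; lra| |split].
- by move=> f g fl gl n a; apply: le (eK _ _ fl gl n a) _ _ => //; lra.
- by move=> n a i i_n; apply: le (H1 n a i i_n) _ _ => //; lra.
- by move=> m n a mn; apply: le (H2 m n a mn) _ _ => //; lra.
- by move=> m n a mn; apply: le (H3 m n a mn) _ _ => //; lra.
Qed.

(** * Convex blocks *)

(** Multipliers in [0, 1] give a convex combination of the sums over subsets. *)
Lemma unit_multiplier_le (R : realType) (X : normedModType R) (x : nat -> X) (M : R) n :
  (forall P : pred nat, `|\sum_(i < n | P i) x i| <= M) ->
  forall t : nat -> R, (forall i, 0 <= t i <= 1) -> `|\sum_(i < n) t i *: x i| <= M.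
Proof.
move=> H t t01.
(* The vector [y] collects the choices, term kept or dropped, already made for the last indices. *)
suff main y : (forall P : pred nat, `|y + \sum_(i < n | P i) x i| <= M) ->
    `|y + \sum_(i < n) t i *: x i| <= M.
  by rewrite -[X in `|X|]add0r; apply: main => P; rewrite add0r.
elim: n y {H} => [|n IH] y H; first by have := H xpred0; rewrite !big_ord0.
have {}IH (b : bool) : `|y + (if b then x n else 0) + \sum_(i < n) t i *: x i| <= M.
  apply: IH => P; have := H (fun i => if (i < n)%N then P i else b).
  rewrite big_mkcond big_ord_recr ltnn -big_mkcond /= addrA addrAC.
  rewrite (_ : \sum_(i < n | _) x i = \sum_(i < n | P i) x i)//.
  by apply: eq_bigl => i; rewrite ltn_ord.
set s := \sum_(i < n) _ in IH; rewrite big_ord_recr /= -/s.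
have -> : y + (s + t n *: x n) = (1 - t n) *: (y + s) + t n *: (y + x n + s).
  rewrite [y + x n + s]addrAC [t n *: (_ + _)]scalerDr [RHS]addrA.
  by rewrite -scalerDl subrK scale1r addrA.
have /andP[t0 t1] := t01 n.
have := IH true; have := IH false; rewrite addr0 => h1 h2.
rewrite (le_trans (ler_normD _ _))// !normrZ ger0_norm ?subr_ge0// ger0_norm//.
have := ler_wpM2l t0 h2.
have h : 0 <= 1 - t n by rewrite subr_ge0.
by have := ler_wpM2l h h1; lra.
Qed.

Lemma multiplier_le (R : realType) (X : normedModType R) (x : nat -> X) (M : R) n :
  (forall P : pred nat, `|\sum_(i < n | P i) x i| <= M) ->
  forall t : nat -> R, (forall i, `|t i| <= 1) ->
  `|\sum_(i < n) t i *: x i| <= 2 * M.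
Proof.
move=> H t t1.
have -> : \sum_(i < n) t i *: x i =
    \sum_(i < n) Num.max (t i) 0 *: x i - \sum_(i < n) Num.max (- t i) 0 *: x i.
  rewrite -sumrB; apply: eq_bigr => i _; rewrite -scalerBl; congr (_ *: _).
  by case: (leP (t i) 0) => ti; [rewrite max_l ?oppr_ge0// sub0r opprK|
    rewrite max_r ?subr0// oppr_le0 ltW].
rewrite (le_trans (ler_normB _ _))// mulr_natl mulr2n lerD//.
  apply: (unit_multiplier_le H (t := fun i => Num.max (t i) 0)) => i.
  by have := t1 i; rewrite ler_norml le_max ge_max lexx orbT ler01 => /andP[_ ->].
apply: (unit_multiplier_le H (t := fun i => Num.max (- t i) 0)) => i.
have := t1 i; rewrite ler_norml le_max ge_max lexx orbT ler01 => /andP[h _].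
by rewrite lerNl h.
Qed.

Section convex_blocks.
Variables (R : realType) (X : completeNormedModType R) (e : nat -> X) (C : R).
Hypotheses (ecs : conditional_spreading_basis e) (eC : bounds e C).

Let C0 : 0 < C. Proof. by case: eC. Qed.
Let eK : uniformly_spreading C e. Proof. by case: eC. Qed.

(* If convex combinations are bounded away from zero, then [w] and [w'],
   hence [e], dominate the basis of l1. *)
Lemma small_convex_combination (Y Y' : normedModType R) (w : nat -> Y)
    (w' : nat -> Y') (D : R) :
  (forall (P : pred nat) n a,
     `|lincomb n (fun i => if P i then a i else 0) w| <= D * `|lincomb n a e|) ->
  (forall (P : pred nat) n a,
     `|lincomb n (fun i => if P i then a i else 0) w'| <= D * `|lincomb n a e|) ->
  forall m (eps : R), 0 < eps -> exists n (l : nat -> R),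
  [/\ (m < n)%N, forall i, 0 <= l i, \sum_(m <= i < n) l i = 1,
      `|\sum_(m <= i < n) l i *: w i| <= eps &
      `|\sum_(m <= i < n) l i *: w' i| <= eps].
Proof.
move=> wD w'D m eps eps0; apply: contrapT => H.
(* A nonnegative combination violating this bound, divided by its sum of coefficients, would be a
   convex combination small for [w] and for [w'] at once. *)
have lower n (c : nat -> R) : (forall i, 0 <= c i) ->
    eps * \sum_(i < n) c i <=
    `|lincomb n c (fun i => w (m + i)%N)| + `|lincomb n c (fun i => w' (m + i)%N)|.
  move=> c0; have : 0 <= \sum_(i < n) c i by apply: sumr_ge0.
  rewrite le_eqVlt => /predU1P[<-|s0]; first by rewrite mulr0 addr_ge0.
  have [n0|n0] := posnP n; first by move: s0; rewrite n0 big_ord0 ltxx.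
  set s := \sum_(i < n) c i in s0 *.
  pose l i := c (i - m)%N / s.
  have E (V : normedModType R) (v : nat -> V) :
      \sum_(m <= i < m + n) l i *: v i = s^-1 *: lincomb n c (fun i => v (m + i)%N).
    rewrite -{1}[m]add0n big_addn addKn big_mkord /lincomb scaler_sumr.
    by apply: eq_bigr => i _; rewrite /l addnK scalerA mulrC [(i + m)%N]addnC.
  apply: contrapT => /negP; rewrite -ltNge => lt; apply: H.
  have s'0 : 0 <= s^-1 by rewrite invr_ge0 ltW.
  exists (m + n)%N, l; split.
  - by rewrite -[X in (X < _)%N]addn0 ltn_add2l.
  - by move=> i; rewrite divr_ge0// ltW.
  - rewrite -{1}[m]add0n big_addn addKn big_mkord.
    rewrite (eq_bigr (fun i : 'I_n => c i / s)) => [|i _]; last by rewrite /l addnK.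
    by rewrite -mulr_suml divff// gt_eqF.
  - rewrite E normrZ ger0_norm// ler_pdivrMl// mulrC (le_trans _ (ltW lt))// lerDl//.
  - by rewrite E normrZ ger0_norm// ler_pdivrMl// mulrC (le_trans _ (ltW lt))// lerDr.
have D0 : 0 <= D.
  have := wD xpredT 1%N (fun=> 1); rewrite leNgt; apply: contraTT; rewrite -!ltNge => Dlt.
  rewrite /lincomb !big_ord1 /= !scale1r.
  rewrite (lt_le_trans _ (normr_ge0 _))// pmulr_llt0// normr_gt0.
  case: eC => _ _ _ /(_ 1%N (fun=> 1) 0%N isT) + _.
  rewrite /lincomb big_ord1 scale1r normr1; case: (eqVneq (e 0) 0) => // ->.
  by rewrite normr0 mulr0 ler10.
have upper (V : normedModType R) (v : nat -> V) (P : pred nat) n a :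
    (forall (P : pred nat) n a,
      `|lincomb n (fun i => if P i then a i else 0) v| <= D * `|lincomb n a e|) ->
    `|lincomb n (fun i => if P i then a i else 0) (fun i => v (m + i)%N)| <=
    D * (C * `|lincomb n a e|).
  move=> vD.
  have E (U : normedModType R) (u : nat -> U) (b : nat -> R) :
      lincomb n b (fun i => u (m + i)%N) =
      lincomb (m + n) (fun k => if (m <= k)%N then b (k - m)%N else 0) u.
    rewrite /lincomb big_split_ord /= [X in _ = X + _]big1 ?add0r => [|i _]; last first.
      by rewrite leqNgt ltn_ord scale0r.
    by apply: eq_bigr => i _; rewrite leq_addr addKn.
  have := vD (fun k => P (k - m)%N) (m + n)%N (fun k => if (m <= k)%N then a (k - m)%N else 0).
  rewrite -E => h; rewrite E.
  rewrite (_ : lincomb _ _ v = lincomb (m + n) (fun i => if P (i - m)%N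
     then if (m <= i)%N then a (i - m)%N else 0 else 0) v).
    apply: (le_trans h); rewrite ler_wpM2l//.
    by apply: spread_le => //; apply: homo_ltnS => i; rewrite ltn_add2l.
  by apply: eq_lincomb => i _; case: (m <= i)%N; case: (P _).
(* In the constant, one factor 2 comes from the positive and negative parts of [a], the other from
   the two sequences, and [C] from the shift by [m]. *)
apply: (@not_l1 _ _ _ ecs _ C0 eK (4 * (D * C) / eps)) => n a.
rewrite mulrAC ler_pdivlMr// mulrC.
have -> : \sum_(i < n) `|a i| = \sum_(i < n) Num.max (a i) 0 + \sum_(i < n) Num.max (- a i) 0.
  rewrite -big_split; apply: eq_bigr => i _ /=.
  by case: (leP (a i) 0) => ai; [rewrite max_l ?oppr_ge0// ler0_norm// add0r|
    rewrite max_r ?oppr_le0 ?(ltW ai)// gtr0_norm// addr0].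
have m1 : eps * \sum_(i < n) Num.max (a i) 0 <= 2 * (D * C) * `|lincomb n a e|.
  apply: le_trans (lower n (fun i => Num.max (a i) 0) _) _.
    by move=> i; rewrite le_max lexx orbT.
  have E (V : normedModType R) (v : nat -> V) : lincomb n (fun i => Num.max (a i) 0) v =
      lincomb n (fun i => if 0 <= a i then a i else 0) v.
    by apply: eq_lincomb => i _; case: (leP 0 (a i)).
  rewrite !E.
  have := upper _ _ (fun i => 0 <= a i) n a wD.
  have := upper _ _ (fun i => 0 <= a i) n a w'D; lra.
have m2 : eps * \sum_(i < n) Num.max (- a i) 0 <= 2 * (D * C) * `|lincomb n a e|.
  apply: le_trans (lower n (fun i => Num.max (- a i) 0) _) _.
    by move=> i; rewrite le_max lexx orbT.
  have E (V : normedModType R) (v : nat -> V) : lincomb n (fun i => Num.max (- a i) 0) v =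
      - lincomb n (fun i => if a i <= 0 then a i else 0) v.
    rewrite -lincombNl; apply: eq_lincomb => i _.
    congr (_ *: _).
    case: (leP (a i) 0) => h; first by rewrite max_l// oppr_ge0.
    by rewrite max_r ?oppr0// oppr_le0 ltW.
  rewrite !E !normrN.
  have := upper _ _ (fun i => a i <= 0) n a wD.
  have := upper _ _ (fun i => a i <= 0) n a w'D; lra.
rewrite mulrDr; move: m1 m2; lra.
Qed.

(** A bounded functional has a limit along [e]. Otherwise it exceeds some fixed [eps] on infinitely
    many differences [e (p k) - e (q k)] with suitable signs, hence on all their convex
    combinations, while some of these are arbitrarily small. *)
Lemma dominated_functional_cvg (f : nat -> R^o) (D : R) :
  (forall n a, `|lincomb n a f| <= D * `|lincomb n a e|) -> cvgn f.
Proof.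
move=> fD; apply/cvg_nat_cauchyP; apply: contrapT.
move=> /existsNP[eps /not_implyP[eps0 H]].
have {}H N : exists pq, (N < pq.1 < pq.2)%N /\ eps < `|f pq.1 - f pq.2|.
  apply: contrapT => nN; apply: H; exists N.+1 => m n Nm Nn.
  rewrite leNgt; apply/negP => lt; apply: nN.
  case: (ltngtP m n) => mn.
  - by exists (m, n); rewrite /= Nm mn.
  - by exists (n, m); rewrite /= Nn mn distrC.
  by move: lt; rewrite mn subrr normr0 ltNge ltW.
have [s [_ Hs]] := @dependent_choice_nat (nat * nat)
  (fun _ s s' => (s.2 < s'.1 < s'.2)%N /\ eps < `|f s'.1 - f s'.2|) (0, 0)%N
  (fun _ s => H s.2).
pose p k := (s k.+1).1; pose q k := (s k.+1).2.
have pq k : (p k < q k < p k.+1)%N.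
  by have [/andP[_ h] _] := Hs k; have [/andP[h' _] _] := Hs k.+1; apply/andP.
have gap k : eps < `|f (p k) - f (q k)| by have [] := Hs k.
pose sg k : R := if f (q k) <= f (p k) then 1 else -1.
have gap' k : eps < sg k * (f (p k) - f (q k)).
  have := gap k; rewrite /sg; case: (leP (f (q k)) (f (p k))) => h.
    by rewrite ger0_norm ?subr_ge0// mul1r.
  by rewrite ltr0_norm ?subr_lt0// mulN1r.
pose w k := sg k *: (e (p k) - e (q k)).
have wD (P : pred nat) n a :
    `|lincomb n (fun i => if P i then a i else 0) w| <= 4 * C * C * `|lincomb n a e|.
  pose d k := e (p k) - e (q k).
  have h Q : `|lincomb n (fun i => if Q i then a i else 0) d| <= C * (2 * C * `|lincomb n a e|).
    apply: le_trans (differences_spread eK _ _ pq) _.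
    by rewrite ler_pM2l// differences_mask.
  (* Each sign class is a masked combination of differences. *)
  have -> : lincomb n (fun i => if P i then a i else 0) w =
     lincomb n (fun i => if P i && (f (q i) <= f (p i)) then a i else 0) d -
     lincomb n (fun i => if P i && ~~ (f (q i) <= f (p i)) then a i else 0) d.
    rewrite -lincombBl; apply: eq_lincomb => i _; rewrite /w /sg -/(d i).
    case: (P i) => /=; last by rewrite subrr !scale0r.
    by case: ifP => _ /=; rewrite ?subr0 ?sub0r ?scale1r// scaleN1r scalerN scaleNr.
  apply: le_trans (ler_normB _ _) _.
  have := h (fun i => P i && (f (q i) <= f (p i))).
  have := h (fun i => P i && ~~ (f (q i) <= f (p i))); lra.
have D0 : 0 < `|D| + 1 by rewrite ltr_wpDl.
have eps'0 : 0 < eps / 2 / (`|D| + 1) by rewrite !divr_gt0.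
have [n [l [_ l0 l1 small _]]] := small_convex_combination wD wD 0%N eps'0.
move: l1 small; rewrite !big_mkord => l1 small.
pose c k := l k * sg k.
pose b k := scatter p n c k - scatter q n c k.
pose N := (p n + q n).+1.
have p_lt : {homo p : i j / (i < j)%N} by apply: homo_ltnS => i; have := pq i; lia.
have q_lt : {homo q : i j / (i < j)%N}.
  by apply: homo_ltnS => i; have := pq i; have := pq i.+1; lia.
have pN i : (i < n)%N -> (p i < N)%N by move=> /p_lt; rewrite /N; lia.
have qN i : (i < n)%N -> (q i < N)%N by move=> /q_lt; rewrite /N; lia.
have := fD N b.
rewrite /b !lincombBl !lincomb_scatter// -!lincombBr.
have -> : lincomb n c (fun i => (e \o p) i - (e \o q) i) = \sum_(i < n) l i *: w i.
  by apply: eq_bigr => i _; rewrite /w scalerA.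
apply/negP; rewrite -ltNge.
apply: (@le_lt_trans _ _ (eps / 2)).
  rewrite (@le_trans _ _ ((`|D| + 1) * `|\sum_(i < n) l i *: w i|))//.
    by rewrite ler_wpM2r// (le_trans (ler_norm _))// lerDl.
  by rewrite mulrC -ler_pdivlMr.
apply: (@lt_le_trans _ _ eps); first by rewrite ltr_pdivrMr// ltr_pMr// ltr1n.
apply: le_trans (ler_norm _).
rewrite -[leLHS]mulr1 -l1 mulr_sumr; apply: ler_sum => i _.
rewrite mulrC -[_ *: _]/(l i * sg i * (f (p i) - f (q i))) -mulrA.
by rewrite ler_wpM2l// ltW.
Qed.

End convex_blocks.

(** * Strongly summing bases *)

Lemma sum_geometric_le (R : realType) n (f : nat -> R) (B : R) :
  (forall i, (i < n)%N -> f i <= B * 2^-1 ^+ i) -> 0 <= B -> \sum_(i < n) f i <= 2 * B.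
Proof.
move=> H B0; apply: (@le_trans _ _ (\sum_(i < n) B * 2^-1 ^+ i)).
  by apply: ler_sum => i _; exact: H.
by rewrite -mulr_sumr mulrC ler_wpM2r// sum_half_le.
Qed.

Lemma norm_lincomb_geometric_le (R : realType) (X : normedModType R) n
    (c : nat -> R) (x : nat -> X) (k B : R) : 0 <= k -> 0 <= B ->
  (forall i, (i < n)%N -> `|c i| <= k) ->
  (forall i, (i < n)%N -> `|x i| <= B * 2^-1 ^+ i) ->
  `|lincomb n c x| <= 2 * B * k.
Proof.
move=> k0 B0 ck xB; rewrite (le_trans (ler_norm_sum _ _ _))// -mulrA.
apply: (@sum_geometric_le _ _ (fun i => `|c i *: x i|)); last by rewrite mulr_ge0.
by move=> i i_n; rewrite normrZ mulrAC mulrC ler_pM// ?xB// ck.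
Qed.

Lemma eventually_forall_lt (P : nat -> nat -> Prop) :
  (forall m, exists I, forall i, (I <= i)%N -> P m i) ->
  forall n, exists I, forall i, (I <= i)%N -> forall m, (m < n)%N -> P m i.
Proof.
move=> H; elim=> [|n [I HI]]; first by exists 0%N.
have [J HJ] := H n; exists (maxn I J) => i; rewrite geq_max => /andP[Ii Ji] m.
by rewrite ltnS leq_eqVlt => /predU1P[->|]; [exact: HJ|exact: HI].
Qed.

Section double_copy.
Variables (R : realType) (X : completeNormedModType R) (e : nat -> X) (C : R).
Hypotheses (ecs : conditional_spreading_basis e) (eC : bounds e C).

Let C0 : 0 < C. Proof. by case: eC. Qed.
Let eK : uniformly_spreading C e. Proof. by case: eC. Qed.
Let eB i : `|e i| <= C. Proof. by case: eC. Qed.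
Let coefC n (a : nat -> R) i : (i < n)%N -> `|a i| <= C * `|lincomb n a e|.
Proof. by case: eC => _ _ _ + _; exact. Qed.
Let prefixC m n (a : nat -> R) : (m <= n)%N -> `|\sum_(i < m) a i| <= C * `|lincomb n a e|.
Proof. by case: eC => _ _ _ _ [+ _]; exact. Qed.
Let projC m n (a : nat -> R) : (m <= n)%N -> `|lincomb m a e| <= C * `|lincomb n a e|.
Proof. by case: eC => _ _ _ _ [_]; exact. Qed.

Lemma dominated_subsequence (Y : normedModType R) (v : nat -> Y) (D : R) f :
  (forall n a, `|lincomb n a v| <= D * `|lincomb n a e|) ->
  {homo f : i j / (i < j)%N} -> 0 <= D ->
  forall n a, `|lincomb n a (v \o f)| <= D * (C * `|lincomb n a e|).
Proof.
move=> vD f_lt D0 n a.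
have fN i : (i < n)%N -> (f i < f n)%N by exact: f_lt.
rewrite -(lincomb_scatter v a fN) (le_trans (vD _ _))// ler_wpM2l//.
by rewrite lincomb_scatter//; exact: spread_le.
Qed.

Lemma lincomb_matrix n (c : nat -> R) (l : nat -> nat) (A : nat -> nat -> R) N :
  (forall i m, (l i <= m)%N -> A i m = 0) -> (forall i, (i < n)%N -> (l i <= N)%N) ->
  lincomb n c (fun i => lincomb (l i) (A i) e) =
  lincomb N (fun m => \sum_(i < n) c i * A i m) e.
Proof.
move=> Al lN; rewrite /lincomb.
under [RHS]eq_bigr do rewrite scaler_suml.
rewrite [RHS]exchange_big; apply: eq_bigr => i _ /=.
rewrite -/(lincomb _ _ _) (lincomb_widen _ _ (lN i (ltn_ord i))) /lincomb scaler_sumr.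
apply: eq_bigr => m _; rewrite scalerA; case: ltnP => // h.
by rewrite Al// mulr0.
Qed.

Section finitely_supported.
Variables (l : nat -> nat) (A : nat -> nat -> R) (D : R).
Hypothesis supp : forall i m, (l i <= m)%N -> A i m = 0.
Let v i := lincomb (l i) (A i) e.
Hypothesis vD : forall n a, `|lincomb n a v| <= D * `|lincomb n a e|.

Let bound n := \sum_(i < n) l i.
Let lbound n i : (i < n)%N -> (l i <= bound n)%N.
Proof. by move=> i_n; rewrite /bound (bigD1 (Ordinal i_n))//= leq_addr. Qed.

(** As a function of [i], the coordinate [m] of [v i] is a functional dominated by [e], since [v]
    is. The same holds for the sum of the coordinates. *)
Lemma coordinate_cvg m : cvgn ((fun i => A i m) : nat -> R^o).
Proof.
apply: (@dominated_functional_cvg _ _ _ _ ecs eC (fun i => A i m) (C * D)) => n a.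
rewrite -mulrA.
apply: le_trans (_ : C * `|lincomb n a v| <= _); last by rewrite ler_pM2l.
have lN i : (i < n)%N -> (l i <= maxn m.+1 (bound n))%N.
  by move=> /lbound h; rewrite leq_max h orbT.
rewrite (lincomb_matrix a supp lN).
by apply: (@coefC _ (fun k => \sum_(i < n) a i * A i k) m); rewrite leq_max ltnSn.
Qed.

Lemma sum_cvg : cvgn ((fun i => \sum_(m < l i) A i m) : nat -> R^o).
Proof.
apply: (@dominated_functional_cvg _ _ _ _ ecs eC (fun i => \sum_(m < l i) A i m) (C * D)) => n a.
rewrite -mulrA.
apply: le_trans (_ : C * `|lincomb n a v| <= _); last by rewrite ler_pM2l.
have := @lbound n; move: (bound n) => N lN.
rewrite (lincomb_matrix a supp lN); apply: le_trans (@prefixC N N _ (leqnn N)).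
rewrite exchange_big le_eqVlt /=; apply/orP; left; apply/eqP; congr (`| _ |).
apply: eq_bigr => i _; rewrite -mulr_sumr; congr (_ * _).
have /= -> := big_ord_widen _ (A i) (lN i (ltn_ord i)).
by rewrite big_mkcond; apply: eq_bigr => m _; case: ltnP => // /supp ->.
Qed.

(** The initial segments of [a] are limits of projections of the bounded sequence [v]. If [e] is
    strongly summing, the series of [a] therefore converges. *)
Lemma limit_bounded (a : nat -> R) :
  (forall m, ((fun i => A i m) : nat -> R^o) @ \oo --> (a m : R^o)) ->
  forall n, `|lincomb n a e| <= C * (D * C).
Proof.
move=> Aa n; apply: (@le_addM_gt0 _ _ _ (C * n%:R)) => eps eps0.
have [I HI] : exists I, forall i, (I <= i)%N -> forall m, (m < n)%N -> `|a m - A i m| <= eps.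
  apply: eventually_forall_lt => m; have /cvg_natP/(_ _ eps0)[I HI] := Aa m.
  by exists I.
have vI : `|v I| <= D * C.
  have := vD I.+1 (fun i => (i == I)%:R).
  rewrite /lincomb !big_ord_recr /= eqxx !scale1r big1 ?add0r => [|i _]; last first.
    by rewrite (ltn_eqF (ltn_ord i)) scale0r.
  rewrite big1 ?add0r => [|i _]; last by rewrite (ltn_eqF (ltn_ord i)) scale0r.
  move=> /le_trans; apply; rewrite ler_wpM2l//.
  have := vD 1%N (fun=> 1); rewrite /lincomb !big_ord1 !scale1r => h.
  have : 0 < `|e 0|.
    have := @coefC 1%N (fun=> 1) 0%N isT; rewrite normr1 /lincomb big_ord1 scale1r => h1.
    by rewrite -(pmulr_rgt0 _ C0) (lt_le_trans _ h1).
  move=> e0; rewrite -(pmulr_lge0 _ e0); exact: le_trans h.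
have h1 : `|lincomb n (A I) e| <= C * (D * C).
  apply: le_trans (_ : C * `|v I| <= _); last by rewrite ler_pM2l.
  have -> : v I = lincomb (maxn n (l I)) (A I) e.
    rewrite /v (lincomb_widen _ _ (leq_maxr n _)); apply: eq_lincomb => i _.
    by case: ltnP => // /supp ->.
  by apply: projC; rewrite leq_maxl.
have h2 : `|lincomb n (fun m => a m - A I m) e| <= C * n%:R * eps.
  rewrite (le_trans (norm_lincomb_le _ (fun i _ => eB i)))// -mulrA ler_pM2l//.
  rewrite (@le_trans _ _ (\sum_(i < n) eps))//.
    by apply: ler_sum => i _; exact: HI.
  by rewrite sumr_const card_ord mulr_natl.
rewrite -(subrK (lincomb n (A I) e) (lincomb n a e)) -lincombBl addrC.
by rewrite (le_trans (ler_normD _ _))// lerD.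
Qed.

End finitely_supported.

(** * Sliding humps *)

Section sliding_hump.
Variables (M N l : nat -> nat) (V : nat -> nat -> R) (a : nat -> R) (D E B : R).
Hypotheses (M0 : M 0 = 0%N) (Mlt : {homo M : i j / (i < j)%N}).
Hypothesis Nlt : {homo N : i j / (i < j)%N}.
Hypothesis supp : forall i m, (l i <= m)%N -> V i m = 0.
Hypothesis lM : forall i, (l (N i) <= M i.+1)%N.
Hypotheses (D0 : 0 <= D) (E0 : 0 <= E).
Let v i := lincomb (l i) (V i) e.
Hypothesis vD : forall n c, `|lincomb n c v| <= D * `|lincomb n c e|.
Hypothesis Va : forall i, \sum_(t < M i) `|V (N i) t - a t| <= 2^-1 ^+ i.
Hypothesis humpE : forall i, `|\sum_(M i <= t < M i.+1) V (N i) t| <= E * 2^-1 ^+ i.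
Hypothesis aE : forall i, `|\sum_(M i <= t < M i.+1) a t| <= E * 2^-1 ^+ i.
Hypothesis aB : forall n, `|lincomb n a e| <= B.

(** The part of [v (N i)] beyond the coordinates where it is close to [a]. It ends before [M i.+1],
    where the next hump starts. *)
Definition hump i := \sum_(M i <= t < M i.+1) V (N i) t *: e t.
Let A i := \sum_(M i <= t < M i.+1) a t *: e t.
Definition hump_error i := lincomb (M i) (fun t => V (N i) t - a t) e.

Lemma hump_decomposition i : v (N i) = lincomb (M i) a e + hump i + hump_error i.
Proof.
rewrite addrAC /hump_error -lincombDl.
rewrite (@eq_lincomb _ _ (M i) _ (V (N i)) _ e) => [|t _]; last by rewrite addrC subrK.
have -> : v (N i) = lincomb (M i.+1) (V (N i)) e.
  rewrite /v (lincomb_widen _ _ (lM i)); apply: eq_lincomb => t _.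
  by case: ltnP => // /supp ->.
rewrite /lincomb /hump -!(big_mkord xpredT (fun t => V (N i) t *: e t)).
by rewrite (@big_cat_nat _ _ _ (M i))//; apply/ltnW/Mlt.
Qed.

Lemma norm_hump_error_le i : `|hump_error i| <= C * 2^-1 ^+ i.
Proof.
by rewrite (le_trans (norm_lincomb_le _ (fun t _ => eB t)))// ler_pM2l.
Qed.

Lemma lincomb_block_of n (F : nat -> nat -> R) :
  lincomb (M n) (fun t => F (block_of M t) t) e =
  \sum_(k < n) \sum_(M k <= t < M k.+1) F k t *: e t.
Proof.
rewrite /lincomb (big_partition_nat M0 Mlt (fun t => F (block_of M t) t *: e t)).
apply: eq_bigr => k _; apply: eq_big_nat => t Ht.
by rewrite (block_of_uniq M0 Mlt Ht).
Qed.

Lemma block_of_bound n t : (t < M n)%N -> (block_of M t < n)%N.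
Proof. by rewrite block_of_lt. Qed.

Lemma sum_block_of n k (F : nat -> nat -> R) : (k < n)%N ->
  \sum_(t < M n | block_of M t == k) F (block_of M t) t =
  \sum_(M k <= t < M k.+1) F k t.
Proof.
move=> kn; rewrite (big_block M0 Mlt (fun t => F (block_of M t) t) kn).
by apply: eq_big_nat => t Ht; rewrite (block_of_uniq M0 Mlt Ht).
Qed.

(** Suppressing pieces of [a] costs only their sums, which are summable by [aE]. The pieces thus
    form a bounded family under all choices of indices, to which bounded multipliers can be
    applied. *)
Lemma norm_sum_blocks_le (P : pred nat) n :
  `|\sum_(j < n | P j) A j| <= C * (C * B + C * (2 * E)).
Proof.
have := @suppression _ _ _ _ C0 eK (block_of M) (predC P) (M n) a C n
  (block_of_homo M0 Mlt) eB (@block_of_bound n).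
rewrite (lincomb_block_of n (fun k t => if predC P k then 0 else a t)).
have -> : \sum_(k < n) \sum_(M k <= t < M k.+1) (if predC P k then 0 else a t) *: e t =
    \sum_(j < n | P j) A j.
  rewrite [RHS]big_mkcond; apply: eq_bigr => k _ /=.
  by case: (P k) => //=; rewrite big1// => t _; rewrite scale0r.
move=> /le_trans; apply; rewrite ler_pM2l// lerD ?ler_pM2l//.
rewrite big_mkcond.
apply: (@sum_geometric_le _ _ (fun k => if ~~ P k then
  `|\sum_(i < M n | block_of M i == k) a i| else 0)) => // k kn.
rewrite (sum_block_of (fun=> a) kn); case: ifP => _ //.
by rewrite mulr_ge0// ltW// half_exp_gt0.
Qed.

(* The even humps and the pieces of [a] are suppressed from the differences
   [v (N (2 i)) - v (N (2 i + 1))]. *)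
Lemma hump_mask : exists2 D' : R, 0 <= D' & forall (P : pred nat) n c,
  `|lincomb n (fun i => if P i then c i else 0) (fun i => hump i.*2.+1)|
    <= D' * `|lincomb n c e|.
Proof.
exists (C * (C * (2 * (D * C) + 4 * C * C) + C * (2 * (C * (2 * E))))).
  by rewrite !mulr_ge0 ?addr_ge0 ?mulr_ge0 ?addr_ge0 ?mulr_ge0 ?(ltW C0).
move=> P n c; set L := `|lincomb n c e|.
have cL i : (i < n)%N -> `|c i| <= C * L by exact: coefC.
(* On the block [2 i], the vector [v (N (2 i + 1))] already follows [a], hence [V - a] there. On the
   block [2 i + 1], it is the only one of the two left. *)
pose F k t := if odd k then - (c k./2 * V (N k) t) else c k./2 * (V (N k) t - a t).
pose x := lincomb n c (fun i => hump i.*2 - A i.*2 - hump i.*2.+1).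
have xE : lincomb (M n.*2) (fun t => F (block_of M t) t) e = x.
  rewrite lincomb_block_of (big_ord_double (fun k => \sum_(M k <= t < M k.+1) F k t *: e t)).
  apply: eq_bigr => i _; rewrite scalerBr /hump /A -sumrB !scaler_sumr -sumrN.
  congr (_ + _); apply: eq_bigr => t _; rewrite /F /= odd_double /= ?doubleK ?uphalf_double.
    by rewrite -scalerBl scalerA.
  by rewrite scaleNr scalerA.
have xL : `|x| <= (2 * (D * C) + 4 * C * C) * L.
  have -> : x = lincomb n c (v \o (N \o double)) - lincomb n c (v \o (N \o (fun i => i.*2.+1)))
      - (lincomb n c (fun i => hump_error i.*2) - lincomb n c (fun i => hump_error i.*2.+1)).
    rewrite -!lincombBr; apply: eq_lincomb => i _ /=; congr (_ *: _).
    rewrite !hump_decomposition.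
    have -> : lincomb (M i.*2.+1) a e = lincomb (M i.*2) a e + A i.*2.
      rewrite /lincomb -!(big_mkord xpredT (fun t => a t *: e t)).
      by rewrite (@big_cat_nat _ _ _ (M i.*2))//; apply/ltnW/Mlt.
    set p := lincomb _ _ _; set q := hump _; set r := hump_error _; set s := A _.
    set t := hump _; set u := hump_error _.
    have -> : p + q + r - (p + s + t + u) = q - s - t + (r - u).
      rewrite -(addrA p q) -(addrA p s) -(addrA p (s + t)) opprD addrACA subrr add0r.
      by rewrite !opprD !addrA [q + r - s]addrAC [q - s + r - t]addrAC.
    by rewrite addrK.
  rewrite (le_trans (ler_normB _ _))// mulrDl lerD//.
    rewrite (le_trans (ler_normB _ _))// -mulrA mulr_natl mulr2n lerD// -mulrA;
    apply: dominated_subsequence => // i j ij; apply: Nlt; lia.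
  rewrite (le_trans (ler_normB _ _))//.
  have -> : 4 * C * C * L = 2 * C * (C * L) + 2 * C * (C * L) by ring.
  have err f : (forall i, (i <= f i)%N) ->
      `|lincomb n c (fun i => hump_error (f i))| <= 2 * C * (C * L).
    move=> f_le; apply: (norm_lincomb_geometric_le _ (ltW C0) cL) => [|i _].
      by rewrite mulr_ge0 ?(ltW C0) ?normr_ge0.
    apply: le_trans (norm_hump_error_le _) _.
    by rewrite ler_pM2l// half_exp_le.
  by rewrite lerD//; apply: err => i; lia.
pose Q k := ~~ odd k || ~~ P k./2.
have := @suppression _ _ _ _ C0 eK (block_of M) Q (M n.*2) (fun t => F (block_of M t) t) C n.*2
  (block_of_homo M0 Mlt) eB (@block_of_bound n.*2).
rewrite xE (lincomb_block_of n.*2 (fun k t => if Q k then 0 else F k t)).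
have -> : \sum_(k < n.*2) \sum_(M k <= t < M k.+1) (if Q k then 0 else F k t) *: e t =
   - lincomb n (fun i => if P i then c i else 0) (fun i => hump i.*2.+1).
  rewrite (big_ord_double (fun k => \sum_(M k <= t < M k.+1) (if Q k then 0 else F k t) *: e t)).
  rewrite -sumrN; apply: eq_bigr => i _.
  rewrite [X in X + _]big1 ?add0r => [|t _]; last by rewrite /Q odd_double scale0r.
  rewrite /Q /F /hump -scaleNr scaler_sumr; apply: eq_bigr => t _.
  rewrite /= odd_double /= uphalf_double.
  by case: (P i) => /=; rewrite ?oppr0 ?scale0r// scalerA mulNr.
rewrite normrN => /le_trans; apply; rewrite -mulrA ler_pM2l// mulrDl lerD//.
  by rewrite -mulrA ler_pM2l.
rewrite -mulrA ler_pM2l// big_mkcond -mulrA.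
apply: (@sum_geometric_le _ _ (fun k => if Q k then
  `|\sum_(i < M n.*2 | block_of M i == k) F (block_of M i) i| else 0)); last first.
  by rewrite !mulr_ge0 ?(ltW C0) ?normr_ge0.
move=> k kn; rewrite (sum_block_of F kn).
have h0 : 0 <= C * (2 * E) * L * 2^-1 ^+ k.
  by rewrite !mulr_ge0 ?(ltW C0) ?normr_ge0 ?(ltW (half_exp_gt0 _ _)).
case: ifP => _ //; rewrite /F.
have k2 : (k./2 < n)%N by rewrite ltn_half_double.
have cL0 : 0 <= C * L by rewrite mulr_ge0 ?(ltW C0) ?normr_ge0.
have -> : C * (2 * E) * L * 2^-1 ^+ k = C * L * (E * 2^-1 ^+ k + E * 2^-1 ^+ k) by ring.
case: (odd k).
  rewrite sumrN normrN -mulr_sumr normrM ler_pM// ?cL// (le_trans (humpE k))// lerDl.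
  by rewrite mulr_ge0// ltW// half_exp_gt0.
rewrite -mulr_sumr normrM ler_pM// ?cL// sumrB (le_trans (ler_normB _ _))// lerD//.
Qed.

End sliding_hump.

(* The limits of [v] have no mass at infinity: beyond [a], its terms are
   humps with almost vanishing sums. Convex combinations make the humps and
   the differences of [e] small, and then the alternating series of the
   corresponding convex blocks of [e] is bounded. *)
Lemma no_massless_copy (V : nat -> nat -> R) (l : nat -> nat) (a : nat -> R) (s D B : R) :
  strongly_summing e -> 0 <= D ->
  (forall i m, (l i <= m)%N -> V i m = 0) ->
  let v i := lincomb (l i) (V i) e in
  (forall n c, `|lincomb n c v| <= D * `|lincomb n c e|) ->
  (forall f n c, {homo f : i j / (i < j)%N} -> (forall i, `|c i| <= 1) ->
     `|lincomb n c e| <= D * (`|lincomb n c (v \o f)| + `|lincomb n c (differences e)| + 1)) ->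
  (forall m, ((fun i => V i m) : nat -> R^o) @ \oo --> (a m : R^o)) ->
  ((fun i => \sum_(m < l i) V i m) : nat -> R^o) @ \oo --> (s : R^o) ->
  (series a : nat -> R^o) @ \oo --> (s : R^o) ->
  (forall n, `|lincomb n a e| <= B) -> False.
Proof.
move=> ess D0 supp v vD eD Va Vs as_ aB.
(* The factor [1 + |s|] lets the last estimate hold for the empty segment at [M 0 = 0]. *)
pose T i m n := [/\ \sum_(t < m) `|V n t - a t| <= 2^-1 ^+ i,
  `|s - \sum_(t < l n) V n t| <= 2^-1 ^+ i &
  `|s - \sum_(t < m) a t| <= (1 + `|s|) * 2^-1 ^+ i].
have s0 : 0 < 1 + `|s| by rewrite ltr_pwDl.
have evV i m : exists I, forall n, (I <= n)%N ->
    \sum_(t < m) `|V n t - a t| <= 2^-1 ^+ i /\ `|s - \sum_(t < l n) V n t| <= 2^-1 ^+ i.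
  have h0 : 0 < (2^-1 : R) ^+ i / m.+1%:R by rewrite divr_gt0// half_exp_gt0.
  have [I HI] : exists I, forall n, (I <= n)%N -> forall t, (t < m)%N ->
      `|a t - V n t| <= 2^-1 ^+ i / m.+1%:R.
    by apply: eventually_forall_lt => t; have /cvg_natP/(_ _ h0) := Va t.
  have /cvg_natP/(_ _ (half_exp_gt0 _ i))[J HJ] := Vs.
  exists (maxn I J) => n; rewrite geq_max => /andP[In Jn]; split; last exact: HJ.
  apply: (@le_trans _ _ (\sum_(t < m) 2^-1 ^+ i / m.+1%:R)).
    by apply: ler_sum => t _; rewrite distrC HI.
  rewrite sumr_const card_ord -[_ *+ m]mulr_natr -mulrA ler_piMr ?(ltW (half_exp_gt0 _ _))//.
  by rewrite mulrC ler_pdivrMr// mul1r ler_nat.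
have eva i : exists I, forall m, (I <= m)%N -> `|s - \sum_(t < m) a t| <= (1 + `|s|) * 2^-1 ^+ i.
  have /cvg_natP/(_ ((1 + `|s|) * 2^-1 ^+ i)) := as_.
  rewrite mulr_gt0 ?half_exp_gt0// => /(_ isT)[I HI]; exists I => m Im.
  by have := HI m Im; rewrite /series /= big_mkord.
have [n0 Hn0] := evV 0%N 0%N.
have [st [st0 Hst]] := @dependent_choice_nat (nat * nat) (fun i p p' =>
    [/\ (p.1 < p'.1)%N, (p.2 < p'.2)%N, (l p.2 <= p'.1)%N & T i.+1 p'.1 p'.2])
  (0%N, n0) (fun i p => ltac:(
    have [I HI] := eva i.+1; have [J HJ] := evV i.+1 (maxn p.1.+1 (maxn (l p.2) I));
    exists (maxn p.1.+1 (maxn (l p.2) I), maxn p.2.+1 J); split=> /=;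
    [by rewrite leq_max leqnn | by rewrite leq_max leqnn
    |by rewrite !leq_max leqnn orbT
    |have [h1 h2] := HJ (maxn p.2.+1 J) (leq_maxr _ _); split=> //;
     by apply: HI; rewrite !leq_max leqnn !orbT])).
pose M i := (st i).1; pose N i := (st i).2.
have M0 : M 0 = 0%N by rewrite /M st0.
have Mlt : {homo M : i j / (i < j)%N} by apply: homo_ltnS => i; case: (Hst i).
have Nlt : {homo N : i j / (i < j)%N} by apply: homo_ltnS => i; case: (Hst i).
have lM i : (l (N i) <= M i.+1)%N by case: (Hst i).
have HT i : T i (M i) (N i).
  case: i => [|i]; last by case: (Hst i).
  have [h1 h2] := Hn0 n0 (leqnn _).
  rewrite /M /N st0 /=; split=> //; rewrite big_ord0 subr0 expr0 mulr1 lerDr//.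
pose E := 4 + 2 * `|s|.
have E0 : 0 <= E by rewrite addr_ge0// mulr_ge0.
have sumM (F : nat -> R) i :
    \sum_(M i <= t < M i.+1) F t = \sum_(t < M i.+1) F t - \sum_(t < M i) F t.
  rewrite -!(big_mkord xpredT F) [in RHS](@big_cat_nat _ _ _ (M i) 0 (M i.+1))//=.
    by rewrite [RHS]addrC addKr.
  exact/ltnW/Mlt.
have aE i : `|\sum_(M i <= t < M i.+1) a t| <= E * 2^-1 ^+ i.
  have [_ _ h1] := HT i; have [_ _ h2] := HT i.+1.
  rewrite sumM -(subrKA s) (le_trans (ler_normD _ _))// distrC.
  have : (2^-1 : R) ^+ i.+1 <= 2^-1 ^+ i by rewrite half_exp_le.
  move/(ler_wpM2l (ltW s0)); have := half_exp_gt0 R i; rewrite /E; lra.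
have VE i : `|\sum_(M i <= t < M i.+1) V (N i) t| <= E * 2^-1 ^+ i.
  have [h1 h2 h3] := HT i.
  (* Here no mass is lost: the sums of the [V n] and the series of [a] have the same limit [s], so
     that three small terms are all that remains of the sum of the hump. *)
  have -> : \sum_(M i <= t < M i.+1) V (N i) t = (s - \sum_(t < M i) a t)
      - (s - \sum_(t < l (N i)) V (N i) t) - \sum_(t < M i) (V (N i) t - a t).
    have -> : \sum_(t < l (N i)) V (N i) t = \sum_(t < M i.+1) V (N i) t.
      rewrite (big_ord_widen _ (V (N i)) (lM i)) big_mkcond; apply: eq_bigr => t _.
      by case: ltnP => // /supp ->.
    by rewrite sumM sumrB; ring.
  have h4 : `|\sum_(t < M i) (V (N i) t - a t)| <= 2^-1 ^+ i.
    exact: le_trans (ler_norm_sum _ _ _) h1.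
  rewrite (le_trans (ler_normB _ _))//.
  have := ler_normB (s - \sum_(t < M i) a t) (s - \sum_(t < l (N i)) V (N i) t).
  have := mulr_ge0 (normr_ge0 s) (ltW (half_exp_gt0 R i)).
  by have := half_exp_gt0 R i; rewrite /E; lra.
have Va' i : \sum_(t < M i) `|V (N i) t - a t| <= 2^-1 ^+ i by case: (HT i).
pose b := hump M N V.
have [D' D'0 bD] : exists2 D' : R, 0 <= D' & forall (P : pred nat) n c,
    `|lincomb n (fun i => if P i then c i else 0) (fun i => b i.*2.+1)| <= D' * `|lincomb n c e|.
  exact: (@hump_mask M N l V a D E M0 Mlt Nlt supp lM D0 E0 vD Va' VE aE).
have bD2 (P : pred nat) n c :
    `|lincomb n (fun i => if P i then c i else 0) (fun i => b i.*2.+1)|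
      <= (D' + 2 * C) * `|lincomb n c e|.
  by rewrite (le_trans (bD _ _ _))// ler_wpM2r// lerDl mulr_ge0// ltW.
have uD2 (P : pred nat) n c :
    `|lincomb n (fun i => if P i then c i else 0) (differences e)|
      <= (D' + 2 * C) * `|lincomb n c e|.
  by rewrite (le_trans (differences_mask C0 eK _ _ _))// ler_wpM2r// lerDr.
have [sq [sq0 Hsq]] := @dependent_choice_nat (nat * (nat -> R)) (fun i p p' =>
   [/\ (p.1 < p'.1)%N, forall t, 0 <= p'.2 t, \sum_(p.1 <= t < p'.1) p'.2 t = 1,
      `|\sum_(p.1 <= t < p'.1) p'.2 t *: b t.*2.+1| <= 2^-1 ^+ i &
      `|\sum_(p.1 <= t < p'.1) p'.2 t *: differences e t| <= 2^-1 ^+ i])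
  (0%N, fun=> 0) (fun i p => ltac:(
    have [n [lam Hn]] := small_convex_combination ecs eC bD2 uD2 p.1 (half_exp_gt0 R i);
    by exists (n, lam))).
pose Q i := (sq i).1; pose lam i := (sq i.+1).2.
have Q0 : Q 0 = 0%N by rewrite /Q sq0.
have Qlt : {homo Q : i j / (i < j)%N} by apply: homo_ltnS => i; case: (Hsq i).
have lam0 i t : 0 <= lam i t by case: (Hsq i) => _ + _ _ _; exact.
have lam1 i : \sum_(Q i <= t < Q i.+1) lam i t = 1 by case: (Hsq i).
have lamb i : `|\sum_(Q i <= t < Q i.+1) lam i t *: b t.*2.+1| <= 2^-1 ^+ i by case: (Hsq i).
have lamu i : `|\sum_(Q i <= t < Q i.+1) lam i t *: differences e t| <= 2^-1 ^+ i by case: (Hsq i).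
(* Successive convex blocks with alternating signs. The partial sums [p] stay in [0, 1] and are
   alternately 0 and 1 at the ends [Q k], so the series of [c] diverges; it remains to bound its
   combinations of [e]. *)
pose c t := (-1) ^+ block_of Q t * lam (block_of Q t) t.
pose p t := \sum_(j < t) c j.
have pE i t : (Q i <= t <= Q i.+1)%N ->
    p t = \sum_(j < i) (-1) ^+ j + (-1) ^+ i * \sum_(Q i <= j < t) lam i j.
  move=> /andP[Qt tQ]; rewrite /p -(big_mkord xpredT c) (@big_cat_nat _ _ _ (Q i))//=.
  rewrite (big_mkord xpredT c) (big_partition_nat Q0 Qlt); congr (_ + _).
    apply: eq_bigr => j _.
    rewrite -[RHS]mulr1 -[X in _ = _ * X](lam1 j) mulr_sumr.
    by apply: eq_big_nat => k Hk; rewrite /c (block_of_uniq Q0 Qlt Hk).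
  rewrite mulr_sumr; apply: eq_big_nat => k Hk.
  by rewrite /c (@block_of_uniq Q Q0 Qlt k i)//; lia.
have altE i : \sum_(j < i) (-1) ^+ j = (odd i)%:R :> R.
  elim: i => [|i IH]; first by rewrite big_ord0.
  by rewrite big_ord_recr /= IH -signr_odd; case: (odd i); rewrite /= ?expr0 ?expr1; lra.
have lam01 i t : (Q i <= t <= Q i.+1)%N -> 0 <= \sum_(Q i <= j < t) lam i j <= 1.
  move=> /andP[Qt tQ]; rewrite sumr_ge0//= -(lam1 i).
  by rewrite [leRHS](@big_cat_nat _ _ _ t)//= lerDl sumr_ge0.
have p01 t : 0 <= p t <= 1.
  have /andP[h1 /ltnW h2] := block_ofP Q0 Qlt t.
  have h : (Q (block_of Q t) <= t <= Q (block_of Q t).+1)%N by apply/andP.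
  rewrite (pE _ _ h) altE; have /andP[] := lam01 _ _ h; rewrite -signr_odd.
  by case: (odd _); rewrite ?expr0 ?expr1 /=; lra.
have c1 t : `|c t| <= 1.
  have /andP[h1 h2] := block_ofP Q0 Qlt t; set k := block_of Q t in h1 h2.
  rewrite /c -/k normrM normrX normrN1 expr1n mul1r ger0_norm// -(lam1 k).
  rewrite (@big_cat_nat _ _ _ t)//=; last exact: ltnW.
  by rewrite [X in _ <= _ + X]big_ltn// addrCA lerDl addr_ge0// sumr_ge0.
(* Odd indices, because only the odd humps admit masks. *)
pose f t := N t.*2.+1.
have f_lt : {homo f : i j / (i < j)%N} by move=> i j ij; apply: Nlt; lia.
pose A i := \sum_(M i <= t < M i.+1) a t *: e t.
pose bnd := 2 * (C * (C * B + C * (2 * E))) + 2 * 1 + 2 * C * 1.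
have lincombQ (Y : normedModType R) (y : nat -> Y) k :
    lincomb (Q k) c y = lincomb k (fun i => (-1) ^+ i)
      (fun i => \sum_(Q i <= t < Q i.+1) lam i t *: y t).
  rewrite /lincomb (big_partition_nat Q0 Qlt (fun t => c t *: y t)).
  apply: eq_bigr => i _; rewrite scaler_sumr; apply: eq_big_nat => t Ht.
  by rewrite /c (block_of_uniq Q0 Qlt Ht) scalerA.
have sgn1 i : `|(-1) ^+ i| <= 1 :> R by rewrite normrX normrN1 expr1n.
have vbnd k : `|lincomb (Q k) c (v \o f)| <= bnd.
  have -> : lincomb (Q k) c (v \o f) = lincomb (Q k) c (fun t => lincomb (M t.*2.+1) a e) +
      lincomb (Q k) c (fun t => b t.*2.+1) +
      lincomb (Q k) c (fun t => hump_error M N V a t.*2.+1).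
    rewrite -!lincombDr; apply: eq_lincomb => t _; congr (_ *: _).
    exact: (hump_decomposition a Mlt supp lM).
  rewrite (le_trans (ler_normD _ _))// lerD//; last first.
    apply: norm_lincomb_geometric_le => //; first exact: ltW.
    move=> t _; rewrite (le_trans (norm_hump_error_le Va' _))// ler_pM2l// half_exp_le//; lia.
  rewrite (le_trans (ler_normD _ _))// lerD//; last first.
    rewrite lincombQ -[2 * 1]mulr1; apply: norm_lincomb_geometric_le => // i _.
    by rewrite mul1r lamb.
  pose n := (Q k).*2.
  (* The piece [A j] of [a] belongs to the initial segments with [j < t.*2.+1]. Its total
     coefficient is a difference of two values of [p], hence at most 1 in absolute value. *)
  pose tau j := p (Q k) - p (minn (uphalf j) (Q k)).
  have -> : lincomb (Q k) c (fun t => lincomb (M t.*2.+1) a e) = \sum_(j < n) tau j *: A j.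
    rewrite /lincomb.
    under eq_bigr => t _.
      rewrite (big_partition_nat M0 Mlt (fun s => a s *: e s)).
      rewrite (big_ord_widen n A); last by have := ltn_ord t; rewrite /n; lia.
      rewrite big_mkcond scaler_sumr.
      over.
    rewrite exchange_big; apply: eq_bigr => j _ /=.
    have -> : tau j = \sum_(t < Q k | (j < t.*2.+1)%N) c t.
      rewrite /tau /p.
      rewrite (big_ord_widen _ c (geq_minr (uphalf j) (Q k))).
      rewrite [X in X - _](bigID (fun t : 'I_(Q k) => (t < minn (uphalf j) (Q k))%N)) /=.
      rewrite [LHS]addrC addKr; apply: eq_bigl => t.
      have := ltn_ord t; rewrite -leqNgt; lia.
    rewrite scaler_suml [RHS]big_mkcond; apply: eq_bigr => t _.
    by case: ifP => _; rewrite ?scaler0.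
  apply: multiplier_le => [P|j].
    exact: (@norm_sum_blocks_le M a E B M0 Mlt E0 aE aB P n).
  rewrite /tau; have := p01 (Q k); have := p01 (minn (uphalf j) (Q k)).
  by rewrite ler_norml; lra.
have ubnd k : `|lincomb (Q k) c (differences e)| <= 2 * 1 * 1.
  rewrite lincombQ; apply: norm_lincomb_geometric_le => // i _.
  by rewrite mul1r lamu.
have ebnd n : `|lincomb n c e| <= C * (D * (bnd + 2 * 1 * 1 + 1)).
  apply: le_trans (projC c (homo_ltn_geq Qlt n)) _; rewrite ler_pM2l//.
  apply: le_trans (eD f _ c f_lt c1) _; rewrite ler_wpM2l// lerD2r lerD//.
have /cvg_nat_cauchyP/(_ 2^-1)[|n1 Hn1] := ess c (ex_intro _ _ ebnd).
  by rewrite invr_gt0.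
have h1 := homo_ltn_geq Qlt n1.
have h2 : (n1 <= Q n1.+1)%N by rewrite (leq_trans h1)// ltnW// Qlt.
have := Hn1 _ _ h1 h2; rewrite /series /= !big_mkord -/(p _) -/(p _).
have E1 k : p (Q k) = (odd k)%:R.
  by rewrite (pE k) ?leqnn ?(ltnW (Qlt _ _ _))// altE big_geq// mulr0 addr0.
by rewrite !E1 /=; case: (odd n1) => /=; rewrite ?subr0 ?sub0r ?normrN normr1; lra.
Qed.
End double_copy.

(** * Reduction of two copies to one combination *)

Section double_copy_embedding.
Variables (R : realType) (X : completeNormedModType R) (e : nat -> X) (C : R).
Hypotheses (ecs : conditional_spreading_basis e) (eC : bounds e C).

Let C0 : 0 < C. Proof. by case: eC. Qed.
Let eK : uniformly_spreading C e. Proof. by case: eC. Qed.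
Let coefC n (a : nat -> R) i : (i < n)%N -> `|a i| <= C * `|lincomb n a e|.
Proof. by case: eC => _ _ _ + _; exact. Qed.

(** Every large length is admissible, so that two vectors can be approximated with a common
    length. *)
Lemma finite_approximation (x : X) (eps : R) : 0 < eps -> exists N, forall l, (N <= l)%N ->
  exists A : nat -> R, (forall m, (l <= m)%N -> A m = 0) /\ `|x - lincomb l A e| <= eps.
Proof.
move=> eps0; case: ecs => /(_ x)[a [/cvg_natP/(_ _ eps0)[N HN] _]] _ _.
exists N => l Nl; exists (fun m => if (m < l)%N then a m else 0); split=> [m|].
  by rewrite ltnNge => ->.
by rewrite -lincomb_widen// -seriesE HN.
Qed.

Lemma no_double_copy (W : normedModType R) (z : nat -> W) (x y : nat -> X) (D : R) :
  strongly_summing e -> 0 < D ->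
  (forall n a, `|lincomb n a z| <= D * `|lincomb n a e|) ->
  (forall n a, `|lincomb n a e| <= D * (`|lincomb n a z| + `|lincomb n a (differences e)|)) ->
  (forall al be n a, let m := Num.max `|al| `|be| in
    m * `|lincomb n a z| <= D * `|lincomb n a (fun i => al *: x i + be *: y i)| /\
    `|lincomb n a (fun i => al *: x i + be *: y i)| <= D * (m * `|lincomb n a z|)) ->
  False.
Proof.
move=> ess D0 ze ez xyz.
have approx i : exists lA : nat * (nat -> R) * (nat -> R),
    let: (l, A, A') := lA in [/\ forall m, (l <= m)%N -> A m = 0,
      forall m, (l <= m)%N -> A' m = 0, `|x i - lincomb l A e| <= 2^-1 ^+ i &
      `|y i - lincomb l A' e| <= 2^-1 ^+ i].
  have [N HN] := finite_approximation (x i) (half_exp_gt0 R i).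
  have [N' HN'] := finite_approximation (y i) (half_exp_gt0 R i).
  have [A [A0 HA]] := HN _ (leq_maxl N N').
  have [A' [A'0 HA']] := HN' _ (leq_maxr N N').
  by exists (maxn N N', A, A').
have {approx}[lA HlA] := choice approx.
pose l i := (lA i).1.1; pose Ax i := (lA i).1.2; pose Ay i := (lA i).2.
have Ax0 i m : (l i <= m)%N -> Ax i m = 0.
  by have := HlA i; rewrite /l /Ax; case: (lA i) => [[? ?] ?] [h _ _ _]; exact: h.
have Ay0 i m : (l i <= m)%N -> Ay i m = 0.
  by have := HlA i; rewrite /l /Ay; case: (lA i) => [[? ?] ?] [_ h _ _]; exact: h.
have xA i : `|x i - lincomb (l i) (Ax i) e| <= 2^-1 ^+ i.
  by have := HlA i; rewrite /l /Ax; case: (lA i) => [[? ?] ?] [].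
have yA i : `|y i - lincomb (l i) (Ay i) e| <= 2^-1 ^+ i.
  by have := HlA i; rewrite /l /Ay; case: (lA i) => [[? ?] ?] [].
pose V al be i m : R := al * Ax i m + be * Ay i m.
pose v al be i := lincomb (l i) (V al be i) e.
have vE al be i : v al be i = al *: lincomb (l i) (Ax i) e + be *: lincomb (l i) (Ay i) e.
  by rewrite /v /V lincombDl !lincombZl.
pose w al be i := al *: x i + be *: y i.
have wv al be i : `|w al be i - v al be i| <= (`|al| + `|be|) * 2^-1 ^+ i.
  rewrite vE /w opprD addrACA -!scalerBr mulrDl (le_trans (ler_normD _ _))//.
  by rewrite !normrZ lerD// ler_wpM2l.
have vD al be : exists2 D1 : R, 0 <= D1 &
    forall n c, `|lincomb n c (v al be)| <= D1 * `|lincomb n c e|.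
  have m0 : 0 <= Num.max `|al| `|be| by rewrite le_max normr_ge0.
  have k0 : 0 <= `|al| + `|be| by rewrite addr_ge0.
  exists (D * (Num.max `|al| `|be| * D) + 2 * (`|al| + `|be|) * C) => [|n c].
    by rewrite addr_ge0// !mulr_ge0 ?(ltW D0) ?(ltW C0).
  have -> : lincomb n c (v al be) =
      lincomb n c (w al be) - lincomb n c (fun i => w al be i - v al be i).
    by rewrite -lincombBr; apply: eq_lincomb => i _; rewrite subKr.
  rewrite (le_trans (ler_normB _ _))// mulrDl lerD//.
    by apply: le_trans (xyz al be n c).2 _; rewrite -!mulrA ler_pM2l// ler_wpM2l.
  rewrite -(mulrA (2 * _) C); apply: norm_lincomb_geometric_le => //.
  - by rewrite mulr_ge0 ?(ltW C0) ?normr_ge0.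
  - by move=> i; exact: coefC.
have V10 : V 1 0 = Ax by apply/funext => i; apply/funext => m; rewrite /V mul1r mul0r addr0.
have V01 : V 0 1 = Ay by apply/funext => i; apply/funext => m; rewrite /V mul1r mul0r add0r.
have lims (A : nat -> nat -> R) (Dl : R) : (forall i m, (l i <= m)%N -> A i m = 0) ->
    (forall n c, `|lincomb n c (fun i => lincomb (l i) (A i) e)| <= Dl * `|lincomb n c e|) ->
    exists a s s', [/\ forall m, ((fun i => A i m) : nat -> R^o) @ \oo --> (a m : R^o),
      ((fun i => \sum_(m < l i) A i m) : nat -> R^o) @ \oo --> (s : R^o) &
      (series a : nat -> R^o) @ \oo --> (s' : R^o)].
  move=> A0 AD.
  pose a m := lim (((fun i => A i m) : nat -> R^o) @ \oo).
  have Aa m : ((fun i => A i m) : nat -> R^o) @ \oo --> (a m : R^o).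
    exact: (@coordinate_cvg _ _ _ _ ecs eC l A Dl A0 AD m).
  exists a, (lim (((fun i => \sum_(m < l i) A i m) : nat -> R^o) @ \oo)).
  exists (lim ((series a : nat -> R^o) @ \oo)); split=> //.
    exact (sum_cvg ecs eC A0 AD).
  apply: ess; exists (C * (Dl * C)) => n; exact (limit_bounded eC A0 AD Aa n).
have [D1 _ vD1] := vD 1 0; have [D2 _ vD2] := vD 0 1.
rewrite /v V10 in vD1; rewrite /v V01 in vD2.
have [ax [sx [sx' [Hax Hsx Hsx']]]] := lims _ _ Ax0 vD1.
have [ay [sy [sy' [Hay Hsy Hsy']]]] := lims _ _ Ay0 vD2.
(* The mass lost at infinity by [x] is [sx - sx'], by [y] it is [sy - sy']. The pair [al], [be] is a
   nontrivial relation between these two scalars. *)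
have [al [be [mpos defect]]] : exists al be : R, 0 < Num.max `|al| `|be| /\
    al * (sx - sx') + be * (sy - sy') = 0.
  have [E|nE] := eqVneq (sx - sx') 0.
    by exists 1, 0; rewrite E mulr0 mul0r addr0 lt_max normr1 ltr01.
  exists (- (sy - sy')), (sx - sx'); split; last by ring.
  by rewrite lt_max [X in _ || X]normr_gt0 nE orbT.
set m := Num.max _ _ in mpos.
have [D3 D30 vD3] := vD al be.
pose s := al * sx + be * sy.
have sE : s = al * sx' + be * sy' by rewrite /s; lra.
pose a k := al * ax k + be * ay k.
have V0 i k : (l i <= k)%N -> V al be i k = 0.
  by move=> h; rewrite /V Ax0// Ay0// !mulr0 addr0.
have Va k : ((fun i => V al be i k) : nat -> R^o) @ \oo --> (a k : R^o).
  exact: cvg_comb.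
have k0 : 0 <= 2 * (`|al| + `|be|) by rewrite mulr_ge0// addr_ge0.
have Dm0 : 0 <= D / m by rewrite divr_ge0// ltW.
have D40 : 0 <= C * D * (D / m * (1 + 2 * (`|al| + `|be|)) + C).
  apply: mulr_ge0; first by apply: mulr_ge0; exact: ltW.
  by apply: addr_ge0; [apply: mulr_ge0 => //; exact: addr_ge0|exact: ltW].
(* The first [C] comes from passing to the subsequence [f], [D] from [ez], [D / m] from the lower
   estimate of the embedding, [2 * (|al| + |be|)] from replacing [w] by the finitely supported [v],
   and the last [C] from moving the differences. *)
set D4 := C * D * _ in D40.
apply: (@no_massless_copy _ _ _ _ ecs eC (V al be) l a s (D3 + D4) (C * (D3 * C))) => //.
- exact: addr_ge0.
- by move=> n c; rewrite (le_trans (vD3 n c))// ler_wpM2r// lerDl.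
- move=> f n c f_lt c1.
  rewrite -/(v al be) (le_trans (le_spread eK _ _ f_lt))//.
  have fN i : (i < n)%N -> (f i < f n)%N by exact: f_lt.
  have := ez (f n) (scatter f n c); rewrite !lincomb_scatter// => h1.
  have h2 : `|lincomb n c (differences e \o f)| <= C * `|lincomb n c (differences e)|.
    apply: (@differences_spread _ _ _ _ eK (double \o f) (fun i => (f i).*2.+1)) => i /=.
    by have := f_lt i i.+1 (ltnSn i); lia.
  have h3 : `|lincomb n c (z \o f)| <= D / m * `|lincomb n c (w al be \o f)|.
    have := (xyz al be (f n) (scatter f n c)).1; rewrite -/m -/(w al be) !lincomb_scatter//.
    by rewrite mulrAC ler_pdivlMr// mulrC.
  have h4 : `|lincomb n c (w al be \o f)| <=
      `|lincomb n c (v al be \o f)| + 2 * (`|al| + `|be|).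
    have -> : lincomb n c (w al be \o f) = lincomb n c (v al be \o f) +
        lincomb n c (fun i => w al be (f i) - v al be (f i)).
      by rewrite -lincombDr; apply: eq_lincomb => i _; rewrite addrC subrK.
    rewrite (le_trans (ler_normD _ _))// lerD2l -[leRHS]mulr1.
    apply: norm_lincomb_geometric_le => //.
    move=> i _; rewrite (le_trans (wv _ _ _))// ler_wpM2l ?addr_ge0// half_exp_le//.
    exact: homo_ltn_geq.
  set p := `|lincomb n c (v al be \o f)| in h4 *.
  set q := `|lincomb n c (differences e)| in h2 *.
  have p0 : 0 <= p by exact: normr_ge0.
  have q0 : 0 <= q by exact: normr_ge0.
  set k := 2 * _ in h4 k0 D4 D40 *.
  apply: (@le_trans _ _ (D4 * (p + q + 1))); last first.
    by rewrite ler_wpM2r ?lerDr// !addr_ge0.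
  set S := p + q + 1.
  have -> : D4 * S = C * (D * (D / m * ((1 + k) * S) + C * S)) by rewrite /D4; ring.
  rewrite ler_pM2l// (le_trans h1)// ler_pM2l// /S.
  rewrite lerD//; last first.
    by rewrite (le_trans h2)// ler_pM2l//; lra.
  apply: (le_trans h3); rewrite ler_wpM2l//.
  rewrite (le_trans h4)//.
  have := mulr_ge0 k0 p0; have := mulr_ge0 k0 q0; lra.
- have -> : (fun i => \sum_(k < l i) V al be i k) = (fun i =>
      al *: (\sum_(k < l i) Ax i k : R^o) + be *: (\sum_(k < l i) Ay i k : R^o)).
    by apply/funext => i; rewrite /V big_split /= -!mulr_sumr.
  exact: cvg_comb.
- have -> : (series a : nat -> R^o) = (fun i =>
      al *: (series ax i : R^o) + be *: (series ay i : R^o)).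
    by apply/funext => i; rewrite /series /= big_split /= -!mulr_sumr.
  by rewrite sE; exact: cvg_comb.
- by move=> n; exact (limit_bounded eC V0 vD3 Va n).
Qed.

End double_copy_embedding.

(** * Bases that are not strongly summing *)

(** A subsequence of averages is a combination of [e] at the positions [h (t / N) * N + t mod N],
    which increase with [t]. The constant does not grow with [N]. *)
Lemma block_average_uniformly_spreading (R : realType) (X : normedModType R)
    (e : nat -> X) (K : R) N : (0 < N)%N -> uniformly_spreading K e ->
  uniformly_spreading K (block_average e N).
Proof.
move=> N0 eK f g f_lt g_lt n a.
have E h : lincomb n a (block_average e N \o h) =
    lincomb (n * N) (fun t => a (t %/ N)%N / N%:R) (e \o (fun t => h (t %/ N) * N + t %% N)%N).
  rewrite /lincomb (big_ord_mul (fun t => (a (t %/ N)%N / N%:R) *: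
    (e \o (fun t => h (t %/ N) * N + t %% N)%N) t)).
  apply: eq_bigr => i _; rewrite /= block_averageE /average scalerA scaler_sumr.
  apply: eq_bigr => j _; rewrite divnMDl// modnMDl divn_small// addn0 modn_small//.
have h_lt h : {homo h : i j / (i < j)%N} ->
    {homo (fun t => h (t %/ N) * N + t %% N)%N : i j / (i < j)%N}.
  move=> h_lt; apply: homo_ltnS => t.
  have := divn_eq t N; have := ltn_pmod t N0.
  set q := (t %/ N)%N; set r := (t %% N)%N => rN tE.
  have [rS|rS] := ltnP r.+1 N.
    have -> : t.+1 = (q * N + r.+1)%N by rewrite addnS -tE.
    by rewrite divnMDl// modnMDl divn_small// addn0 modn_small// addnS.
  have -> : t.+1 = (q.+1 * N + 0)%N by rewrite mulSnr; lia.
  rewrite divnMDl// modnMDl div0n addn0 mod0n addn0.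
  have : ((h q).+1 * N <= h q.+1 * N)%N by rewrite leq_mul2r h_lt// orbT.
  by rewrite mulSnr; lia.
by rewrite !E; apply: eK; exact: h_lt.
Qed.

Lemma abel_sum (R : realType) (X : normedModType R) (c : nat -> R) (x : nat -> X) n :
  lincomb n c x = lincomb n (fun k => \sum_(i < k.+1) c i) (fun k => x k - x k.+1) +
    (\sum_(i < n) c i) *: x n.
Proof.
elim: n => [|n IH]; first by rewrite /lincomb !big_ord0 scale0r addr0.
rewrite /lincomb big_ord_recr [in RHS]big_ord_recr /= -!/(lincomb _ _ _) IH.
rewrite -!addrA; congr (_ + _).
by rewrite -scalerDr subrK -scalerDl big_ord_recr.
Qed.

Section not_strongly_summing.
Variables (R : realType) (X : completeNormedModType R) (e : nat -> X) (C : R).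
Hypothesis (eC : bounds e C).

Let C0 : 0 < C. Proof. by case: eC. Qed.
Let eK : uniformly_spreading C e. Proof. by case: eC. Qed.
Let eB i : `|e i| <= C. Proof. by case: eC. Qed.

(* Two placements of the same bounded series, averaged, differ only by the
   masses of its oscillations. *)
Lemma block_average_oscillation : ~ strongly_summing e ->
  exists2 D : R, 0 < D & forall n, exists c : R, forall N, (0 < N)%N ->
  forall (d : nat -> R) (s : R), 0 < s -> (forall k, (k < n)%N -> `|d k| <= s) ->
  `|lincomb n d (differences (block_average e N))| <= (D + c / N%:R) * s.
Proof.
move=> /existsNP[a /not_implyP[[B aB] na]].
have B0 : 0 <= B := le_trans (normr_ge0 _) (aB 0%N).
have [eps eps0 H] : exists2 eps : R, 0 < eps &
    forall N, exists pq, (N < pq.1 < pq.2)%N /\ eps < `|series a pq.1 - series a pq.2|.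
  have /existsNP[eps /not_implyP[eps0 h]] :
      ~ (forall eps : R, 0 < eps -> exists N, forall m n, (N <= m)%N -> (N <= n)%N ->
      `|(series a : nat -> R^o) m - (series a : nat -> R^o) n| <= eps).
    by move=> h; apply: na; exact/(cvg_nat_cauchyP (series a : nat -> R^o)).
  exists eps => // N; apply: contrapT => nN; apply: h; exists N.+1 => m n Nm Nn.
  rewrite leNgt; apply/negP => lt; apply: nN; case: (ltngtP m n) => mn.
  - by exists (m, n); rewrite /= Nm mn.
  - by exists (n, m); rewrite /= Nn mn distrC.
  by move: lt; rewrite mn subrr normr0 ltNge ltW.
have [st [st0 Hst]] := @dependent_choice_nat (nat * nat)
  (fun _ p p' => (p.2 < p'.1 < p'.2)%N /\ eps < `|series a p'.1 - series a p'.2|) (0, 0)%N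
  (fun _ p => H p.2).
(* The odd blocks are the oscillations of the partial sums, of mass [S k] beyond [eps]; the even
   blocks are the gaps between them. *)
pose M t := if odd t then (st t./2.+1).1 else (st t./2).2.
have M0 : M 0 = 0%N by rewrite /M /= st0.
have Mlt : {homo M : i j / (i < j)%N}.
  apply: homo_ltnS => i; rewrite /M /= uphalf_half; have [/andP[h1 h2] _] := Hst i./2.
  by case: (odd i) => /=; rewrite ?add1n ?add0n.
pose S k := \sum_(M k.*2.+1 <= t < M k.*2.+2) a t.
have Seps k : eps < `|S k|.
  have [/andP[_ h1] h2] := Hst k.
  rewrite /S /M /= odd_double /= ?uphalf_double ?doubleK; move: h2.
  by rewrite distrC sub_series_geq ?(ltnW h1).
pose D := 2 * (2 * C * B) / eps + 1.
exists (C * D) => [|n]; first by rewrite mulr_gt0// ltr_wpDl// divr_ge0 ?mulr_ge0// ltW.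
have [c Hc] := averaging C0 eK (M n.*2) a.
exists (C * (4 * c / eps)) => N N0 d s s0 ds.
pose A := block_average e N.
have AK : uniformly_spreading C A by exact: block_average_uniformly_spreading.
pose x k := S k *: (A (3 * k + 1)%N - A (3 * k + 2)%N).
have xP (P : pred nat) : `|\sum_(k < n | P k) x k| <= 2 * C * B + 2 * c / N%:R.
  (* Gaps are placed at [3 k] and oscillations at [3 k + 1], except that the second placement moves
     those in [P] to [3 k + 2]. Exactly the oscillations in [P] are averaged; all other terms agree
     and cancel. *)
  pose b1 k := (if odd k then 3 * k./2 + 1 else 3 * k./2)%N.
  pose b2 k := (if odd k then 3 * k./2 + (if P k./2 then 2 else 1) else 3 * k./2)%N.
  pose P1 j := (j %% 3 == 1)%N && P (j %/ 3)%N.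
  pose P2 j := (j %% 3 == 2)%N.
  have b1S k : (b1 k <= b1 k.+1)%N.
    by rewrite /b1 /= uphalf_half; case: (odd k) => /=; lia.
  have b2S k : (b2 k <= b2 k.+1)%N.
    rewrite /b2 /= uphalf_half; by case: (odd k) => /=; case: ifP => _; lia.
  have blk_homo b : (forall k, (b k <= b k.+1)%N) ->
      {homo b \o block_of M : i j / (i <= j)%N}.
    move=> bS i j ij; exact: (@homo_leq _ b leq leqnn leq_trans bS) (block_of_homo M0 Mlt ij).
  have h1 := Hc _ P1 (blk_homo _ b1S) N N0.
  have h2 := Hc _ P2 (blk_homo _ b2S) N N0.
  have E12 k : P1 (b1 k) = odd k && P k./2 /\ P2 (b2 k) = odd k && P k./2.
    rewrite /P1 /P2 /b1 /b2; case: (odd k) => /=; last first.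
      by rewrite mulnC modnMl.
    rewrite ![(3 * _)%N]mulnC modnMDl divnMDl// addn0; split=> //.
    by case: (P k./2); rewrite modnMDl.
  have -> : \sum_(k < n | P k) x k =
     lincomb (M n.*2) a (fun t => if P1 ((b1 \o block_of M) t) then A ((b1 \o block_of M) t)
           else e ((b1 \o block_of M) t * N + t)%N) -
     lincomb (M n.*2) a (fun t => if P2 ((b2 \o block_of M) t) then A ((b2 \o block_of M) t)
           else e ((b2 \o block_of M) t * N + t)%N).
    pose y k := if odd k && P k./2 then A (3 * k./2 + 1)%N - A (3 * k./2 + 2)%N else 0.
    rewrite -lincombBr (@eq_lincomb _ _ _ _ a _ (fun t => y (block_of M t))); last first.
      move=> t _ /=; move: (block_of M t) => k; rewrite (E12 k).1 (E12 k).2 /y /b1 /b2.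
      case: (odd k) => /=; last by rewrite subrr.
      by case: (P k./2); rewrite ?subrr.
    rewrite /lincomb (big_partition_nat M0 Mlt (fun t => a t *: y (block_of M t))).
    rewrite (big_ord_double (fun k => \sum_(M k <= t < M k.+1) a t *: y (block_of M t))).
    rewrite big_mkcond; apply: eq_bigr => i _ /=.
    rewrite [X in _ = X + _]big_nat_cond big1 ?add0r => [|t]; last first.
      rewrite andbT => Ht; rewrite (block_of_uniq M0 Mlt Ht) /y odd_double.
      by rewrite scaler0.
    rewrite (eq_big_nat _ _ (F2 := fun t => a t *: y i.*2.+1)) => [|t Ht]; last first.
      by rewrite (block_of_uniq M0 Mlt Ht).
    rewrite -scaler_suml -/(S i) /y /= odd_double /= uphalf_double.
    by case: (P i); rewrite ?scaler0.
  rewrite (le_trans (ler_normB _ _))//.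
  have h3 : C * `|lincomb (M n.*2) a e| <= C * B by rewrite ler_pM2l.
  have := lerD h1 h2; rewrite -/A; lra.
have e1 k : `|eps / S k| <= 1.
  rewrite normrM normfV ger0_norm ?(ltW eps0)// ler_pdivrMr ?mul1r ?(ltW (Seps k))//.
  exact: lt_trans (Seps k).
have S0 k : S k != 0 by rewrite -normr_gt0 (lt_trans eps0).
have main : `|lincomb n d (fun k => A (3 * k + 1)%N - A (3 * k + 2)%N)| <=
    s / eps * (2 * (2 * C * B + 2 * c / N%:R)).
  (* [d k] is [s / eps] times [t k * S k], where [t k] is at most 1 in absolute value because [d k]
     is bounded by [s] and [S k] exceeds [eps]. Beyond [n] there is no bound on [d], hence the value
     0. *)
  pose t k := if (k < n)%N then d k / s * (eps / S k) else 0.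
  have -> : lincomb n d (fun k => A (3 * k + 1)%N - A (3 * k + 2)%N) =
      (s / eps) *: \sum_(k < n) t k *: x k.
    rewrite /lincomb scaler_sumr; apply: eq_bigr => k _; rewrite /t ltn_ord /x !scalerA.
    by congr (_ *: _); field; rewrite S0 !gt_eqF.
  have se0 : 0 <= s / eps by apply: divr_ge0; exact: ltW.
  rewrite normrZ ger0_norm// ler_wpM2l//.
  apply: multiplier_le xP _ _ => k; rewrite /t; case: ifP => kn; last by rewrite normr0.
  rewrite normrM mulr_ile1// normrM normfV (ger0_norm (ltW s0)).
  by rewrite ler_pdivrMr// mul1r ds.
apply: le_trans (@le_differences_spread _ _ _ _ AK (fun k => 3 * k + 1)%N
  (fun k => 3 * k + 2)%N n d _) _.
  by move=> i; have := mulnS 3 i; lia.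
apply: le_trans (ler_wpM2l (ltW C0) main) _.
have Nn0 : N%:R != 0 :> R by rewrite pnatr_eq0 -lt0n.
have eps0' : eps != 0 by rewrite gt_eqF.
have -> : C * (s / eps * (2 * (2 * C * B + 2 * c / N%:R))) =
  (C * (2 * (2 * C * B) / eps) + C * (4 * c / eps) / N%:R) * s by field; rewrite ?Nn0 ?eps0'.
by rewrite ler_wpM2r ?(ltW s0)// lerD2r ler_wpM2l ?(ltW C0)// lerDl.
Qed.

(** It suffices to bound the averages, uniformly in their length. Summation by parts turns their
    combination into one of [A k - A k.+1] with the prefix sums as coefficients. Even and odd [k]
    taken separately give disjoint pairs, for which only the supremum of the coefficients counts. *)
Lemma le_summing : ~ strongly_summing e -> exists2 D : R, 0 < D &
  forall n (c : nat -> R) s, (forall k, (k <= n)%N -> `|\sum_(i < k) c i| <= s) ->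
  `|lincomb n c e| <= D * (s + `|lincomb n c (differences e)|).
Proof.
move=> /block_average_oscillation[D D0 HD].
exists (C * (D + C * D + C + C)) => [|n c s].
  by rewrite mulr_gt0// !addr_gt0// mulr_gt0.
(* The oscillation estimate divides by the bound on the coefficients, and [s] may be 0; hence
   [s + eps]. *)
move=> cs; apply: (@le_addM_gt0 _ _ _ (C * (D + C * D + C))) => eps eps0.
have s0 : 0 <= s by have := cs 0%N isT; rewrite big_ord0 normr0.
have {}cs k : (k <= n)%N -> `|\sum_(i < k) c i| <= s + eps.
  by move=> /cs/le_trans; apply; rewrite lerDl ltW.
rewrite (_ : _ + C * (D + C * D + C) * eps = C * ((D + C * D + C) * (s + eps) + C * s +
   (D + C * D + C + C) * `|lincomb n c (differences e)|)); last by ring.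
set u := `|lincomb n c (differences e)|.
have u0 : 0 <= u by exact: normr_ge0.
have [c1 Hc1] := HD n.
apply: (@le_add_divn _ _ _ (C * (c1 + C * c1) * (s + eps))) => N N0.
apply: le_trans (le_average_differences C0 eK n c N0) _.
pose A := block_average e N; rewrite -/A -/u.
have AK : uniformly_spreading C A by exact: block_average_uniformly_spreading.
have se0 : 0 < s + eps by rewrite ltr_wpDl.
pose d k := if (k < n)%N then \sum_(i < k.+1) c i else 0.
have ds k : `|d k| <= s + eps.
  by rewrite /d; case: ifP => [/cs//|_]; rewrite normr0 ltW.
have h1 : `|lincomb n (fun i => d i.*2) (differences A)| <= (D + c1 / N%:R) * (s + eps).
  by apply: Hc1.
have h2 : `|lincomb n (fun i => d i.*2.+1) (fun i => A i.*2.+1 - A i.*2.+2)| <=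
    C * ((D + c1 / N%:R) * (s + eps)).
  apply: le_trans (differences_spread AK _ _ _) _; first by move=> i; rewrite doubleS; lia.
  by rewrite ler_pM2l//; apply: Hc1.
have h3 : `|(\sum_(i < n) c i) *: A n| <= (s + eps) * C.
  by rewrite normrZ ler_pM ?cs// norm_block_average_le.
have : `|lincomb n c A| <= (D + c1 / N%:R) * (s + eps) + C * ((D + c1 / N%:R) * (s + eps)) +
    (s + eps) * C.
  rewrite abel_sum (le_trans (ler_normD _ _))// lerD//.
  have -> : lincomb n (fun k => \sum_(i < k.+1) c i) (fun k => A k - A k.+1) =
      lincomb n.*2 d (fun k => A k - A k.+1).
    rewrite (lincomb_widen _ _ (_ : (n <= n.*2)%N)) -?addnn ?leq_addr//.
  rewrite {1}/lincomb (big_ord_double (fun k => d k *: (A k - A k.+1))) big_split.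
  by rewrite (le_trans (ler_normD _ _))// lerD.
move=> h; have Cs : 0 <= C * s by rewrite mulr_ge0// ltW.
have Du : 0 <= (D + C * D + C) * u by rewrite mulr_ge0// !addr_ge0 ?mulr_ge0 ?(ltW D0) ?(ltW C0).
rewrite -[X in _ <= _ + X]mulrA -[X in _ <= _ + X]mulrA -mulrDr ler_pM2l//.
apply: le_trans (lerD h (lexx (C * u))) _.
have -> : (c1 + C * c1) * ((s + eps) / N%:R) =
   c1 / N%:R * (s + eps) + C * (c1 / N%:R * (s + eps)) by ring.
lra.
Qed.

End not_strongly_summing.

(** * Isomorphism induced by equivalent sequences *)

Section equivalent_bases.
Variables (R : realType) (X : completeNormedModType R) (Y : normedModType R).
Variables (e : nat -> X) (g : nat -> Y) (c D : R).
Hypothesis eS : schauder_basis e.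
Hypotheses (c0 : 0 < c) (D0 : 0 < D).
Hypothesis eg : forall n a, c * `|lincomb n a e| <= `|lincomb n a g| <= D * `|lincomb n a e|.
Hypothesis Ycauchy : forall u : nat -> Y,
  (forall eps : R, 0 < eps -> exists N, forall m n, (N <= m)%N -> (N <= n)%N ->
    `|u m - u n| <= eps) -> cvgn u.
Hypothesis gdense : forall (y : Y) (eps : R), 0 < eps ->
  exists n a, `|y - lincomb n a g| <= eps.

(** [T] keeps the coefficients and replaces [e] by [g]. Its range contains the span of [g], hence is
    dense, and it is closed because [T] is bounded below and [X] is complete. *)
Lemma equivalent_basis_isomorphic : isomorphic X Y.
Proof.
have ex_coef (x : X) : exists a : nat -> R, (fun n => lincomb n a e) @ \oo --> x /\
    forall a', (fun n => lincomb n a' e) @ \oo --> x -> a = a'.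
  have sE a : series (fun i => a i *: e i) = (fun n => lincomb n a e).
    by apply/funext => n; rewrite seriesE.
  have [a [ax a_uniq]] := eS x; exists a; split=> [|a' a'x].
    by rewrite -sE.
  by apply: a_uniq; rewrite sE.
have [coef Hcoef] := choice ex_coef.
have coef_cvg (x : X) := (Hcoef x).1; have coef_uniq (x : X) := (Hcoef x).2.
have ex_T (x : X) : exists y : Y, (fun n => lincomb n (coef x) g) @ \oo --> y.
  apply/cvg_ex; apply: Ycauchy => eps eps0.
  have : cvgn (fun n => lincomb n (coef x) e) by apply/cvg_ex; exists x.
  move/cvg_nat_cauchyP => /(_ (eps / D)) [|N HN]; first by rewrite divr_gt0.
  have main m n : (N <= m)%N -> (m <= n)%N ->
      `|lincomb n (coef x) g - lincomb m (coef x) g| <= eps.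
    move=> Nm mn; rewrite !(lincomb_widen _ _ mn) -lincombBl.
    have /andP[_ h] := eg n (fun i => coef x i - (if (i < m)%N then coef x i else 0)).
    apply: (le_trans h).
    rewrite lincombBl -lincomb_widen// -ler_pdivlMl// mulrC HN//.
    exact: leq_trans mn.
  by exists N => m n Nm Nn; have [mn|/ltnW nm] := leqP m n; [rewrite distrC|]; exact: main.
have [T HT] := choice ex_T.
have T_uniq (x : X) a : (fun n => lincomb n a e) @ \oo --> x ->
    forall y : Y, (fun n => lincomb n a g) @ \oo --> y -> T x = y.
  move=> ax y ay; rewrite -(coef_uniq _ _ ax) in ay.
  exact: (cvg_unique _ (HT x) ay).
have T_lin : linear T.
  move=> k x y.
  have lD (V : normedModType R) (v : nat -> V) :
      (fun n => lincomb n (fun i => k * coef x i + 1 * coef y i) v) =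
      (fun n => k *: lincomb n (coef x) v + 1 *: lincomb n (coef y) v).
    by apply/funext => n; rewrite lincombDl !lincombZl.
  apply: (T_uniq _ (fun i => k * coef x i + 1 * coef y i)).
    rewrite lD.
    by have := cvg_comb (al := k) (be := 1) (coef_cvg x) (coef_cvg y); rewrite scale1r.
  rewrite lD.
  by have := cvg_comb (al := k) (be := 1) (HT x) (HT y); rewrite scale1r.
pose TL : {linear X -> Y} := HB.pack_for {linear X -> Y} T
  (GRing.isLinear.Build _ _ _ _ T T_lin).
have TE n a : T (lincomb n a e) = lincomb n a g.
  apply: (T_uniq _ (fun i => if (i < n)%N then a i else 0)).
    apply/cvg_natP => eps eps0; exists n => m nm.
    by rewrite -lincomb_widen// subrr normr0 ltW.
  apply/cvg_natP => eps eps0; exists n => m nm.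
  by rewrite -lincomb_widen// subrr normr0 ltW.
have T_bounds x : c * `|x| <= `|T x| <= D * `|x|.
  apply/andP; split.
    apply: (@le_addM_gt0 _ _ _ (c + 1)) => eps eps0.
    have /cvg_natP/(_ _ eps0)[N1 HN1] := coef_cvg x.
    have /cvg_natP/(_ _ eps0)[N2 HN2] := HT x.
    have := HN1 _ (leq_maxl N1 N2); have := HN2 _ (leq_maxr N1 N2).
    set n := maxn _ _; set u := lincomb _ _ e; set v := lincomb _ _ g => hv hu.
    have /andP[h _] := eg n (coef x); rewrite -/u -/v in h.
    have h1 : `|x| <= `|u| + eps.
      by rewrite -(subrK u x) addrC (le_trans (ler_normD _ _))// lerD2l.
    have h2 : `|v| <= `|T x| + eps.
      by rewrite -(subrK (T x) v) addrC (le_trans (ler_normD _ _))// lerD2l distrC.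
    have := ler_wpM2l (ltW c0) h1; lra.
  apply: (@le_addM_gt0 _ _ _ (D + 1)) => eps eps0.
  have /cvg_natP/(_ _ eps0)[N1 HN1] := coef_cvg x.
  have /cvg_natP/(_ _ eps0)[N2 HN2] := HT x.
  have := HN1 _ (leq_maxl N1 N2); have := HN2 _ (leq_maxr N1 N2).
  set n := maxn _ _; set u := lincomb _ _ e; set v := lincomb _ _ g => hv hu.
  have /andP[_ h] := eg n (coef x); rewrite -/u -/v in h.
  have h1 : `|u| <= `|x| + eps.
    by rewrite -(subrK x u) addrC (le_trans (ler_normD _ _))// lerD2l distrC.
  have h2 : `|T x| <= `|v| + eps.
    by rewrite -(subrK v (T x)) addrC (le_trans (ler_normD _ _))// lerD2l.
  have := ler_wpM2l (ltW D0) h1; lra.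
have TB x y : T (x - y) = T x - T y by exact: (raddfB TL).
have T_inj : injective T.
  move=> x y Txy; apply/eqP; rewrite -subr_eq0 -normr_eq0 eq_le normr_ge0 andbT.
  have /andP[h _] := T_bounds (x - y); rewrite TB Txy subrr normr0 in h.
  by rewrite -(pmulr_rle0 _ c0).
have T_surj y : exists x, T x = y.
  have /choice[na Hna] : forall k : nat, exists na : nat * (nat -> R),
      `|y - lincomb na.1 na.2 g| <= 2^-1 ^+ k.
    by move=> k; have [n [a Ha]] := gdense y (half_exp_gt0 R k); exists (n, a).
  pose x k := lincomb (na k).1 (na k).2 e.
  have small (eps : R) : 0 < eps -> exists k, forall l, (k <= l)%N -> 2^-1 ^+ l <= eps.
    move=> eps0.
    have /cvg_natP/(_ _ eps0)[k Hk] : (fun l => (2^-1 : R) ^+ l : R^o) @ \oo --> (0 : R^o).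
      by apply: cvg_expr; rewrite ger0_norm ?invr_ge0// invf_lt1 ?ltr1n.
    exists k => l /Hk; rewrite sub0r normrN; exact: le_trans (ler_norm _).
  have Tx k : `|y - T (x k)| <= 2^-1 ^+ k by rewrite TE.
  have /cvg_ex[l xl] : cvgn x.
    apply/cvg_nat_cauchyP => eps eps0.
    have [|k Hk] := small (c * eps / 2); first by rewrite divr_gt0// mulr_gt0.
    exists k => m n km kn; rewrite -(ler_pM2l c0).
    have /andP[h _] := T_bounds (x m - x n); apply: (le_trans h); rewrite TB.
    rewrite -(subrKA y) (le_trans (ler_normD _ _))// (splitr (c * eps)) lerD//.
      by rewrite distrC (le_trans (Tx _)) ?Hk.
    by rewrite (le_trans (Tx _)) ?Hk.
  exists l; apply/eqP; rewrite -subr_eq0 -normr_eq0 eq_le normr_ge0 andbT.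
  apply: (@le_addM_gt0 _ _ _ (D + 1)) => eps eps0; rewrite add0r.
  have [k1 Hk1] := small _ eps0; have /cvg_natP/(_ _ eps0)[k2 Hk2] := xl.
  pose k := maxn k1 k2.
  rewrite -(subrKA (T (x k))) (le_trans (ler_normD _ _))// mulrDl mul1r lerD//.
    rewrite -TB; have /andP[_ h] := T_bounds (l - x k); apply: (le_trans h).
    by rewrite ler_pM2l// Hk2// leq_maxr.
  by rewrite distrC (le_trans (Tx _))// Hk1// leq_maxl.
exists TL; split; first by exists c, D.
have [S HS] := choice T_surj.
by exists S => // x; apply: T_inj; rewrite HS.
Qed.

End equivalent_bases.

(** * Interleaving two copies of the natural numbers by blocks *)

Section interleaved_positions.
Variable M : nat -> nat.
Hypotheses (M0 : M 0 = 0%N) (Mlt : {homo M : i j / (i < j)%N}).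

Let blk := block_of M.
Let M2 i := (M i).*2.
Let M20 : M2 0 = 0%N. Proof. by rewrite /M2 M0. Qed.
Let M2lt : {homo M2 : i j / (i < j)%N}.
Proof. by move=> i j /Mlt; rewrite /M2 ltn_double. Qed.
Let M_le i : (M i <= M i.+1)%N. Proof. exact/ltnW/Mlt. Qed.

(* The positions [2 M i, 2 M (i + 1)) hold a first and a second copy of the
   block [M i, M (i + 1)). *)
Definition first_copy m := (m + M (block_of M m))%N.
Definition second_copy m := (m + M (block_of M m).+1)%N.

Let blkP m : (M (blk m) <= m < M (blk m).+1)%N. Proof. exact: block_ofP. Qed.
Let blkE m i : (M i <= m < M i.+1)%N -> blk m = i. Proof. exact: block_of_uniq. Qed.
Let blkM i : blk (M i) = i. Proof. by apply: blkE; rewrite leqnn Mlt. Qed.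

Let blkS m : blk m.+1 = blk m \/ (blk m.+1 = (blk m).+1 /\ m.+1 = M (blk m).+1).
Proof.
have /andP[h1 h2] := blkP m.
have [h|h] := ltnP m.+1 (M (blk m).+1); first by left; apply: blkE; lia.
have E : m.+1 = M (blk m).+1 by lia.
by right; split=> //; rewrite {1}E blkM.
Qed.

Lemma first_copy_lt : {homo first_copy : i j / (i < j)%N}.
Proof.
apply: homo_ltnS => m; rewrite /first_copy -/blk; have := M_le (blk m).
by case: (blkS m) => [->|[-> _]]; lia.
Qed.

Lemma second_copy_lt : {homo second_copy : i j / (i < j)%N}.
Proof.
apply: homo_ltnS => m; rewrite /second_copy -/blk; have := M_le (blk m).+1.
by case: (blkS m) => [->|[-> _]]; lia.
Qed.

Lemma copyP t : (exists m, t = first_copy m) \/ (exists m, t = second_copy m).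
Proof.
have := block_ofP M20 M2lt t; set i := block_of M2 t; rewrite /M2 => Ht.
have Mi := M_le i.
have [h|h] := ltnP t (M i + M i.+1).
  left; exists (t - M i)%N; rewrite /first_copy -/blk (@blkE _ i); lia.
right; exists (t - M i.+1)%N; rewrite /second_copy -/blk (@blkE _ i); lia.
Qed.

Lemma big_copies (V : nmodType) (F : nat -> V) I :
  \sum_(t < (M I).*2) F t =
  \sum_(m < M I) F (first_copy m) + \sum_(m < M I) F (second_copy m).
Proof.
rewrite (big_partition_nat M20 M2lt F I).
rewrite (big_partition_nat M0 Mlt (F \o first_copy)).
rewrite (big_partition_nat M0 Mlt (F \o second_copy)).
rewrite -big_split; apply: eq_bigr => i _ /=; have Mi := M_le i.
rewrite /M2 (@big_cat_nat _ _ _ (M i + M i.+1)) /=; [|lia|lia].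
congr (_ + _).
  rewrite -addnn big_addn (_ : M i + M i.+1 - M i = M i.+1)%N; last lia.
  by apply: eq_big_nat => m Hm; rewrite /= /first_copy -/blk (blkE Hm).
rewrite big_addn (_ : (M i.+1).*2 - M i.+1 = M i.+1)%N; last lia.
by apply: eq_big_nat => m Hm; rewrite /= /second_copy -/blk (blkE Hm).
Qed.

End interleaved_positions.

(** * Partial sums and differences under interleaving *)

Section interleaving.
Variables (R : realType) (X : completeNormedModType R) (e : nat -> X) (C D : R).
Hypotheses (eC : bounds e C).
Hypothesis (D0 : 0 < D).
Hypothesis eD : forall n (c : nat -> R) s,
  (forall k, (k <= n)%N -> `|\sum_(i < k) c i| <= s) ->
  `|lincomb n c e| <= D * (s + `|lincomb n c (differences e)|).
Variables (M : nat -> nat) (lam : nat -> R).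
Hypotheses (M0 : M 0 = 0%N) (Mlt : {homo M : i j / (i < j)%N}).
Hypothesis lam0 : forall t, 0 <= lam t.
Hypothesis lam1 : forall i, \sum_(M i <= t < M i.+1) lam t = 1.
Hypothesis lamu : forall i,
  `|\sum_(M i <= t < M i.+1) lam t *: differences e t| <= 2^-1 ^+ i.

Let C0 : 0 < C. Proof. by case: eC. Qed.
Let eK : uniformly_spreading C e. Proof. by case: eC. Qed.
Let prefixC m n (a : nat -> R) : (m <= n)%N -> `|\sum_(i < m) a i| <= C * `|lincomb n a e|.
Proof. by case: eC => _ _ _ _ [+ _]; exact. Qed.

Let blk := block_of M.
Let blkP m : (M (blk m) <= m < M (blk m).+1)%N. Proof. exact: block_ofP. Qed.
Let blkE m i : (M i <= m < M i.+1)%N -> blk m = i. Proof. exact: block_of_uniq. Qed.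
Let blkM i : blk (M i) = i. Proof. by apply: blkE; rewrite leqnn Mlt. Qed.
Let M_le i : (M i <= M i.+1)%N. Proof. exact/ltnW/Mlt. Qed.
Let first_lt := first_copy_lt M0 Mlt.
Let second_lt := second_copy_lt M0 Mlt.

Section coefficients.
Variables (I : nat) (a : nat -> R).
Hypothesis supp : forall t, ((M I).*2 <= t)%N -> a t = 0.

Let s k := \sum_(t < k) a t.
Definition first_mass i := \sum_(M i <= m < M i.+1) a (first_copy M m).
Definition second_mass i := \sum_(M i <= m < M i.+1) a (second_copy M m).
(** A block carried by the other component is replaced by its mass, spread out along [lam], so that
    the prefix sums keep up with those of [a]. The second copy of a block is followed by the first
    copy of the next one, hence the [.+1] in [second_coef]. The mass [s (M 1)] of the very first
    block never enters there. *)
Definition first_coef m := a (first_copy M m) + second_mass (block_of M m) * lam m.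
Definition second_coef m := a (second_copy M m) + first_mass (block_of M m).+1 * lam m.

Let sum_shift p q r : (p <= q)%N -> \sum_(p <= m < q) a (m + r)%N = s (q + r)%N - s (p + r)%N.
Proof.
move=> pq; rewrite /s -!(big_mkord xpredT a).
rewrite [in RHS](@big_cat_nat _ _ _ (p + r) 0 (q + r))//= ?leq_add2r//.
by rewrite [RHS]addrC addKr big_addn addnK.
Qed.

Lemma first_massE i : first_mass i = s (M i.+1 + M i)%N - s (M i + M i)%N.
Proof.
rewrite -sum_shift// /first_mass; apply: eq_big_nat => m Hm.
by rewrite /first_copy -/blk (blkE Hm).
Qed.

Lemma second_massE i : second_mass i = s (M i.+1 + M i.+1)%N - s (M i + M i.+1)%N.
Proof.
rewrite -sum_shift// /second_mass; apply: eq_big_nat => m Hm.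
by rewrite /second_copy -/blk (blkE Hm).
Qed.

Let weight m := \sum_(M (blk m) <= t < m) lam t.

Let weight01 m : 0 <= weight m <= 1.
Proof.
have /andP[h1 /ltnW h2] := blkP m; rewrite sumr_ge0//= -(lam1 (blk m)).
by rewrite [leRHS](@big_cat_nat _ _ _ m)//= lerDl sumr_ge0.
Qed.

Lemma sum_weighted_blocks (F : nat -> R) i :
  \sum_(t < M i) F (blk t) * lam t = \sum_(j < i) F j.
Proof.
rewrite (big_partition_nat M0 Mlt (fun t => F (blk t) * lam t)).
apply: eq_bigr => j _; rewrite -[RHS]mulr1 -(lam1 j) mulr_sumr.
by apply: eq_big_nat => t Ht; rewrite (blkE Ht).
Qed.

Let sum_split (F : nat -> R) m :
  \sum_(t < m) F t = \sum_(t < M (blk m)) F t + \sum_(M (blk m) <= t < m) F t.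
Proof.
have /andP[h1 h2] := blkP m.
by rewrite -!(big_mkord xpredT F) (@big_cat_nat _ _ _ (M (blk m))).
Qed.

Let sum_weight (F : nat -> R) m :
  \sum_(M (blk m) <= t < m) F (blk t) * lam t = F (blk m) * weight m.
Proof.
rewrite mulr_sumr; apply: eq_big_nat => t Ht; rewrite (@blkE _ (blk m))//.
have := blkP m; lia.
Qed.

Lemma first_prefix m :
  \sum_(t < m) first_coef t = s (m + M (blk m))%N + second_mass (blk m) * weight m.
Proof.
rewrite sum_split !big_split /= sum_weight.
rewrite (sum_weighted_blocks second_mass).
have -> : \sum_(j < blk m) second_mass j = \sum_(t < M (blk m)) a (second_copy M t).
  by rewrite (big_partition_nat M0 Mlt (a \o second_copy M)).
rewrite -(big_copies M0 Mlt) -/(s _) addrA; congr (_ + _).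
rewrite (eq_big_nat _ _ (F2 := fun t => a (t + M (blk m))%N)) => [|t Ht]; last first.
  by rewrite /first_copy -/blk (@blkE _ (blk m))//; have := blkP m; lia.
rewrite sum_shift; last by have /andP[] := blkP m.
by rewrite -addnn addrC subrK.
Qed.

Lemma second_prefix m :
  \sum_(t < m) second_coef t =
  s (m + M (blk m).+1)%N - s (M 1) + first_mass (blk m).+1 * weight m.
Proof.
rewrite sum_split !big_split /= (sum_weight (fun i => first_mass i.+1)).
rewrite (sum_weighted_blocks (fun i => first_mass i.+1)).
have -> : \sum_(j < blk m) first_mass j.+1 =
    \sum_(t < M (blk m)) a (first_copy M t) + first_mass (blk m) - s (M 1).
  rewrite (big_partition_nat M0 Mlt (a \o first_copy M)).
  rewrite -(big_ord_recr (blk m) first_mass) big_ord_recl /= addrAC.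
  by rewrite [first_mass 0]first_massE M0 !addn0 /s big_ord0 subr0 subrr add0r.
rewrite addrA; congr (_ + _).
have := big_copies M0 Mlt a (blk m); rewrite -/(s _) first_massE -addnn => h.
rewrite (eq_big_nat _ _ (F2 := fun t => a (t + M (blk m).+1)%N)) => [|t Ht]; last first.
  by rewrite /second_copy -/blk (@blkE _ (blk m))//; have := blkP m; lia.
rewrite sum_shift; last by have /andP[] := blkP m.
rewrite [(M (blk m) + M (blk m).+1)%N]addnC; move: h; lra.
Qed.

Lemma lincomb_first_coef (V : normedModType R) (v : nat -> V) :
  lincomb (M I) first_coef v = lincomb (M I) (a \o first_copy M) v +
  lincomb I second_mass (fun i => \sum_(M i <= t < M i.+1) lam t *: v t).
Proof.
rewrite /first_coef lincombDl; congr (_ + _).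
rewrite /lincomb (big_partition_nat M0 Mlt (fun t => (second_mass (block_of M t) * lam t) *: v t)).
apply: eq_bigr => i _; rewrite scaler_sumr; apply: eq_big_nat => t Ht.
by rewrite -/blk (blkE Ht) scalerA.
Qed.

Lemma lincomb_second_coef (V : normedModType R) (v : nat -> V) :
  lincomb (M I) second_coef v = lincomb (M I) (a \o second_copy M) v +
  lincomb I (fun i => first_mass i.+1) (fun i => \sum_(M i <= t < M i.+1) lam t *: v t).
Proof.
rewrite /second_coef lincombDl; congr (_ + _).
rewrite /lincomb (big_partition_nat M0 Mlt (fun t => (first_mass (block_of M t).+1 * lam t) *: v t)).
apply: eq_bigr => i _; rewrite scaler_sumr; apply: eq_big_nat => t Ht.
by rewrite -/blk (blkE Ht) scalerA.
Qed.

Let supp_sum k : ((M I).*2 <= k)%N -> s k = s (M I).*2.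
Proof.
move=> h; rewrite /s -!(big_mkord xpredT a) (@big_cat_nat _ _ _ (M I).*2)//=.
rewrite [X in _ + X]big1_seq ?addr0// => t; rewrite mem_index_iota => /andP[_ /andP[ht _]].
exact: supp.
Qed.

Let sL k : `|s k| <= C * `|lincomb (M I).*2 a e|.
Proof.
have [/supp_sum ->|/ltnW h] := leqP (M I).*2 k; exact: prefixC.
Qed.

Let differences_copy f m : {homo f : i j / (i < j)%N} ->
  `|lincomb m (a \o f) (differences e)| <= C * `|lincomb m (a \o f) (differences e \o f)|.
Proof.
move=> f_lt; apply: (@le_differences_spread _ _ _ _ eK (double \o f) (fun i => (f i).*2.+1)).
by move=> i /=; have := f_lt i i.+1 (ltnSn i); lia.
Qed.

Let copy_differences f m : {homo f : i j / (i < j)%N} ->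
  `|lincomb m (a \o f) (differences e \o f)| <= C * `|lincomb m (a \o f) (differences e)|.
Proof.
move=> f_lt; apply: (@differences_spread _ _ _ _ eK (double \o f) (fun i => (f i).*2.+1)).
by move=> i /=; have := f_lt i i.+1 (ltnSn i); lia.
Qed.

Let copy_le f : {homo f : i j / (i < j)%N} -> (forall m, (m < M I)%N -> (f m < (M I).*2)%N) ->
  `|lincomb (M I) (a \o f) (differences e \o f)| <= 2 * C * `|lincomb (M I).*2 a e|.
Proof.
move=> f_lt fN; pose P t := `[< exists m, (m < M I)%N /\ f m = t >].
rewrite (_ : lincomb (M I) (a \o f) _ =
    lincomb (M I).*2 (fun t => if P t then a t else 0) (differences e)).
  exact: differences_mask.
rewrite -(lincomb_scatter _ _ fN); apply: eq_lincomb => t _; congr (_ *: _).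
rewrite /scatter /P; case: asboolP => [[m [mI <-]]|nP].
  rewrite (big_pred1 (Ordinal mI))//= => i.
  by rewrite (inj_eq (homo_ltn_inj f_lt)).
rewrite big_pred0// => i; apply/negbTE/eqP => fi; apply: nP.
by exists i.
Qed.

Let first_bound m : (m < M I)%N -> (first_copy M m < (M I).*2)%N.
Proof.
rewrite /first_copy -/blk => h; have : (M (blk m) <= M I)%N; last lia.
by apply: (homo_leq_ltn Mlt); apply: ltnW; rewrite block_of_lt.
Qed.

Let second_bound m : (m < M I)%N -> (second_copy M m < (M I).*2)%N.
Proof.
rewrite /second_copy -/blk => h; have : (M (blk m).+1 <= M I)%N; last lia.
by apply: (homo_leq_ltn Mlt); rewrite block_of_lt.
Qed.

Let L := `|lincomb (M I).*2 a e|.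
Let L0 : 0 <= L. Proof. exact: normr_ge0. Qed.

Let mass_le i : `|first_mass i| <= 2 * C * L /\ `|second_mass i| <= 2 * C * L.
Proof.
have h k l : `|s k - s l| <= 2 * C * L.
  have := sL k; have := sL l; rewrite -/L.
  by have := ler_normB (s k) (s l); lra.
by rewrite first_massE second_massE; split.
Qed.

Let lamu_le (c : nat -> R) (B : R) : 0 <= B -> (forall i, `|c i| <= B) ->
  `|lincomb I c (fun i => \sum_(M i <= t < M i.+1) lam t *: differences e t)| <= 2 * 1 * B.
Proof.
move=> B0 cB; apply: norm_lincomb_geometric_le => // i _; by rewrite mul1r.
Qed.

Let weighted_le (x B : R) m : `|x| <= B -> `|x * weight m| <= B.
Proof.
move=> xB; have /andP[w0 w1] := weight01 m.
by rewrite normrM (ger0_norm w0) (le_trans _ xB)// ler_piMr.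
Qed.

(** Prefix sums are at most [3 * C * L]: [C * L] for a partial sum of [a], and [2 * C * L] for a
    fraction of a mass. The differences contribute [2 * C * C * L] for the copied coefficients and
    [4 * C * L] for the masses, whose convex blocks have summable differences. In the second
    component [s (M 1)] adds one more [C * L]. *)
Lemma first_coef_le : `|lincomb (M I) first_coef e| <= D * (7 * C + 2 * C * C) * L.
Proof.
have CL : 0 <= C * L by rewrite mulr_ge0// ltW.
have h1 k : `|\sum_(t < k) first_coef t| <= 3 * C * L.
  rewrite first_prefix (le_trans (ler_normD _ _))//.
  have := weighted_le k (mass_le (blk k)).2; have := sL (k + M (blk k))%N; rewrite -/L; lra.
apply: le_trans (eD (fun k _ => h1 k)) _; rewrite -!mulrA ler_pM2l//.
have h2 : `|lincomb (M I) first_coef (differences e)| <= C * (2 * C * L) + 2 * 1 * (2 * C * L).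
  rewrite lincomb_first_coef (le_trans (ler_normD _ _))// lerD//.
    apply: le_trans (differences_copy _ first_lt) _; rewrite ler_pM2l//.
    exact: copy_le first_lt first_bound.
  by apply: lamu_le => [|i]; [rewrite -mulrA mulr_ge0|exact: (mass_le i).2].
have : 0 <= C * (C * L) by rewrite mulr_ge0// ltW.
lra.
Qed.

Lemma second_coef_le : `|lincomb (M I) second_coef e| <= D * (8 * C + 2 * C * C) * L.
Proof.
have CL : 0 <= C * L by rewrite mulr_ge0// ltW.
have h1 k : `|\sum_(t < k) second_coef t| <= 4 * C * L.
  rewrite second_prefix (le_trans (ler_normD _ _))//.
  have := ler_normB (s (k + M (blk k).+1)%N) (s (M 1)).
  have := weighted_le k (mass_le (blk k).+1).1; have := sL (k + M (blk k).+1)%N.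
  have := sL (M 1); rewrite -/L; lra.
apply: le_trans (eD (fun k _ => h1 k)) _; rewrite -!mulrA ler_pM2l//.
have h2 : `|lincomb (M I) second_coef (differences e)| <= C * (2 * C * L) + 2 * 1 * (2 * C * L).
  rewrite lincomb_second_coef (le_trans (ler_normD _ _))// lerD//.
    apply: le_trans (differences_copy _ second_lt) _; rewrite ler_pM2l//.
    exact: copy_le second_lt second_bound.
  by apply: lamu_le => [|i]; [rewrite -mulrA mulr_ge0|exact: (mass_le i.+1).1].
have : 0 <= C * (C * L) by rewrite mulr_ge0// ltW.
lra.
Qed.

Let H := Num.max `|lincomb (M I) first_coef e| `|lincomb (M I) second_coef e|.
Let H0 : 0 <= H. Proof. by rewrite le_max normr_ge0. Qed.

Let first_supp m : (M I <= m)%N -> a (first_copy M m) = 0.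
Proof.
move=> h; apply: supp; rewrite /first_copy -/blk.
suff : (M I <= M (blk m))%N by lia.
by apply: (homo_leq_ltn Mlt); rewrite leqNgt block_of_lt// -leqNgt.
Qed.

Let second_supp m : (M I <= m)%N -> a (second_copy M m) = 0.
Proof.
move=> h; apply: supp; rewrite /second_copy -/blk.
suff : (M I <= M (blk m).+1)%N by lia.
by apply: (homo_leq_ltn Mlt); apply: leqW; rewrite leqNgt block_of_lt// -leqNgt.
Qed.

Let first_coef_supp m : (M I <= m)%N -> first_coef m = 0.
Proof.
move=> h; rewrite /first_coef first_supp// add0r /second_mass big1_seq ?mul0r// => t.
rewrite mem_index_iota => /andP[_ /andP[ht _]]; apply: second_supp; apply: leq_trans ht.
by apply: (homo_leq_ltn Mlt); rewrite leqNgt block_of_lt// -leqNgt.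
Qed.

Let second_coef_supp m : (M I <= m)%N -> second_coef m = 0.
Proof.
move=> h; rewrite /second_coef second_supp// add0r /first_mass big1_seq ?mul0r// => t.
rewrite mem_index_iota => /andP[_ /andP[ht _]]; apply: first_supp; apply: leq_trans ht.
by apply: (homo_leq_ltn Mlt); apply: leqW; rewrite leqNgt block_of_lt// -leqNgt.
Qed.

Let prefixH (c : nat -> R) : (forall m, (M I <= m)%N -> c m = 0) ->
  `|lincomb (M I) c e| <= H -> forall k, `|\sum_(t < k) c t| <= C * H.
Proof.
move=> c0 cH k; have [h|/ltnW h] := leqP k (M I).
  by rewrite (le_trans (prefixC _ h))// ler_pM2l.
rewrite -(big_mkord xpredT c) (@big_cat_nat _ _ _ (M I))//= [X in _ + X]big1_seq ?addr0; last first.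
  by move=> t; rewrite mem_index_iota => /andP[_ /andP[ht _]]; exact: c0.
by rewrite (big_mkord xpredT c) (le_trans (prefixC _ (leqnn _)))// ler_pM2l.
Qed.

(** At the ends of the blocks the weights vanish, and prefix sums of the two components are partial
    sums of [a], up to [s (M 1)]. This bounds the masses, and then all the partial sums of [a]. The
    differences of [a] are recovered by subtracting the small convex blocks. *)
Lemma le_first_second_coef : L <= D * (7 * C + 24 * C * C) * H.
Proof.
have CH : 0 <= C * H by rewrite mulr_ge0// ltW.
have pa k : `|\sum_(t < k) first_coef t| <= C * H.
  by apply: prefixH first_coef_supp _ _; rewrite le_max lexx.
have pb k : `|\sum_(t < k) second_coef t| <= C * H.
  by apply: prefixH second_coef_supp _ _; rewrite le_max lexx orbT.
have weightM i : weight (M i) = 0 by rewrite /weight blkM big_geq.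
have s2M i : s (M i + M i)%N = \sum_(t < M i) first_coef t.
  by rewrite first_prefix blkM weightM mulr0 addr0.
have sMM i : s (M i + M i.+1)%N - s (M 1) = \sum_(t < M i) second_coef t.
  by rewrite second_prefix blkM weightM mulr0 addr0.
have s1 : `|s (M 1)| <= 2 * (C * H).
  (* Past the support both components have received the total sum of [a], except for the mass
     missing in the second. *)
  have -> : s (M 1) = \sum_(t < M I) first_coef t - \sum_(t < M I) second_coef t.
    rewrite -s2M -sMM (@supp_sum (M I + M I.+1)%N) -?addnn ?leq_add2l//; lra.
  by have := ler_normB (\sum_(t < M I) first_coef t) (\sum_(t < M I) second_coef t);
    have := pa (M I); have := pb (M I); lra.
have sMM_le i : `|s (M i + M i.+1)%N| <= 3 * (C * H).
  rewrite -(subrK (s (M 1)) (s _)) sMM (le_trans (ler_normD _ _))//.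
  by have := pb (M i); lra.
have s2M_le i : `|s (M i + M i)%N| <= C * H by rewrite s2M.
have m1 i : `|first_mass i| <= 4 * (C * H).
  rewrite first_massE addnC (le_trans (ler_normB _ _))//.
  by have := sMM_le i; have := s2M_le i; lra.
have m2 i : `|second_mass i| <= 4 * (C * H).
  rewrite second_massE (le_trans (ler_normB _ _))//.
  by have := sMM_le i; have := s2M_le i.+1; lra.
have sH k : `|s k| <= 7 * (C * H).
  case: (copyP M0 Mlt k) => -[m ->]; rewrite ?/first_copy ?/second_copy -/blk.
    have /eqP := first_prefix m; rewrite -subr_eq => /eqP <-.
    rewrite (le_trans (ler_normB _ _))//.
    by have := pa m; have := weighted_le m (m2 (blk m)); lra.
  have /eqP := second_prefix m; rewrite -subr_eq eq_sym subr_eq => /eqP ->.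
  rewrite (le_trans (ler_normD _ _))//.
  have := ler_normB (\sum_(t < m) second_coef t) (first_mass (blk m).+1 * weight m).
  by have := pb m; have := weighted_le m (m1 (blk m).+1); lra.
apply: le_trans (eD (fun k _ => sH k)) _; rewrite -!mulrA ler_pM2l//.
have uH c : `|lincomb (M I) c e| <= H -> `|lincomb (M I) c (differences e)| <= 2 * C * H.
  move=> h; have := differences_mask C0 eK xpredT (M I) c.
  by move=> /le_trans; apply; rewrite ler_pM2l// mulr_gt0.
have u1 : `|lincomb (M I) (a \o first_copy M) (differences e)|
    <= 2 * C * H + 2 * 1 * (4 * (C * H)).
  have -> : lincomb (M I) (a \o first_copy M) (differences e) =
      lincomb (M I) first_coef (differences e) -
      lincomb I second_mass (fun i => \sum_(M i <= t < M i.+1) lam t *: differences e t).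
    by rewrite lincomb_first_coef addrK.
  rewrite (le_trans (ler_normB _ _))// lerD//; first by apply: uH; rewrite le_max lexx.
  by apply: lamu_le => //; rewrite mulr_ge0.
have u2 : `|lincomb (M I) (a \o second_copy M) (differences e)|
    <= 2 * C * H + 2 * 1 * (4 * (C * H)).
  have -> : lincomb (M I) (a \o second_copy M) (differences e) =
      lincomb (M I) second_coef (differences e) -
      lincomb I (fun i => first_mass i.+1)
        (fun i => \sum_(M i <= t < M i.+1) lam t *: differences e t).
    by rewrite lincomb_second_coef addrK.
  rewrite (le_trans (ler_normB _ _))// lerD//; first by apply: uH; rewrite le_max lexx orbT.
  by apply: lamu_le => //; rewrite mulr_ge0.
have : `|lincomb (M I).*2 a (differences e)| <=
    C * (2 * C * H + 2 * 1 * (4 * (C * H))) + C * (2 * C * H + 2 * 1 * (4 * (C * H))).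
  rewrite {1}/lincomb (big_copies M0 Mlt (fun t => a t *: differences e t)).
  rewrite (le_trans (ler_normD _ _))// lerD//.
    by rewrite (le_trans (copy_differences _ first_lt))// ler_pM2l.
  by rewrite (le_trans (copy_differences _ second_lt))// ler_pM2l.
have : 0 <= C * (C * H) by rewrite mulr_ge0// ltW.
lra.
Qed.

End coefficients.
End interleaving.

Lemma prod_cauchy_cvg (R : realType) (X : completeNormedModType R) (u : nat -> direct_sum X X) :
  (forall eps : R, 0 < eps -> exists N, forall m n, (N <= m)%N -> (N <= n)%N ->
    `|u m - u n| <= eps) -> cvgn u.
Proof.
move=> H.
have H1 : cvgn (fun n => (u n : X * X).1).
  apply/cvg_nat_cauchyP => eps /H[N HN]; exists N => m n Nm Nn.
  by apply: le_trans (HN _ _ Nm Nn); rewrite [leRHS]prod_normE le_max lexx.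
have H2 : cvgn (fun n => (u n : X * X).2).
  apply/cvg_nat_cauchyP => eps /H[N HN]; exists N => m n Nm Nn.
  by apply: le_trans (HN _ _ Nm Nn); rewrite [leRHS]prod_normE le_max lexx orbT.
have /cvg_ex[l1 /cvg_natP h1] := H1; have /cvg_ex[l2 /cvg_natP h2] := H2.
apply/cvg_ex; exists ((l1, l2) : direct_sum X X); apply/cvg_natP => eps eps0.
have [N1 HN1] := h1 _ eps0; have [N2 HN2] := h2 _ eps0.
exists (maxn N1 N2) => n; rewrite geq_max => /andP[/HN1 ? /HN2 ?].
by rewrite prod_normE ge_max; apply/andP.
Qed.

Lemma lincomb_fst (R : realType) (X Y : normedModType R) n a (h : nat -> X * Y) :
  (lincomb n a h).1 = lincomb n a (fst \o h).
Proof.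
elim: n => [|n IH]; first by rewrite /lincomb !big_ord0.
by rewrite /lincomb in IH *; rewrite !big_ord_recr /= -IH.
Qed.

Lemma lincomb_snd (R : realType) (X Y : normedModType R) n a (h : nat -> X * Y) :
  (lincomb n a h).2 = lincomb n a (snd \o h).
Proof.
elim: n => [|n IH]; first by rewrite /lincomb !big_ord0.
by rewrite /lincomb in IH *; rewrite !big_ord_recr /= -IH.
Qed.

(** * The interleaved sequence in the direct sum *)

Section interleaved_basis.
Variables (R : realType) (X : completeNormedModType R) (e : nat -> X).
Variables (M : nat -> nat) (lam : nat -> R).
Hypotheses (M0 : M 0 = 0%N) (Mlt : {homo M : i j / (i < j)%N}).

Let M2 i := (M i).*2.
Let M20 : M2 0 = 0%N. Proof. by rewrite /M2 M0. Qed.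
Let M2lt : {homo M2 : i j / (i < j)%N}.
Proof. by move=> i j /Mlt; rewrite /M2 ltn_double. Qed.

Definition block_vector i := \sum_(M i <= t < M i.+1) lam t *: e t.
Definition previous_block_vector i := if i is j.+1 then block_vector j else 0.

(* The summand [block_vector] or [previous_block_vector] keeps the partial
   sums of both components close to those of the interleaved sequence. *)
Definition interleaved_basis t : X * X :=
  let i := block_of M2 t in
  if (t < M i + M i.+1)%N then (e (t - M i)%N, previous_block_vector i)
  else (block_vector i, e (t - M i.+1)%N).

Lemma interleaved_basis_first m :
  interleaved_basis (first_copy M m) = (e m, previous_block_vector (block_of M m)).
Proof.
have := block_ofP M0 Mlt m; rewrite /interleaved_basis /first_copy.
set i := block_of M m => Hi.
rewrite (@block_of_uniq _ M20 M2lt _ i) ?ifT ?addnK//; rewrite /M2; lia.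
Qed.

Lemma interleaved_basis_second m :
  interleaved_basis (second_copy M m) = (block_vector (block_of M m), e m).
Proof.
have := block_ofP M0 Mlt m; rewrite /interleaved_basis /second_copy.
set i := block_of M m => Hi.
rewrite (@block_of_uniq _ M20 M2lt _ i) ?ifF ?addnK//; rewrite /M2; lia.
Qed.

Let sum_blocks (V : normedModType R) (F : nat -> R) (v : nat -> V) I :
  \sum_(m < M I) F m *: v (block_of M m) =
  \sum_(i < I) (\sum_(M i <= m < M i.+1) F m) *: v i.
Proof.
rewrite (big_partition_nat M0 Mlt (fun m => F m *: v (block_of M m))).
apply: eq_bigr => i _; rewrite scaler_suml; apply: eq_big_nat => m Hm.
by rewrite (block_of_uniq M0 Mlt Hm).
Qed.

Lemma lincomb_interleaved_basis I (a : nat -> R) :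
  (forall t, ((M I).*2 <= t)%N -> a t = 0) ->
  lincomb (M I).*2 a interleaved_basis =
  (lincomb (M I) (first_coef M lam a) e, lincomb (M I) (second_coef M lam a) e).
Proof.
move=> supp; apply: injective_projections => /=.
  rewrite lincomb_fst lincomb_first_coef// {1}/lincomb.
  rewrite (big_copies M0 Mlt (fun t => a t *: (fst \o interleaved_basis) t)).
  congr (_ + _); first by apply: eq_bigr => m _; rewrite /= interleaved_basis_first.
  apply: (etrans _ (sum_blocks (a \o second_copy M) block_vector I)).
  by apply: eq_bigr => m _; rewrite /= interleaved_basis_second.
rewrite lincomb_snd lincomb_second_coef// {1}/lincomb addrC.
rewrite (big_copies M0 Mlt (fun t => a t *: (snd \o interleaved_basis) t)).
congr (_ + _); last by apply: eq_bigr => m _; rewrite /= interleaved_basis_second.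
rewrite (eq_bigr (fun m : 'I_(M I) => a (first_copy M m) *:
  previous_block_vector (block_of M m))) => [|m _]; last by rewrite /= interleaved_basis_first.
rewrite (sum_blocks (a \o first_copy M) previous_block_vector).
(* [previous_block_vector] shifts the index of the masses by one. The sum can be extended by the
   block [I], where [a] vanishes, while its term of index 0 is zero. *)
have massI : first_mass M a I = 0.
  rewrite /first_mass big1_seq// => m; rewrite mem_index_iota => /andP[_ Hm].
  by apply: supp; rewrite /first_copy (block_of_uniq M0 Mlt Hm); lia.
have -> : \sum_(i < I) first_mass M a i *: previous_block_vector i =
    \sum_(i < I.+1) first_mass M a i *: previous_block_vector i.
  by rewrite [RHS]big_ord_recr /= massI scale0r addr0.
by rewrite big_ord_recl /= scaler0 add0r.
Qed.

Let span : set (X * X) := [set v | exists n a, v = lincomb n a interleaved_basis].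

Let span0 : span 0.
Proof. by exists 0%N, (fun=> 0); rewrite /lincomb big_ord0. Qed.

Let spanZD k u v : span u -> span v -> span (k *: u + v).
Proof.
move=> [n [a ->]] [m [b ->]].
exists (maxn n m), (fun i => k * (if (i < n)%N then a i else 0) + (if (i < m)%N then b i else 0)).
by rewrite lincombDl lincombZl -!lincomb_widen ?leq_maxl ?leq_maxr.
Qed.

Let span_sum (r : seq nat) (c : nat -> R) (v : nat -> X * X) :
  (forall i, i \in r -> span (v i)) -> span (\sum_(i <- r) c i *: v i).
Proof.
elim: r => [|i r IH] H; first by rewrite big_nil.
rewrite big_cons; apply: spanZD; first by apply: H; rewrite mem_head.
by apply: IH => j jr; apply: H; rewrite in_cons jr orbT.
Qed.

Let spanB u v : span u -> span v -> span (u - v).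
Proof. by move=> su sv; rewrite addrC -scaleN1r; exact: spanZD. Qed.

Let span_basis t : span (interleaved_basis t).
Proof.
exists t.+1, (fun i => (i == t)%:R).
rewrite /lincomb big_ord_recr /= eqxx scale1r big1 ?add0r// => i _.
by rewrite (ltn_eqF (ltn_ord i)) scale0r.
Qed.

Let pair0E (r : seq nat) (c : nat -> R) (x : nat -> X) :
  \sum_(i <- r) c i *: ((x i, 0) : X * X) = (\sum_(i <- r) c i *: x i, 0).
Proof.
elim: r => [|i r IH]; first by rewrite !big_nil.
by rewrite !big_cons IH; apply: injective_projections => //=; rewrite scaler0 addr0.
Qed.

Let pair1E (r : seq nat) (c : nat -> R) (x : nat -> X) :
  \sum_(i <- r) c i *: ((0, x i) : X * X) = (0, \sum_(i <- r) c i *: x i).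
Proof.
elim: r => [|i r IH]; first by rewrite !big_nil.
by rewrite !big_cons IH; apply: injective_projections => //=; rewrite scaler0 addr0.
Qed.

(** By induction on blocks: a first copy yields [(e k, 0)] once the previous block vector is
    available in the second component. A second copy then yields [(0, e m)], since the block vector
    to be removed involves only the vectors [(e k, 0)] of the same block. *)
Let span_pairs I m : (m < M I)%N -> span (e m, 0) /\ span (0, e m).
Proof.
elim: I m => [|I IH] m mI; first by rewrite M0 in mI.
have [h|h] := ltnP m (M I); first exact: IH.
have first k : (M I <= k < M I.+1)%N -> span (e k, 0).
  move=> Hk; have -> : (e k, 0) = interleaved_basis (first_copy M k) -
      (0, previous_block_vector (block_of M k)).
    rewrite interleaved_basis_first; apply: injective_projections => /=.
      by rewrite subr0.
    by rewrite subrr.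
  apply: spanB => //; rewrite (block_of_uniq M0 Mlt Hk); case: I IH {mI h Hk} => [|I] IH //=.
  rewrite /block_vector -pair1E; apply: span_sum => i; rewrite mem_index_iota => /andP[_ Hi].
  by have [] := IH i Hi.
split; first by apply: first; rewrite h.
have -> : (0, e m) = interleaved_basis (second_copy M m) - (block_vector (block_of M m), 0).
  rewrite interleaved_basis_second; apply: injective_projections => /=.
    by rewrite subrr.
  by rewrite subr0.
have Hm : (M I <= m < M I.+1)%N by rewrite h.
apply: spanB => //; rewrite (block_of_uniq M0 Mlt Hm).
rewrite /block_vector -pair0E; apply: span_sum => i; rewrite mem_index_iota.
exact: first.
Qed.

Lemma interleaved_basis_dense : schauder_basis e -> forall (y : X * X) (eps : R), 0 < eps ->
  exists n a, `|y - lincomb n a interleaved_basis| <= eps.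
Proof.
move=> eS [y1 y2] eps eps0.
have [a1 [/cvg_natP/(_ _ eps0)[n1 Hn1] _]] := eS y1.
have [a2 [/cvg_natP/(_ _ eps0)[n2 Hn2] _]] := eS y2.
have Me m : span (e m, 0) /\ span (0, e m).
  by apply: (@span_pairs m.+1); exact: (homo_ltn_geq Mlt m.+1).
have : span (lincomb n1 a1 e, lincomb n2 a2 e).
  have -> : (lincomb n1 a1 e, lincomb n2 a2 e) =
      1 *: ((lincomb n1 a1 e, 0) : X * X) + (0, lincomb n2 a2 e).
    by rewrite scale1r; apply: injective_projections; rewrite /= ?addr0 ?add0r.
  rewrite /lincomb -!(big_mkord xpredT (fun i => _ i *: e i)) -pair0E -pair1E.
  by apply: spanZD; apply: span_sum => i _; have [] := Me i.
move=> [n [a E]]; exists n, a; rewrite -E prod_normE ge_max /=.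
by rewrite -!seriesE Hn1// Hn2.
Qed.

End interleaved_basis.

Lemma not_strongly_summing_isomorphic (R : realType) (X : completeNormedModType R)
    (e : nat -> X) : conditional_spreading_basis e -> ~ strongly_summing e ->
  isomorphic X (direct_sum X X).
Proof.
move=> ecs ness; have [C eC] := conditional_spreading_bounds ecs.
have [C0 eK _ _ [_ projC]] := eC.
have [D D0 eD] := le_summing eC ness.
have uD P n a := differences_mask C0 eK P n a.
have [sq [sq0 Hsq]] := @dependent_choice_nat (nat * (nat -> R)) (fun i p p' =>
   [/\ (p.1 < p'.1)%N, forall t, 0 <= p'.2 t, \sum_(p.1 <= t < p'.1) p'.2 t = 1 &
      `|\sum_(p.1 <= t < p'.1) p'.2 t *: differences e t| <= 2^-1 ^+ i])
  (0%N, fun=> 0) (fun i p => ltac:(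
    have [n [lam [h1 h2 h3 h4 _]]] := small_convex_combination ecs eC uD uD p.1 (half_exp_gt0 R i);
    by exists (n, lam))).
pose M i := (sq i).1.
have M0 : M 0 = 0%N by rewrite /M sq0.
have Mlt : {homo M : i j / (i < j)%N} by apply: homo_ltnS => i; case: (Hsq i).
pose lam t := (sq (block_of M t).+1).2 t.
have lam0 t : 0 <= lam t by case: (Hsq (block_of M t)) => _ + _ _; exact.
have lamE i t : (M i <= t < M i.+1)%N -> lam t = (sq i.+1).2 t.
  by move=> Ht; rewrite /lam (block_of_uniq M0 Mlt Ht).
have lam1 i : \sum_(M i <= t < M i.+1) lam t = 1.
  case: (Hsq i) => _ _ <- _; apply: eq_big_nat => t; exact: lamE.
have lamu i : `|\sum_(M i <= t < M i.+1) lam t *: differences e t| <= 2^-1 ^+ i.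
  case: (Hsq i) => _ _ _; rewrite (@eq_big_nat _ _ _ _ _ _ (fun t => lam t *: differences e t))//.
  by move=> t Ht; rewrite -lamE.
pose g := interleaved_basis e M lam.
pose K1 := D * (8 * C + 2 * C * C).
pose K2 := D * (7 * C + 24 * C * C).
have CC : 0 < C * C by rewrite mulr_gt0.
have K10 : 0 < K1 by rewrite mulr_gt0//; lra.
have K20 : 0 < K2 by rewrite mulr_gt0//; lra.
have K2i : 0 < K2^-1 by rewrite invr_gt0.
apply: (@equivalent_basis_isomorphic R X (direct_sum X X) e g K2^-1 K1) => //.
- by case: ecs.
- move=> n a.
  (* Padding by zeros extends the combination to full pairs of blocks. *)
  pose b t := if (t < n)%N then a t else 0.
  have nM : (n <= (M n).*2)%N.
    by rewrite -addnn (leq_trans (homo_ltn_geq Mlt n))// leq_addr.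
  have supp t : ((M n).*2 <= t)%N -> b t = 0.
    by move=> h; rewrite /b ltnNge (leq_trans nM h).
  rewrite !(lincomb_widen _ _ nM) -/b (lincomb_interleaved_basis e lam M0 Mlt supp).
  rewrite prod_normE; apply/andP; split.
    by rewrite ler_pdivrMl//; exact: (le_first_second_coef eC D0 eD M0 Mlt lam0 lam1 lamu supp).
  rewrite ge_max; apply/andP; split; last first.
    exact: (second_coef_le eC D0 eD M0 Mlt lam0 lam1 lamu supp).
  apply: le_trans (first_coef_le eC D0 eD M0 Mlt lam0 lam1 lamu supp) _.
  by rewrite ler_wpM2r// ler_wpM2l ?(ltW D0)// lerD2r ler_wpM2r ?(ltW C0)// ler_nat.
- exact: prod_cauchy_cvg.
- by apply: interleaved_basis_dense => //; case: ecs.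
Qed.

(** * The theorem *)

Lemma isomorphic_embeds (R : realType) (X Y : normedModType R) :
  isomorphic X Y -> embeds Y X.
Proof.
move=> [T [[c [C [c0 C0 TcC]]] [S TS ST]]].
have S_lin : linear S.
  by move=> k u v; apply: (can_inj TS); rewrite ST linearP !ST.
exists (HB.pack_for {linear Y -> X} S (GRing.isLinear.Build _ _ _ _ S S_lin)).
exists C^-1, c^-1; split; rewrite ?invr_gt0// => y /=.
have := TcC (S y); rewrite ST => /andP[h1 h2].
by rewrite ler_pdivrMl// h2 ler_pdivlMl.
Qed.

(** Only the vectors [(al *: v, be *: v)] matter. Their norm is the maximum of [|al|] and [|be|]
    times that of [v], which gives the two-sided estimate for each combination of the copies. *)
Lemma no_double_embedding (R : realType) (X : completeNormedModType R) (e : nat -> X)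
    (W : normedModType R) (z : nat -> W) (D : R) :
  conditional_spreading_basis e -> strongly_summing e -> 0 < D ->
  (forall n a, `|lincomb n a z| <= D * `|lincomb n a e|) ->
  (forall n a, `|lincomb n a e| <= D * (`|lincomb n a z| + `|lincomb n a (differences e)|)) ->
  ~ embeds (direct_sum W W) X.
Proof.
move=> ecs ess D0 ze ez [T [c [K [c0 K0 TcK]]]].
have [C eC] := conditional_spreading_bounds ecs.
have c'0 : 0 < c^-1 by rewrite invr_gt0.
pose x i := T ((z i, 0) : W * W); pose y i := T ((0, z i) : W * W).
apply: (@no_double_copy _ _ _ _ ecs eC W z x y (D + c^-1 + K)) => //.
- by rewrite !addr_gt0.
- by move=> n a; rewrite (le_trans (ze n a))// ler_wpM2r// -addrA lerDl addr_ge0// ltW.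
- move=> n a; rewrite (le_trans (ez n a))// ler_wpM2r ?addr_ge0//.
  by rewrite -addrA lerDl addr_ge0// ltW.
move=> al be n a m; set v := lincomb n a z.
have E : lincomb n a (fun i => al *: x i + be *: y i) = T ((al *: v, be *: v) : W * W).
  rewrite /x /y /v; elim: n {v} => [|n IH].
    by rewrite /lincomb !big_ord0 !scaler0 (_ : (0, 0) = 0 :> W * W)// linear0.
  rewrite /lincomb in IH *; rewrite !big_ord_recr /= IH.
  rewrite -!linearZ -linearD -linearZ -linearD; congr (T _).
  apply: injective_projections => /=; rewrite [RHS]scalerDr; congr (_ + _).
    by rewrite scaler0 addr0 !scalerA mulrC.
  by rewrite scaler0 add0r !scalerA mulrC.
have N : `|((al *: v, be *: v) : W * W)| = m * `|v|.
  by rewrite prod_normE /= !normrZ -maxr_pMl.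
have := TcK (al *: v, be *: v); rewrite -E N => /andP[h1 h2].
have v0 : 0 <= m * `|v| by rewrite mulr_ge0// le_max normr_ge0.
split.
  apply: (@le_trans _ _ (c^-1 * `|lincomb n a (fun i => al *: x i + be *: y i)|)).
    by rewrite ler_pdivlMl.
  by rewrite ler_wpM2r// -addrA addrCA lerDl addr_ge0// ltW.
by rewrite (le_trans h2)// ler_wpM2r// lerDr addr_ge0// ltW.
Qed.

Lemma norm_lincomb_block_average_le (R : realType) (X : normedModType R) (e : nat -> X)
    (K : R) n a N : (0 < N)%N -> 0 <= K -> uniformly_spreading K e ->
  `|lincomb n a (block_average e N)| <= K * `|lincomb n a e|.
Proof.
move=> N0 K0 eK.
have -> : lincomb n a (block_average e N) =
    average N (fun j => lincomb n a (fun i => e (i * N + j)%N)).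
  by rewrite average_lincomb; apply: eq_lincomb => i _; rewrite block_averageE.
apply: norm_average_le => // j jN; apply: (spread_le eK (f := fun i => i * N + j)%N).
by move=> i k ik; rewrite ltn_add2r ltn_mul2r N0.
Qed.

(** The corresponding estimates for averages of length [N] have constants independent of [N].
    Comparing [nu] with the norm costs [K] or [k^-1], and the limit in [N] replaces the averages by
    [z]. *)
Lemma convex_block_homogeneous_part_bounds (R : realType) (X : completeNormedModType R)
    (e : nat -> X) (Z : normedModType R) (z : nat -> Z) :
  conditional_spreading_basis e -> convex_block_homogeneous_part e z ->
  exists2 D : R, 0 < D &
  (forall n a, `|lincomb n a z| <= D * `|lincomb n a e|) /\
  (forall n a, `|lincomb n a e| <= D * (`|lincomb n a z| + `|lincomb n a (differences e)|)).
Proof.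
move=> ecs [nu [[_ _ [k [K [k0 K0 nuE]]]] _ nuz]].
have [C [C0 eK _ _ _]] := conditional_spreading_bounds ecs.
have lim n a (eps : R) : 0 < eps -> exists N, (0 < N)%N /\
    `| `|lincomb n a z| - nu (lincomb n a (block_average e N))| <= eps.
  move=> eps0; have [N HN] := (@cvg_natP R R^o _ _).1 (nuz n a) _ eps0.
  by exists N.+1; split=> //; exact: HN.
exists (K * C + C * k^-1 + C * C) => [|].
  by rewrite !addr_gt0 ?mulr_gt0 ?invr_gt0.
have k'0 : 0 < k^-1 by rewrite invr_gt0.
have Ck0 : 0 < C * k^-1 by rewrite mulr_gt0.
have CC0 : 0 < C * C by rewrite mulr_gt0.
have KC0 : 0 < K * C by rewrite mulr_gt0.
split=> n a.
  apply: (@le_trans _ _ (K * C * `|lincomb n a e|)); last by rewrite ler_wpM2r//; lra.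
  apply: (@le_addM_gt0 _ _ _ 1) => eps eps0; have [N [N0 HN]] := lim n a _ eps0.
  have /andP[_ h] := nuE (lincomb n a (block_average e N)).
  have := norm_lincomb_block_average_le n a N0 (ltW C0) eK; rewrite -(ler_pM2l K0).
  move: HN; rewrite ler_norml; lra.
apply: (@le_trans _ _ (C * k^-1 * `|lincomb n a z| + C * C * `|lincomb n a (differences e)|)).
  apply: (@le_addM_gt0 _ _ _ (C * k^-1)) => eps eps0; have [N [N0 HN]] := lim n a _ eps0.
  have /andP[h _] := nuE (lincomb n a (block_average e N)).
  apply: le_trans (le_average_differences C0 eK n a N0) _.
  move: h; rewrite -ler_pdivlMl// -(ler_pM2l C0) => h.
  have : nu (lincomb n a (block_average e N)) <= `|lincomb n a z| + eps.
    by move: HN; rewrite ler_norml; lra.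
  rewrite -(ler_pM2l Ck0); lra.
rewrite mulrDr lerD// ler_wpM2r//; lra.
Qed.

Theorem theorem8p1 (R : realType) (X : completeNormedModType R) (e : nat -> X)
    (he : conditional_spreading_basis e) :
  (strongly_summing e ->
    (forall (Z : completeNormedModType R) (z : nat -> Z),
        convex_block_homogeneous_part e z ->
        closed_span z = [set: Z] ->
        ~ embeds (direct_sum Z Z) X)
    /\ ~ embeds (direct_sum X X) X)
  /\
  (~ strongly_summing e <-> isomorphic X (direct_sum X X)).
Proof.
have noX : strongly_summing e -> ~ embeds (direct_sum X X) X.
  (* For [z = e] both estimates hold with constant 1. *)
  move=> ess; apply: (no_double_embedding (z := e) he ess ltr01) => n a; rewrite mul1r//.
  by rewrite lerDl.
split.
  move=> ess; split=> [Z z zhom _|]; last exact: noX.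
  have [D D0 [ze ez]] := convex_block_homogeneous_part_bounds he zhom.
  exact: no_double_embedding he ess D0 ze ez.
split; first exact: not_strongly_summing_isomorphic.
by move=> iso ess; exact: noX ess (isomorphic_embeds iso).
Qed.
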